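(* Let $X$ be a one-dimensional Lévy process with characteristics $(b,c,F)$; put $\sigma=\sqrt c$. Let $\Delta_n>0$ with $\Delta_n\to0$ and assume $T_n=n\Delta_n\to\infty$. Let $\overline V^n(f)_t=\sum_{i=1}^{[nt]}f(\Delta^n_iX)$ and $\overline V'^n(f)_t=\sum_{i=1}^{[nt]}f(\Delta^n_iX/\sqrt{\Delta_n})$. (i) The processes $\frac1{T_n}\overline V^n(f)$ converge u.c.p. to a limit $v(f)t$ in the following cases: (a) with $v(f)=F(f)$, when $f$ is bounded and one of the following holds: $f\in\mathcal E''_2\cap C^{0,F}$; or $f\in\mathcal E'_r\cap C^{0,F}$ for some $r\in I\cap(1,2)$, and $c=0$; or $f\in\mathcal E''_1\cap C^{0,F}$, $1\in I$ and $c=0$; or $f\in\mathcal E'_r\cap C^{0,F}$ for some $r\in I\cap(0,1]$, and $c=\overline b=0$; (b) with $v(f)=F(f)+c$, when $f\in\mathcal E_2\cap C^{0,F}$ is bounded; (c) with $v(f)=F(f)+|\overline b|$, when $f\in\mathcal E_1\cap C^{0,F}$ is bounded, $c=0$ and $1\in I$. (ii) If $c>0$ and $f\in\mathcal E_r$ is bounded, for some $r\in(0,2)$, the processes $\frac1{n\Delta_n^{r/2}}\overline V^n(f)_t$ converge u.c.p. to $c^{r/2}\mu_rt$. The same holds when $r\in[2,\infty)$ if there is no jump ($F=0$). (iii) If $c>0$ and $f$ is a bounded Borel function, the processes $\frac1n\overline V'^n(f)_t$ converge u.c.p. to $t\,\mathbb E(f(\sigma U))$.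
   Context: $X$ is a Lévy process with $X_0=0$; its characteristics are $b\in\mathbb R$, $c\ge0$ and a measure $F$ on $\mathbb R$ with $F(\{0\})=0$, $\int(x^2\wedge1)F(dx)<\infty$, such that $\mathbb E(e^{iuX_t})=\exp t\big(iub-\tfrac{cu^2}2+\int F(dx)(e^{iux}-1-iux1_{\{|x|\le1\}})\big)$. $\Delta^n_iX=X_{i\Delta_n}-X_{(i-1)\Delta_n}$. $F(f)=\int f\,dF$. $\phi_r(x)=1\wedge|x|^r$ for $r>0$, $\phi_0=1$; $I=\{r\ge0:F(\phi_r)<\infty\}$. If $1\in I$, $\overline b=b-\int_{\{|x|\le1\}}xF(dx)$. $U$ is a generic $\mathcal N(0,1)$ variable, $\mu_r=\mathbb E|U|^r$. Classes of Borel functions $f:\mathbb R\to\mathbb R$, for $r>0$: $\mathcal E_r$: $f$ of polynomial growth with $f(x)\sim|x|^r$ as $x\to0$; $\mathcal E'_r$: $f$ locally bounded with $f(x)=O(|x|^r)$ as $x\to0$; $\mathcal E''_r$: $f$ locally bounded with $f(x)=o(|x|^r)$ as $x\to0$ (in all cases $f(0)=0$). $C^{0,F}$ is the set of functions that are continuous at $F$-almost every point. $Y^n\to Y$ u.c.p. means $\sup_{s\le t}|Y^n_s-Y_s|\to0$ in probability for all $t>0$. *)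

(* Defs.v *)
From mathcomp Require Import all_boot all_order all_algebra.
From mathcomp Require Import complex.
From mathcomp Require Import all_classical all_reals all_analysis.

Set Implicit Arguments.
Unset Strict Implicit.
Unset Printing Implicit Defensive.

Import Order.TTheory GRing.Theory Num.Theory.
Import numFieldNormedType.Exports.

Local Open Scope classical_set_scope.
Local Open Scope ring_scope.

Definition cexp (R : realType) (z : R[i]) : R[i] :=
  (expR (complex.Re z) * cos (complex.Im z)
   +i* (expR (complex.Re z) * sin (complex.Im z)))%C.

Definition cintegral (d : measure_display) (T : measurableType d)
    (R : realType) (mu : {measure set T -> \bar R}) (g : T -> R[i]) : R[i] :=
  ((\int[mu]_x complex.Re (g x)) +i* (\int[mu]_x complex.Im (g x)))%C.

Section Levy.
Context (R : realType) (d : measure_display) (T : measurableType d).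
Variable P : probability T R.

Definition mutually_independent (n : nat) (Y : 'I_n -> T -> R) : Prop :=
  forall B : 'I_n -> set (measurableTypeR R), (forall i, measurable (B i)) ->
    P (\bigcap_(i in [set: 'I_n]) (Y i @^-1` B i)) =
    (\prod_(i < n) P (Y i @^-1` B i))%E.

Definition cadlag (x : R -> R) : Prop :=
  (forall t, 0 <= t -> x s @[s --> t^'+] --> x t) /\
  (forall t, 0 < t -> cvg (x s @[s --> t^'-])).

(* Only the times [t >= 0] are meaningful: the values of [X] at negative times
   are left unconstrained.  Equality in law is tested on Borel sets only, since
   a measure is a function on all sets, unspecified on the nonmeasurable ones. *)
Record is_levy_process (X : R -> {RV P >-> R}) : Prop := {
  levy_start : {ae P, forall w, X 0 w = 0} ;
  levy_independent_increments : forall (n : nat) (t : nat -> R),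
    0 <= t 0%N -> {homo t : i j / (i <= j)%N >-> i <= j} ->
    mutually_independent (fun i : 'I_n => X (t i.+1) \- X (t i)) ;
  levy_stationary_increments : forall s t : R, 0 <= s -> 0 <= t ->
    forall B : set (measurableTypeR R), measurable B ->
      P ((X (s + t) \- X s) @^-1` B) = P (X t @^-1` B) ;
  levy_cadlag : {ae P, forall w, cadlag (fun t => X t w)}
}.

Definition levy_exponent (b c : R) (F : {measure set (measurableTypeR R) -> \bar R})
    (u : R) : R[i] :=
  'i%C * (u * b)%:C%C - (c * u ^+ 2 / 2)%:C%C +
  cintegral F (fun x : R =>
    cexp ('i%C * (u * x)%:C%C) - 1 - 'i%C * (u * x * \1_[set y | `|y| <= 1] x)%:C%C).

Record has_characteristics (X : R -> {RV P >-> R}) (b c : R)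
    (F : {measure set (measurableTypeR R) -> \bar R}) : Prop := {
  characteristics_c_ge0 : 0 <= c ;
  characteristics_F0 : F [set 0] = 0%E ;
  characteristics_Fint : (\int[F]_x (Num.min (x ^+ 2) 1)%:E < +oo)%E ;
  characteristics_charfun : forall t u : R, 0 <= t ->
    cintegral P (fun w => cexp ('i%C * (u * X t w)%:C%C)) =
    cexp (t%:C%C * levy_exponent b c F u)
}.

(* The supremum is taken in the extended reals. *)
Definition cvg_ucp (Y : nat -> R -> T -> R) (Z : R -> T -> R) : Prop :=
  forall t : R, 0 < t -> forall e : R, 0 < e ->
    P [set w | (e%:E < ereal_sup [set `|Y n s w - Z s w|%:E | s in `[0%R, t]])%E]
      @[n --> \oo] --> 0%E.

Definition increment (X : R -> {RV P >-> R}) (delta : R) (i : nat) (w : T) : R :=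
  X (i%:R * delta) w - X (i.-1%:R * delta) w.

Definition Vbar (X : R -> {RV P >-> R}) (Delta : nat -> R) (f : R -> R)
    (n : nat) (t : R) (w : T) : R :=
  \sum_(1 <= i < (Num.truncn (n%:R * t)).+1) f (increment X (Delta n) i w).

Definition Vbar' (X : R -> {RV P >-> R}) (Delta : nat -> R) (f : R -> R)
    (n : nat) (t : R) (w : T) : R :=
  \sum_(1 <= i < (Num.truncn (n%:R * t)).+1)
     f (increment X (Delta n) i w / Num.sqrt (Delta n)).

End Levy.

Section LevyMeasure.
Context (R : realType).
Variable F : {measure set (measurableTypeR R) -> \bar R}.

Definition phi (r x : R) : R := if r == 0 then 1 else Num.min 1 (`|x| `^ r).

Definition I_set : set R :=
  [set r | 0 <= r /\ (\int[F]_x (phi r x)%:E < +oo)%E].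

(* Only meaningful when [I_set 1]: otherwise the integral may be the junk value
   of [Rintegral]. *)
Definition bbar (b : R) : R := b - \int[F]_(x in [set x : R | `|x| <= 1]) x.

Definition C0F : set (R -> R) :=
  [set f | {ae F, forall x : R, {for x, continuous (f : R -> R)}}].

End LevyMeasure.

Section Classes.
Context (R : realType).

Definition borel (f : R -> R) : Prop :=
  measurable_fun [set: measurableTypeR R] (f : measurableTypeR R -> measurableTypeR R).

Definition polynomial_growth (f : R -> R) : Prop :=
  exists (C : R) (p : nat), forall x, `|f x| <= C * (1 + `|x| ^+ p).

Definition locally_bounded (f : R -> R) : Prop :=
  forall x : R, bounded_near f (nbhs x).

Definition abs_pow (r : R) : R -> R := fun x => `|x| `^ r.

(* Full (not punctured) neighbourhoods of 0 are harmless here: for [r > 0] both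
   [f] and [abs_pow r] vanish at 0. *)
Definition classE (r : R) : set (R -> R) :=
  [set f | [/\ borel f, polynomial_growth f, f 0 = 0 &
               f ~_ (nbhs (0 : R)) (abs_pow r)]].

Definition classE' (r : R) : set (R -> R) :=
  [set f | [/\ borel f, locally_bounded f, f 0 = 0 &
               f =O_ (nbhs (0 : R)) (abs_pow r)]].

Definition classE'' (r : R) : set (R -> R) :=
  [set f | [/\ borel f, locally_bounded f, f 0 = 0 &
               f =o_ (nbhs (0 : R)) (abs_pow r)]].

Definition gauss_mean (g : R -> R) : R := \int[normal_prob (0 : R) 1]_u g u.

Definition gauss_moment (r : R) : R := gauss_mean (fun u => `|u| `^ r).

End Classes.

(* Main.v *)
Require Import Defs.
From HB Require Import structures.
From mathcomp Require Import all_boot all_order all_algebra.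
From mathcomp Require Import ring lra complex.
From mathcomp Require Import all_classical all_reals all_analysis measurable_realfun.

(* The increments over a mesh D are i.i.d. with the law of X_D, so a Chebyshev
   bound at the points of a coarse grid, together with the monotonicity in time
   of the sum of the |f(increment)|, reduces everything to the asymptotics of
   E f(X_D) and E f(X_D / sqrt D) as D -> 0, which are read off the
   characteristic function.

   Weighting the law of X_D / D by w(x) = 1 - exp(-x^2/2) gives finite measures
   that converge weakly to (c/2) delta_0 + w F, because multiplication by w acts
   on characteristic functions as a Gaussian second difference, in which drift
   and compensator cancel.  This settles functions that are O(x^2) at 0.  When
   c = 0, the mass that |x|^r puts near 0 is bounded by the dyadic sums
   sum_j 2^(-rj) (1 - cos(2^j x)), whose expectation is explicit; a drift is
   removed by translation.

   In the Gaussian scaling, |E e^(iuX_D/sqrt D)| <= e^(-cu^2/2) bounds all the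
   laws by one multiple of Lebesgue measure, so that weak convergence extends to
   all bounded Borel functions. *)

Set Implicit Arguments.
Unset Strict Implicit.
Unset Printing Implicit Defensive.

Import Order.TTheory GRing.Theory Num.Theory.
Import numFieldNormedType.Exports.

Local Open Scope classical_set_scope.
Local Open Scope ring_scope.

(** * Integrals of real functions *)

(** Characteristic functions enter only through the real integrals of [cos (u * x - a)]: the phase
    [a] recovers both the real and the imaginary part, and it absorbs translations of the law. The
    weight w(x) is the mean of 1 - cos(Ux) for a standard normal U, so that its effect on these
    integrals is explicit. It is comparable with min(x^2, 1), hence wF is finite. It vanishes at 0
    only, hence a bounded f equivalent to l x^2 at 0 is hw with h bounded and h(0) = 2l, and the
    atom c/2 gives back cl. For functions larger than x^2 at 0, weak convergence does not control
    the mass close to 0. That mass is computed for the reference function [phi r], and other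
    functions are compared with it. When r = 1 the reference limit has the defect |bbar|, which an
    O(|x|) function inherits up to a factor and an o(|x|) function does not see. In the law of large
    numbers the number of grid times does not depend on n. Variances tending to 0 then suffice,
    without a rate and without a maximal inequality; the price is that the moments of |f| have to be
    controlled along with those of f. *)

Section Toolbox.
Context {d} {T : measurableType d} {R : realType}.
Implicit Type mu : {measure set T -> \bar R}.

Lemma Rintegral_ae_dominated_cvg mu (f_ : nat -> T -> R) (f g : T -> R) :
  (forall n, measurable_fun setT (f_ n)) -> measurable_fun setT f ->
  {ae mu, forall x, f_ ^~ x @ \oo --> f x} ->
  mu.-integrable setT (EFin \o g) -> (forall n x, `|f_ n x| <= g x) ->
  \int[mu]_x f_ n x @[n --> \oo] --> \int[mu]_x f x.
Proof.
move=> mf_ mf ff gi fg.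
have [fi _ h] := @dominated_convergence _ T R mu setT measurableT
  (fun n => EFin \o f_ n) (EFin \o f) (EFin \o g)
  (fun n => iffRL (measurable_EFinP _ _) (mf_ n)) (iffRL (measurable_EFinP _ _) mf)
  ltac:(by apply: filterS ff => x fx _; apply: cvg_EFin => //; exact: nearW) gi
  ltac:(by apply/aeW => x n _; rewrite /= lee_fin fg).
apply: fine_cvg; rewrite fineK//.
exact: integrable_fin_num.
Qed.

Lemma Rintegral_dominated_cvg mu (f_ : nat -> T -> R) (f g : T -> R) :
  (forall n, measurable_fun setT (f_ n)) -> (forall x, f_ ^~ x @ \oo --> f x) ->
  mu.-integrable setT (EFin \o g) -> (forall n x, `|f_ n x| <= g x) ->
  \int[mu]_x f_ n x @[n --> \oo] --> \int[mu]_x f x.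
Proof.
move=> mf_ ff gi fg; apply: (Rintegral_ae_dominated_cvg mf_ _ _ gi fg).
  exact: (measurable_fun_cvg (h := f_)).
by apply/aeW.
Qed.

Lemma dominated_integrable mu (f g : T -> R) :
  measurable_fun setT f -> mu.-integrable setT (EFin \o g) ->
  (forall x, `|f x| <= g x) -> mu.-integrable setT (EFin \o f).
Proof.
move=> mf gi fg; apply: le_integrable gi => //; first exact/measurable_EFinP.
by move=> x _ /=; rewrite lee_fin (le_trans (fg x))// ler_norm.
Qed.

Lemma bounded_integrable mu (f : T -> R) (K : R) :
  (mu setT < +oo)%E -> measurable_fun setT f -> (forall x, `|f x| <= K) ->
  mu.-integrable setT (EFin \o f).
Proof.
move=> mufin mf fK; apply: measurable_bounded_integrable => //.
by exists K; split; [exact: num_real|move=> y /ltW Ky x _ /=; rewrite (le_trans (fK x))].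
Qed.

Lemma Rintegral_norm_le mu (f g : T -> R) :
  measurable_fun setT f -> mu.-integrable setT (EFin \o g) ->
  (forall x, `|f x| <= g x) -> `|\int[mu]_x f x| <= \int[mu]_x g x.
Proof.
move=> mf gi fg; have fi := dominated_integrable mf gi fg.
apply: (le_trans (le_normr_Rintegral _ fi)) => //.
by apply: le_Rintegral => //; exact: integrable_norm.
Qed.

Lemma integrable_measurable mu (f : T -> R) :
  mu.-integrable setT (EFin \o f) -> measurable_fun setT f.
Proof. by move=> /integrableP[/measurable_EFinP]. Qed.

Lemma integrableD_EFin mu (f g : T -> R) :
  mu.-integrable setT (EFin \o f) -> mu.-integrable setT (EFin \o g) ->
  mu.-integrable setT (EFin \o (fun x => f x + g x)).
Proof. by move=> fi gi; exact: (integrableD _ fi gi). Qed.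

Lemma integrableB_EFin mu (f g : T -> R) :
  mu.-integrable setT (EFin \o f) -> mu.-integrable setT (EFin \o g) ->
  mu.-integrable setT (EFin \o (fun x => f x - g x)).
Proof. by move=> fi gi; exact: (integrableB _ fi gi). Qed.

Lemma integrableZl_EFin mu (k : R) (f : T -> R) :
  mu.-integrable setT (EFin \o f) ->
  mu.-integrable setT (EFin \o (fun x => k * f x)).
Proof. by move=> fi; exact: (integrableZl _ k fi). Qed.

End Toolbox.

Section RFubini.
Context {d1 d2} {T1 : measurableType d1} {T2 : measurableType d2} {R : realType}.
Variables (m1 : {sigma_finite_measure set T1 -> \bar R})
          (m2 : {sigma_finite_measure set T2 -> \bar R}).

Lemma Rintegral_swap (f : T1 * T2 -> R) (g : T1 -> R) (h : T2 -> R) :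
  measurable_fun setT f ->
  m1.-integrable setT (EFin \o g) -> m2.-integrable setT (EFin \o h) ->
  (forall x y, `|f (x, y)| <= g x * h y) ->
  \int[m1]_x \int[m2]_y f (x, y) = \int[m2]_y \int[m1]_x f (x, y).
Proof.
move=> mf gi hi fgh.
have g'i := integrable_norm gi; have h'i := integrable_norm hi.
have fgh' x y : `|f (x, y)| <= `|g x| * `|h y|.
  by rewrite -normrM (le_trans (fgh x y))// ler_norm.
have fxi x : m2.-integrable setT (EFin \o (fun y => f (x, y))).
  apply: (@dominated_integrable _ _ _ m2 _ (fun y => `|g x| * `|h y|)) => //.
    exact: measurableT_comp.
  exact: (integrableZl_EFin _ h'i).
have fyi y : m1.-integrable setT (EFin \o (fun x => f (x, y))).
  apply: (@dominated_integrable _ _ _ m1 _ (fun x => `|h y| * `|g x|)) => //.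
  - exact: measurableT_comp.
  - exact: (integrableZl_EFin _ g'i).
  - by move=> x; rewrite mulrC.
have fi : (m1 \x m2)%E.-integrable setT (EFin \o f).
  have mg : measurable_fun setT g by exact: integrable_measurable gi.
  have mh : measurable_fun setT h by exact: integrable_measurable hi.
  apply/integrable12ltyP; first exact/measurable_EFinP.
  apply: (@le_lt_trans _ _ (\int[m1]_x (`|g x|%:E * (\int[m2]_y `|h y|%:E)))%E).
    apply: ge0_le_integral => //.
    - by move=> x _; apply: integral_ge0.
    - apply: (@measurable_fun_fubini_tonelli_F _ _ _ _ _ m2 (fun z => `|f z|%:E)%E) => //.
      exact/measurable_EFinP/measurableT_comp.
    - apply: emeasurable_funM => //.
      exact/measurable_EFinP/measurableT_comp.
    - move=> x _; rewrite -ge0_integralZl//; last exact/measurable_EFinP/measurableT_comp.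
      apply: ge0_le_integral => //.
      + by apply/measurable_EFinP; do 2 apply: measurableT_comp => //.
      + by apply: emeasurable_funM => //; apply/measurable_EFinP; apply: measurableT_comp.
      + by move=> y _; rewrite -EFinM lee_fin.
  have h'fin := integrable_fin_num measurableT h'i.
  rewrite ge0_integralZr//; first last.
  - exact: integral_ge0.
  - by apply/measurable_EFinP; apply: measurableT_comp.
  apply: lte_mul_pinfty => //; first exact: integral_ge0.
    exact: (integrable_fin_num measurableT g'i).
  by rewrite -ge0_fin_numE// integral_ge0.
rewrite /Rintegral; congr fine.
transitivity (\int[m1]_x \int[m2]_y (f (x, y))%:E)%E.
  by apply: eq_integral => x _; rewrite fineK//; exact: (integrable_fin_num measurableT (fxi x)).
rewrite (Fubini fi); apply: eq_integral => y _ /=.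
by rewrite fineK//; exact: (integrable_fin_num measurableT (fyi y)).
Qed.
End RFubini.

Section Density.
Local Open Scope ereal_scope.
Context {d} {T : measurableType d} {R : realType}.
Variables (mu nu : {measure set T -> \bar R}) (w : T -> R).
Hypothesis w0 : forall x, (0 <= w x)%R.
Hypothesis mw : measurable_fun setT w.
Hypothesis nuE : forall A, measurable A -> nu A = \int[mu]_(x in A) (w x)%:E.

Import HBNNSimple.

(** Simple functions, then monotone convergence. The density relation is assumed on measurable sets
    only, so the lemma serves [normal_prob] as well as [density_measure]. *)
Lemma ge0_integral_density (f : T -> \bar R) :
  (forall x, 0 <= f x) -> measurable_fun setT f ->
  \int[nu]_x f x = \int[mu]_x (f x * (w x)%:E).
Proof.
move=> f0 mf; pose h := nnsfun_approx measurableT mf.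
have mw' : measurable_fun setT (EFin \o w) by exact/measurable_EFinP.
have -> : \int[nu]_x f x = lim (\int[nu]_x (EFin \o h n) x @[n --> \oo]).
  have fE x : f x = lim ((EFin \o h n) x @[n --> \oo]).
    by apply/esym/cvg_lim => //; exact: cvg_nnsfun_approx.
  under eq_integral do rewrite fE.
  apply: monotone_convergence => //.
  - by move=> n; exact/measurable_EFinP.
  - by move=> n x _ //=; rewrite lee_fin.
  - by move=> x _ a b ab; rewrite lee_fin; exact/lefP/nd_nnsfun_approx.
have -> : \int[mu]_x (f x * (w x)%:E) =
    lim (\int[mu]_x ((EFin \o h n) x * (w x)%:E) @[n --> \oo]).
  have fg x : f x * (w x)%:E = lim (((EFin \o h n) x * (w x)%:E) @[n --> \oo]).
    by apply/esym/cvg_lim => //; apply: cvgeZr => //; exact: cvg_nnsfun_approx.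
  under eq_integral do rewrite fg.
  apply: monotone_convergence => [//| | |].
  - by move=> n; apply/emeasurable_funM => //; exact/measurable_EFinP.
  - by move=> n x _ /=; rewrite mule_ge0 ?lee_fin.
  - move=> x _ a b ab /=; rewrite lee_wpmul2r ?lee_fin//.
    exact/lefP/nd_nnsfun_approx.
congr (lim (_ @ \oo)); apply/funext => n.
transitivity (\int[nu]_x
   (\sum_(y \in range (h n)) (y * \1_(h n @^-1` [set y]) x)%:E)).
  by apply: eq_integral => t _; rewrite /= fimfunE -fsumEFin.
have indich m r : measurable_fun setT (fun x => (r * \1_(h m @^-1` [set r]) x)%:E).
  by apply: (measurable_comp measurableT) => //; exact: measurable_funM.
rewrite ge0_integral_fsum//; last by move=> m y _; exact: nnfun_muleindic_ge0.
transitivity (\int[mu]_x (\sum_(y \in range (h n))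
    (y * \1_(h n @^-1` [set y]) x)%:E * (w x)%:E)); last first.
  apply: eq_integral => x _.
  rewrite -ge0_mule_fsuml => [|y]; last exact: nnfun_muleindic_ge0.
  by rewrite fsumEFin //= -(fimfunE _ x).
rewrite ge0_integral_fsum//; last 2 first.
  - by move=> y; apply: emeasurable_funM.
  - by move=> m y _; rewrite mule_ge0 ?lee_fin// -lee_fin nnfun_muleindic_ge0.
apply: eq_fsbigr => r rhn.
under eq_integral do rewrite EFinM.
rewrite integralZl_indic_nnsfun => //.
under [RHS]eq_integral do rewrite EFinM -muleA.
rewrite [RHS]ge0_integralZl//.
- under [in RHS]eq_integral do rewrite muleC.
  rewrite [in RHS](eq_integral ((EFin \o w) \_ (h n @^-1` [set r]))); last first.
    by move=> x xE; rewrite epatch_indic.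
  by rewrite -integral_mkcond -nuE// integral_indic// setIT.
- by apply: emeasurable_funM => //; exact/measurable_EFinP.
- by move=> t _; rewrite mule_ge0 ?lee_fin.
- by move: rhn; rewrite inE => -[t _ <-]; rewrite lee_fin.
Qed.

Lemma integrable_density (f : T -> R) : measurable_fun setT f ->
  nu.-integrable setT (EFin \o f) <->
  mu.-integrable setT (EFin \o (fun x => f x * w x)%R).
Proof.
move=> mf.
have E : \int[nu]_x `|(f x)%:E| = \int[mu]_x `|(f x * w x)%:E|.
  rewrite ge0_integral_density//; last first.
    by apply/measurable_EFinP; exact: measurableT_comp.
  by apply: eq_integral => x _; rewrite EFinM abseM [`|(w x)%:E|]gee0_abs// lee_fin.
split=> /integrableP[_ h]; apply/integrableP; split.
- by apply/measurable_EFinP; exact: measurable_funM.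
- by rewrite -E.
- exact/measurable_EFinP.
- by rewrite E.
Qed.

Lemma integral_density (f : T -> R) : measurable_fun setT f ->
  \int[nu]_x (f x)%:E = \int[mu]_x (f x * w x)%:E.
Proof.
move=> mf; rewrite integralE [RHS]integralE.
have mf' : measurable_fun setT (EFin \o f) by exact/measurable_EFinP.
congr (_ - _); rewrite ge0_integral_density//;
  try (by apply: measurable_funepos => //); try (by apply: measurable_funeneg => //).
- apply: eq_integral => x _.
  by rewrite !funeposE maxe_pMl ?lee_fin// mul0e EFinM.
- apply: eq_integral => x _.
  by rewrite !funenegE maxe_pMl ?lee_fin// mul0e -!EFinN -mulNr EFinM.
Qed.

Lemma Rintegral_density (f : T -> R) : measurable_fun setT f ->
  (\int[nu]_x f x = \int[mu]_x (f x * w x))%R.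
Proof. by move=> mf; rewrite /Rintegral integral_density. Qed.

End Density.

Section DensityMeasure.
Context {d} {T : measurableType d} {R : realType}.
Variables (mu : {measure set T -> \bar R}) (w : T -> R).
Hypothesis w0 : forall x, 0 <= w x.
Hypothesis wi : mu.-integrable setT (EFin \o w).

(** The two proofs are arguments so that the measure and finiteness instances below, which rest on
    them, can be attached to this head symbol. *)
Definition density_measure of (forall x, 0 <= w x) &
  mu.-integrable setT (EFin \o w) := fun A => (\int[mu]_(x in A) (w x)%:E)%E.

Local Notation nu := (density_measure w0 wi).

Let nu0 : nu set0 = 0%E. Proof. exact: integral_set0. Qed.

Let nu_ge0 A : (0 <= nu A)%E.
Proof. by apply: integral_ge0 => x _; rewrite lee_fin. Qed.

Let nu_sigma_additive : semi_sigma_additive nu.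
Proof.
move=> /= A mA tA mUA.
have mw : measurable_fun setT (EFin \o w) by apply/measurable_EFinP; exact: integrable_measurable wi.
rewrite /density_measure ge0_integral_bigcup//=; last 2 first.
- exact: measurable_funTS.
- by move=> x _; rewrite lee_fin.
apply: is_cvg_ereal_nneg_natsum_cond => n _ _.
by apply: integral_ge0 => x _; rewrite lee_fin.
Qed.

HB.instance Definition _ := isMeasure.Build _ _ _ nu nu0 nu_ge0 nu_sigma_additive.

Let nu_fin : fin_num_fun nu.
Proof.
move=> A mA; rewrite ge0_fin_numE//; apply: (@le_lt_trans _ _ (nu setT)).
  by apply: le_measure => //; rewrite inE.
rewrite -ge0_fin_numE//; exact: (integrable_fin_num measurableT wi).
Qed.

HB.instance Definition _ := Measure_isFinite.Build _ _ _ nu nu_fin.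

End DensityMeasure.
(** * The standard normal law *)

Section Gauss.
Context {R : realType}.
Local Notation leb := (@lebesgue_measure R).
Local Notation N := (normal_prob (0 : R) 1).

(** Over [-k, k] the integral is a boundary term; dominated convergence lets k tend to infinity
    along the integers, where alone the decay of [F] is needed. *)
Lemma Rintegral_derivative_line (f F : R -> R) :
  continuous f -> (forall x : R, is_derive x (1 : R) F (f x)) ->
  leb.-integrable setT (EFin \o f) ->
  F k%:R @[k --> \oo] --> 0 -> F (- k%:R) @[k --> \oo] --> 0 ->
  \int[leb]_x f x = 0.
Proof.
move=> cf dF fi Fp Fm.
have mf : measurable_fun setT f by exact: integrable_measurable fi.
have cF : continuous F.
  by move=> x; apply: differentiable_continuous; apply/derivable1_diffP; case: (dF x).
have h1 : \int[leb]_x (f x * \1_(`[- k%:R, k%:R]) x) @[k --> \oo] --> \int[leb]_x f x.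
  apply: (@Rintegral_dominated_cvg _ _ _ leb _ _ (fun x => `|f x|)).
  - by move=> k; apply: measurable_funM => //; exact: measurable_indic.
  - move=> x; apply: cvg_near_cst; exists (Num.truncn `|x|).+1 => // k /= xk.
    rewrite indicE mem_set ?mulr1//= in_itv/= -ler_norml.
    by rewrite ltW// (lt_le_trans (truncnS_gt _))// ler_nat.
  - exact: integrable_norm.
  - move=> k x; rewrite normrM ler_piMr// indicE; case: (_ \in _) => /=; by rewrite ?normr1 ?normr0.
have h2 : (fun k : nat => \int[leb]_x (f x * \1_(`[- k%:R, k%:R]) x)) @ \oo --> (0 : R).
  apply: cvg_trans (_ : (fun k : nat => F k%:R - F (- k%:R)) @ \oo --> 0).
    apply: near_eq_cvg; exists 1%N => // k /= k0.
    have kk : (- k%:R < k%:R :> R) by rewrite (@lt_trans _ _ 0) ?oppr_lt0 ?ltr0n.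
    have FTC : (\int[leb]_(x in `[(- k%:R)%R, k%:R%R]) (f x)%:E = (F k%:R)%:E - (F (- k%:R))%:E)%E.
      apply: (@continuous_FTC2 R f F _ _ kk).
      - exact: continuous_subspaceT.
      - split; first by move=> x _; case: (dF x).
        + exact: cvg_at_right_filter (cF _).
        + exact: cvg_at_left_filter (cF _).
      - by move=> x _; rewrite derive1E; case: (dF x).
    rewrite -[LHS]/(fine ((F k%:R)%:E - (F (- k%:R))%:E)%E) -FTC integral_mkcond.
    congr fine; apply: eq_integral => x _.
    by rewrite epatch_indic.
  by rewrite -(subr0 0); exact: cvgB.
exact: cvg_unique h1 h2.
Qed.

Lemma normal_pdf01 (z : R) :
  normal_pdf 0 1 z = normal_peak 1 * expR (- z ^+ 2 / 2).
Proof.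
by rewrite normal_pdfE ?oner_eq0// /normal_fun subr0 expr1n.
Qed.

Lemma Rintegral_normal_prob (f : R -> R) : measurable_fun setT f ->
  \int[N]_z f z = \int[leb]_z (f z * normal_pdf 0 1 z).
Proof.
move=> mf; apply: Rintegral_density => //; first exact: normal_pdf_ge0.
exact: measurable_normal_pdf.
Qed.

Lemma integrable_normal_prob (f : R -> R) : measurable_fun setT f ->
  leb.-integrable setT (EFin \o (fun z => f z * normal_pdf 0 1 z)) ->
  N.-integrable setT (EFin \o f).
Proof.
move=> mf; apply: (iffRL (@integrable_density _ _ _ leb N (normal_pdf 0 1) _ _ _ f mf)) => //.
  exact: normal_pdf_ge0.
exact: measurable_normal_pdf.
Qed.

Lemma measurable_expR_sqr (a : R) : measurable_fun setT (fun z : R => expR (a * z ^+ 2)).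
Proof.
apply: measurableT_comp; first exact: measurable_expR.
by apply: measurable_funM => //; exact: exprn_measurable.
Qed.

(** The product of the integrand with the standard normal density is s times the centred normal
    density of standard deviation s = (1 + A)^(-1/2). Negative values of A provide dominating
    functions; positive ones give the constant of [lipschitz_le_lebesgue]. *)
Lemma normal_expR_sqr (A : R) : -1 < A ->
  N.-integrable setT (EFin \o (fun z => expR (- (A / 2) * z ^+ 2))) /\
  \int[N]_z expR (- (A / 2) * z ^+ 2) = (Num.sqrt (1 + A))^-1.
Proof.
move=> A1; have A0 : 0 < 1 + A by lra.
set s := (Num.sqrt (1 + A))^-1.
have s0 : 0 < s by rewrite invr_gt0 sqrtr_gt0.
have s2 : s ^+ 2 = (1 + A)^-1 by rewrite exprVn sqr_sqrtr// ltW.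
have E (z : R) : expR (- (A / 2) * z ^+ 2) * normal_pdf 0 1 z = s * normal_pdf 0 s z.
  rewrite normal_pdf01 normal_pdfE ?gt_eqF// /normal_fun subr0 s2.
  rewrite mulrCA -expRD mulrA; congr (_ * expR _).
    rewrite /normal_peak expr1n mul1r -mulrnAr sqrtrM ?sqr_ge0// sqrtr_sqr gtr0_norm//.
    by rewrite invfM mulrA divff ?mul1r// gt_eqF.
  by rewrite -mulr_natr; field; rewrite !gt_eqF.
have i : leb.-integrable setT (EFin \o (fun z => s * normal_pdf 0 s z)).
  exact: (integrableZl_EFin _ (integrable_normal_pdf 0 s)).
split.
  apply: integrable_normal_prob; first exact: measurable_expR_sqr.
  by rewrite (_ : (fun z => _) = (fun z => s * normal_pdf 0 s z))//; exact/funext.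
rewrite Rintegral_normal_prob; last exact: measurable_expR_sqr.
under eq_Rintegral do rewrite E.
rewrite RintegralZl//; last exact: integrable_normal_pdf.
by rewrite /Rintegral integral_normal_pdf mulr1.
Qed.

Lemma integrable_normal_sqr : N.-integrable setT (EFin \o (fun z : R => z ^+ 2)).
Proof.
(* With A = -1/2 the integrand is exp(z^2/4), and 4 exp(z^2/4) >= z^2. *)
have [i _] := @normal_expR_sqr (- 2^-1) ltac:(lra).
apply: dominated_integrable (integrableZl_EFin 4 i) _ => [|x].
  exact: exprn_measurable.
rewrite ger0_norm ?sqr_ge0//.
have := expR_ge1Dx (- (- 2^-1 / 2) * x ^+ 2); lra.
Qed.

Lemma integrable_normal_id : N.-integrable setT (EFin \o (fun z : R => z)).
Proof.
have i1 : N.-integrable setT (EFin \o (fun=> 1 : R)).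
  exact: finite_measure_integrable_cst.
apply: dominated_integrable (integrableD_EFin i1 integrable_normal_sqr) _ => [|x].
  exact: measurable_id.
by rewrite ler_norml; apply/andP; split; nra.
Qed.

End Gauss.

(** * Elementary inequalities for sine and cosine *)

Section Trig.
Context {R : realType}.
Implicit Type x : R.

Lemma norm_sin_le x : `|sin x| <= `|x|.
Proof.
wlog x0 : x / 0 < x => [hw|].
  have [x0|x0|<-] := ltgtP 0 x; [exact: hw| |by rewrite sin0 normr0].
  by have := hw (- x); rewrite oppr_gt0 sinN !normrN; exact.
have [c _] := MVT x0 (fun y _ => is_derive_sin y)
  (continuous_subspaceT (@continuous_sin R)).
rewrite sin0 !subr0 => ->; rewrite normrM ler_piMl// ler_norml cos_geN1 cos_le1//.
Qed.

Lemma cos_half x : 1 - cos x = 2 * sin (x / 2) ^+ 2.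
Proof.
rewrite {1}(_ : x = (x / 2) *+ 2) ?cos_mulr2n; last by field.
have := cos2Dsin2 (x / 2); rewrite -mulr_natr; lra.
Qed.

Lemma one_sub_cos_ge0 x : 0 <= 1 - cos x.
Proof. by rewrite subr_ge0 cos_le1. Qed.

Lemma one_sub_cos_le2 x : 1 - cos x <= 2.
Proof. by have := cos_geN1 x; lra. Qed.

Lemma one_sub_cos_le x : 1 - cos x <= x ^+ 2 / 2.
Proof.
rewrite cos_half -real_normK ?num_real//.
have := norm_sin_le (x / 2); rewrite normrM [ `|2^-1| ]ger0_norm// => h.
have := normr_ge0 (sin (x / 2)); rewrite -[X in _ <= X / 2]real_normK ?num_real//.
nra.
Qed.

Lemma norm_sin_sub_le x : `|sin x - x| <= `|x| ^+ 3 / 2.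
Proof.
wlog x0 : x / 0 < x => [hw|].
  have [x0|x0|<-] := ltgtP 0 x; [exact: hw| |by rewrite sin0 subrr normr0 expr0n mul0r].
  have := hw (- x); rewrite oppr_gt0 sinN -opprD !normrN; exact.
have cf : continuous (fun y : R => sin y - y).
  by move=> y; apply: continuousB; [exact: continuous_sin|exact: cvg_id].
have df (y : R) : is_derive y (1 : R) (fun y => sin y - y) (cos y - 1).
  exact: is_deriveB.
have [c] := MVT x0 (fun y _ => df y) (continuous_subspaceT cf).
rewrite in_itv/= => /andP[c0 cx]; rewrite sin0 !subr0 => ->.
rewrite normrM distrC [ `|1 - cos c| ]ger0_norm ?one_sub_cos_ge0// gtr0_norm//.
rewrite exprSr mulrAC ler_wpM2r//; first exact: ltW.
by rewrite (le_trans (one_sub_cos_le c))// ler_wpM2r// lerXn2r// ?nnegrE ltW.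
Qed.

(** With y = x/2 the difference is 2 (sin y - y)(sin y + y). The constant 1/8 is larger than
    Taylor's 1/24 but is all that is needed. *)
Lemma one_sub_cos_approx x : `|1 - cos x - x ^+ 2 / 2| <= x ^+ 4 / 8.
Proof.
rewrite cos_half; set y := x / 2.
have -> : x = 2 * y by rewrite /y; field.
rewrite (_ : _ - _ = 2 * ((sin y - y) * (sin y + y))); last by field.
rewrite !normrM ger0_norm//.
have h1 := norm_sin_sub_le y.
have h2 : `|sin y + y| <= 2 * `|y|.
  by rewrite (le_trans (ler_normD _ _))// mulr_natl mulr2n lerD2r norm_sin_le.
rewrite (_ : (2 * y) ^+ 4 / 8 = 2 * ((`|y| ^+ 3 / 2) * (2 * `|y|))).
  by rewrite ler_wpM2l// ler_pM.
by rewrite exprMn (exprM y 2 2) -[y ^+ 2]real_normK ?num_real//; field.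
Qed.

(** The constant is 1/2 - 1/8, because x^4 <= x^2 on this range. *)
Lemma one_sub_cos_ge x : `|x| <= 1 -> 3 / 8 * x ^+ 2 <= 1 - cos x.
Proof.
move=> x1; have := one_sub_cos_approx x; rewrite ler_norml => /andP[+ _].
have : x ^+ 2 <= 1 by rewrite -real_normK ?num_real// expr_le1.
by rewrite (exprM x 2 2); have := sqr_ge0 x; nra.
Qed.

Lemma norm_sin_sub_le_sqr x : `|sin x - x| <= 2 * x ^+ 2.
Proof.
have := norm_sin_sub_le x; rewrite -[x ^+ 2]real_normK ?num_real//.
have := normr_ge0 x; have [x1 _ h|x1 _ _] := leP `|x| 1.
  apply: (le_trans h); rewrite exprSr; have := sqr_ge0 `|x|; nra.
rewrite (le_trans (ler_normB _ _))//; have := norm_sin_le x; nra.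
Qed.

Lemma norm_sin_sub_le_norm x : `|sin x - x| <= 2 * `|x|.
Proof.
by rewrite (le_trans (ler_normB _ _))// mulr_natl mulr2n lerD2r norm_sin_le.
Qed.

Lemma cos_lipschitz x y : `|cos x - cos y| <= `|x - y|.
Proof.
have -> : cos x - cos y = - 2 * (sin ((x - y) / 2) * sin ((x + y) / 2)).
  set a := (x - y) / 2; set b := (x + y) / 2.
  have -> : x = a + b by rewrite /a /b; field.
  have -> : y = b - a by rewrite /a /b; field.
  by rewrite cosD cosB; ring.
rewrite !normrM normrN [ `|2| ]ger0_norm//.
have := norm_sin_le ((x - y) / 2); rewrite normrM [ `|2^-1| ]ger0_norm//.
have := sin_max ((x + y) / 2); have := normr_ge0 (sin ((x + y) / 2)).
have := normr_ge0 (sin ((x - y) / 2)); nra.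
Qed.

End Trig.
Lemma Rintegral_probability_cst d (T : measurableType d) (R : realType)
  (P : probability T R) (k : R) : \int[P]_x k = k.
Proof. by rewrite /Rintegral integral_cst//= probability_setT mule1. Qed.

(** * Characteristic function and variance of the standard normal law *)

Section GaussCF.
Context {R : realType}.
Local Notation leb := (@lebesgue_measure R).
Local Notation N := (normal_prob (0 : R) 1).

Lemma measurable_cosM (u : R) : measurable_fun setT (fun z : R => cos (u * z)).
Proof.
apply: measurableT_comp; first by apply: continuous_measurable_fun; exact: continuous_cos.
exact: measurable_funM.
Qed.

Lemma measurable_sinM (u : R) : measurable_fun setT (fun z : R => sin (u * z)).
Proof.
apply: measurableT_comp; first by apply: continuous_measurable_fun; exact: continuous_sin.
exact: measurable_funM.
Qed.

(** Stein's identity: exp(-z^2/2) sin(uz) has derivative u cos(uz) exp(-z^2/2) - z sin(uz)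
    exp(-z^2/2), whose integral over the line is 0. *)
Lemma normal_stein (u : R) :
  \int[N]_z (z * sin (u * z)) = u * \int[N]_z cos (u * z).
Proof.
pose F (z : R) : R := expR (- z ^+ 2 / 2) * sin (u * z).
pose f (z : R) : R := u * (cos (u * z) * expR (- z ^+ 2 / 2)) - z * sin (u * z) * expR (- z ^+ 2 / 2).
have dF (z : R) : is_derive z (1 : R) F (f z).
  rewrite /F; apply: is_derive_eq; rewrite /f /= !scaler1 /GRing.scale /=.
  by field.
(* Decay at the points k and -k only: exp(k^2/2) >= 1 + k^2/2 >= (k + 1)/2. *)
have bnd (z : R) (k : nat) : `|z| = k%:R -> `|F z| <= 2 * harmonic k.
  move=> zk; rewrite normrM -[leRHS]mulr1; apply: ler_pM => //; last first.
    by rewrite ler_norml sin_geN1 sin_le1.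
  rewrite gtr0_norm ?expR_gt0// mulNr expRN -real_normK ?num_real// zk /harmonic /=.
  have h : 2^-1 * k.+1%:R <= expR (k%:R ^+ 2 / 2) :> R.
    apply: le_trans (expR_ge1Dx _); rewrite -(natr1 k).
    by have := sqr_ge0 (k%:R - 2^-1 : R); lra.
  rewrite -[2 in leRHS]invrK -invfM lef_pV2 ?posrE ?expR_gt0// mulr_gt0//.
have cvg0 : (fun k => 2 * harmonic k : R) @ \oo --> (0 : R).
  by rewrite -(mulr0 2); apply: cvgMr; exact: cvg_harmonic.
have cF (v : nat -> R) : (forall k, `|v k| = k%:R) -> F (v k) @[k --> \oo] --> 0.
  move=> vk; apply: norm_cvg0; apply: squeeze_cvgr (cvg_cst 0) cvg0.
  by apply: nearW => k; rewrite normr_ge0 bnd.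
have me : measurable_fun setT (fun z : R => expR (- z ^+ 2 / 2)).
  by rewrite (_ : (fun z => _) = (fun z => expR (- 2^-1 * z ^+ 2))); [exact: measurable_expR_sqr|apply/funext => z; congr expR; ring].
have pdfi (g : R -> R) : measurable_fun setT g -> N.-integrable setT (EFin \o g) ->
    leb.-integrable setT (EFin \o (fun z => g z * expR (- z ^+ 2 / 2))).
  move=> mg gi.
  have := (iffLR (@integrable_density _ _ _ leb N (normal_pdf 0 1) (normal_pdf_ge0 _ _) (measurable_normal_pdf _ _) (fun _ _ => erefl) g mg)) gi.
  move=> /(integrableZl_EFin (normal_peak 1)^-1); congr (is_true (_.-integrable _ _)).
  apply/funext => z /=; rewrite normal_pdf01 mulrCA mulKf// gt_eqF// normal_peak_gt0//.
have Nfin : (N setT < +oo)%E by rewrite probability_setT ltry.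
have sini : N.-integrable setT (EFin \o (fun z => z * sin (u * z))).
  apply: dominated_integrable (integrable_norm integrable_normal_id) _ => [|z].
    by apply: measurable_funM => //; exact: measurable_sinM.
  by rewrite normrM ler_piMr// ler_norml sin_geN1 sin_le1.
have cosi : N.-integrable setT (EFin \o (fun z => cos (u * z))).
  apply: (bounded_integrable (K := 1)) => // [|z]; first exact: measurable_cosM.
  by rewrite ler_norml cos_geN1 cos_le1.
have msin : measurable_fun setT (fun z : R => z * sin (u * z)).
  by apply: measurable_funM => //; exact: measurable_sinM.
have i1 := pdfi _ (measurable_cosM u) cosi.
have i2 := pdfi _ msin sini.
have := @Rintegral_derivative_line R f F _ dF (integrableB_EFin (integrableZl_EFin u i1) i2)
   (cF (fun k => k%:R) _) (cF (fun k => - k%:R) _).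
rewrite RintegralB// ?RintegralZl//; last exact: (integrableZl_EFin u i1).
move=> h; rewrite !Rintegral_normal_prob//; last exact: measurable_cosM.
have E (g : R -> R) : leb.-integrable setT (EFin \o (fun z => g z * expR (- z ^+ 2 / 2))) ->
  \int[leb]_z (g z * normal_pdf 0 1 z) = normal_peak 1 * \int[leb]_z (g z * expR (- z ^+ 2 / 2)).
  by move=> gi; rewrite -RintegralZl//; apply: eq_Rintegral => z _; rewrite normal_pdf01; ring.
rewrite !E// mulrCA; congr (_ * _); apply/esym/eqP; rewrite -subr_eq0; apply/eqP; apply: h.
- move=> z.
  by apply: differentiable_continuous; apply/derivable1_diffP; rewrite /f; apply: ex_derive.
- by move=> k; rewrite normr_nat.
- by move=> k; rewrite normrN normr_nat.
Qed.

(** Differentiation under the integral and Stein's identity give phi' = - u phi, so phi(u)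
    exp(u^2/2) is constant, equal to its value 1 at 0. *)
Lemma normal_characteristic_function (u : R) :
  \int[N]_z cos (u * z) = expR (- u ^+ 2 / 2).
Proof.
have Nfin : (N setT < +oo)%E by rewrite probability_setT ltry.
pose phi (v : R) : R := \int[N]_z cos (v * z).
have cosi (v : R) : N.-integrable setT (EFin \o (fun z => cos (v * z))).
  apply: (bounded_integrable (K := 1)) => // [|z]; first exact: measurable_cosM.
  by rewrite ler_norml cos_geN1 cos_le1.
have dcos (x y : R) : is_derive x (1 : R) (fun v => cos (v * y)) (- (y * sin (x * y))).
  by apply: is_derive_eq; rewrite /GRing.scale /=; ring.
have aI (a : R) : `]a - 1, a + 1[%classic a.
  by rewrite /= in_itv /= ltrDl ltrBlDr ltrDl ltr01.
have pE (x y : R) : partial1of2 (fun v z : R => cos (v * z)) x y = - (y * sin (x * y)).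
  by rewrite partial1of2E; case: (dcos x y).
have Gub (x y : R) : `|partial1of2 (fun v z : R => cos (v * z)) x y| <= `|y|.
  by rewrite pE normrN normrM ler_piMr// ler_norml sin_geN1 sin_le1.
have dphi (a : R) : is_derive a (1 : R) phi (- a * phi a).
  have inorm : N.-integrable setT (EFin \o (fun y : R => `|y|)).
    exact: (integrable_norm integrable_normal_id).
  have der (x y : R) : derivable (fun v : R => cos (v * y)) x 1 by [].
  have d1 : derivable phi a 1.
    exact: (derivable_under_integral measurableT (aI a) (fun x _ => cosi x)
      (fun x y _ _ => der x y) (fun y => normr_ge0 y) inorm (fun x y _ _ => Gub x y)).
  apply: DeriveDef => //; rewrite -derive1E.
  rewrite (differentiation_under_integral measurableT (aI a) (fun x _ => cosi x)
      (fun x y _ _ => der x y) (fun y => normr_ge0 y) inorm (fun x y _ _ => Gub x y)).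
  under eq_Rintegral do rewrite pE -mulN1r.
  rewrite RintegralZl// ?normal_stein ?mulN1r ?mulNr//.
  apply: dominated_integrable (integrable_norm integrable_normal_id) _ => [|z].
    by apply: measurable_funM => //; exact: measurable_sinM.
  by rewrite normrM ler_piMr// ler_norml sin_geN1 sin_le1.
pose g (v : R) : R := phi v * expR (v ^+ 2 / 2).
have dg (v : R) : is_derive v (1 : R) g 0.
  by rewrite /g; apply: is_derive_eq; rewrite /GRing.scale /=; field.
have := is_derive_0_is_cst u 0 dg.
rewrite /g expr0n/= mul0r expR0 mulr1 /phi.
under [in RHS]eq_Rintegral do rewrite mul0r cos0.
rewrite Rintegral_probability_cst mulNr expRN.
have e0 : expR (u ^+ 2 / 2) != 0 :> R by rewrite gt_eqF// expR_gt0.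
by move=> h; apply: (mulIf e0); rewrite h mulVf.
Qed.

(** Read off the characteristic function: 2 (1 - cos(sz)) / s^2 tends to z^2 and is dominated by it,
    while its mean 2 (1 - exp(-s^2/2)) / s^2 tends to 1. *)
Lemma normal_second_moment : \int[N]_z (z ^+ 2) = 1.
Proof.
have Nfin : (N setT < +oo)%E by rewrite probability_setT ltry.
pose s (k : nat) : R := k.+1%:R^-1.
have s0 k : 0 < s k by rewrite invr_gt0.
have s_cvg : s k @[k --> \oo] --> (0 : R) by exact: cvg_harmonic.
have s2_cvg : s k ^+ 2 @[k --> \oo] --> (0 : R).
  by rewrite -(mulr0 0); under eq_fun do rewrite expr2; exact: cvgM.
have h1 : \int[N]_z (2 * (1 - cos (s k * z)) / s k ^+ 2) @[k --> \oo] --> \int[N]_z (z ^+ 2).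
  apply: (@Rintegral_dominated_cvg _ _ _ N (fun k z => 2 * (1 - cos (s k * z)) / s k ^+ 2) _ (fun z => z ^+ 2)).
  - move=> k; apply: measurable_funM => //; apply: measurable_funM => //.
    by apply: measurable_funB => //; exact: measurable_cosM.
  - move=> z; apply/cvgrPdist_le => e e0.
    have : (z ^+ 4 / 4) * s k ^+ 2 @[k --> \oo] --> (z ^+ 4 / 4) * 0 by exact: cvgMr.
    rewrite mulr0 => /cvgrPdist_le /(_ e e0); apply: filterS => k.
    rewrite sub0r normrN => h; apply: le_trans h; apply: le_trans (ler_norm _).
    have := one_sub_cos_approx (s k * z).
    have sk2 : 0 < s k ^+ 2 by rewrite exprn_gt0.
    rewrite (_ : z ^+ 2 - _ = - (2 / s k ^+ 2) * (1 - cos (s k * z) - (s k * z) ^+ 2 / 2)); last first.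
      by field; rewrite gt_eqF.
    rewrite normrM normrN [ `|2 / _| ]gtr0_norm ?divr_gt0// => h.
    rewrite -ler_pdivlMl ?divr_gt0// (le_trans h)// le_eqVlt; apply/orP; left; apply/eqP.
    by field; rewrite gt_eqF.
  - exact: integrable_normal_sqr.
  - move=> k z; rewrite ger0_norm; last first.
      by rewrite divr_ge0 ?sqr_ge0// mulr_ge0// one_sub_cos_ge0.
    rewrite ler_pdivrMr ?exprn_gt0//.
    have := one_sub_cos_le (s k * z); rewrite exprMn; lra.
have h2 : \int[N]_z (2 * (1 - cos (s k * z)) / s k ^+ 2) @[k --> \oo] --> (1 : R).
  apply/cvgrPdist_le => e e0.
  move/cvgrPdist_le : s2_cvg => /(_ e e0); apply: filterS => k.
  rewrite sub0r normrN => h; apply: le_trans h; apply: le_trans (ler_norm _).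
  have -> : \int[N]_z (2 * (1 - cos (s k * z)) / s k ^+ 2) = 2 / s k ^+ 2 * (1 - expR (- s k ^+ 2 / 2)).
    under eq_Rintegral do rewrite mulrAC.
    have i1 : N.-integrable setT (EFin \o (fun z => cos (s k * z))).
      apply: (bounded_integrable (K := 1)) => // [|z]; first exact: measurable_cosM.
      by rewrite ler_norml cos_geN1 cos_le1.
    have i0 : N.-integrable setT (EFin \o (fun z => 1 : R)) by exact: finite_measure_integrable_cst.
    rewrite RintegralZl//; last exact: (integrableB_EFin i0 i1).
    by rewrite RintegralB// Rintegral_probability_cst normal_characteristic_function.
  set x := s k ^+ 2; have x0 : 0 < x by rewrite exprn_gt0.
  have lo := expR_ge1Dx (- (x / 2)); have up := expR_ge1Dx (x / 2).
  have : expR (- (x / 2)) * expR (x / 2) = 1 :> R by rewrite -expRD addNr expR0.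
  have := expR_gt0 (- (x / 2)); rewrite mulNr; move: lo up.
  set p := expR (- _); set q := expR _ => lo up p0 pq.
  rewrite (_ : 1 - _ = (x - 2 * (1 - p)) / x); last by field; rewrite gt_eqF.
  rewrite normrM [ `|x^-1| ]gtr0_norm ?invr_gt0// ler_pdivrMr//.
  by rewrite ler_norml; apply/andP; split; nra.
exact: cvg_unique h1 h2.
Qed.
End GaussCF.
(** * Levy's continuity theorem *)

Section Smoothing.
Context {R : realType}.
Local Notation leb := (@lebesgue_measure R).
Local Notation N := (normal_prob (0 : R) 1).
Local Notation RM := (measurableTypeR R).

Lemma finite_measure_lty d (T : measurableType d) (mu : {finite_measure set T -> \bar R}) :
  (mu setT < +oo)%E.
Proof. by rewrite ltey_eq fin_num_measure. Qed.

Lemma lipschitz_continuous (h : R -> R) (L : R) :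
  (forall x y, `|h x - h y| <= L * `|x - y|) -> continuous h.
Proof.
move=> hL x; apply/cvgrPdist_lt => e e0.
have L1 : 0 < `|L| + 1 by rewrite ltr_wpDl.
near=> y; apply: (le_lt_trans (hL x y)); apply: (@le_lt_trans _ _ ((`|L| + 1) * `|x - y|)).
  by rewrite ler_wpM2r// (le_trans (ler_norm L))// lerDl.
rewrite -ltr_pdivlMl//; near: y; apply: cvgr_dist_lt; first exact: cvg_id.
by rewrite mulr_gt0// invr_gt0.
Unshelve. all: by end_near. Qed.

Lemma integral_affine (G : R -> R) (x s : R) : 0 < s -> continuous G ->
  (forall y, 0 <= G y) ->
  (\int[leb]_y (G y)%:E = \int[leb]_z (G (x + s * z) * s)%:E)%E.
Proof.
(* A translation followed by a scaling: in this form the limits at infinity required by the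
   substitution rule are immediate. *)
move=> s0 cG G0; pose F (z : R) := (z + x / s) * s.
have FE z : F z = x + s * z by rewrite /F; field; rewrite gt_eqF.
have dF (z : R) : is_derive z (1 : R) F s.
  by rewrite /F; apply: is_derive_eq; rewrite /GRing.scale /=; ring.
have F' : F^`()%classic = cst s by apply/funext => z; rewrite derive1E; case: (dF z).
rewrite (@increasing_ge0_integration_by_substitutionT R F G) //.
- by apply: eq_integral => z _; rewrite F' -FE.
- by move=> a b ab; rewrite /F ltr_pM2r// ltrD2r.
- by rewrite F' => ?; exact: cvg_cst.
- by rewrite F'; exact: is_cvg_cst.
- by rewrite F'; exact: is_cvg_cst.
- by apply: gt0_cvgMlNy => //; exact: cvg_addrr_Ny.
- by apply: gt0_cvgMly => //; exact: cvg_addrr.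
Qed.

Lemma expR_gauss_le1 (z : R) : expR (- z ^+ 2 / 2) <= 1.
Proof. by rewrite -[leRHS]expR0 ler_expR; have := sqr_ge0 z; lra. Qed.

Lemma measurable_affine (x s : R) : measurable_fun setT (fun z : R => x + s * z).
Proof. by apply: measurable_funD => //; exact: measurable_funM. Qed.

Lemma Rintegral_affine (G : R -> R) (x s : R) : 0 < s -> continuous G ->
  (forall y, 0 <= G y) ->
  \int[leb]_y G y = \int[leb]_z (G (x + s * z) * s).
Proof. by move=> s0 cG G0; rewrite /Rintegral (integral_affine x s0 cG G0). Qed.

Variables (mu : {finite_measure set RM -> \bar R}) (h : R -> R) (s : R).
Hypotheses (s0 : 0 < s) (ch : continuous h) (h0 : forall x, 0 <= h x).
Hypothesis hi : leb.-integrable setT (EFin \o h).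

Let continuous_gauss (x : R) : continuous (fun y : R => expR (- ((y - x) / s) ^+ 2 / 2)).
Proof.
move=> y; apply: differentiable_continuous; apply/derivable1_diffP.
by apply: ex_derive.
Qed.

Let measurable_gauss : measurable_fun setT (fun w : R => expR (- (w / s) ^+ 2 / 2)).
Proof.
apply: continuous_measurable_fun => w; have := @continuous_gauss 0 w.
by rewrite (_ : (fun y : R => _) = (fun w : R => expR (- (w / s) ^+ 2 / 2)))//; apply/funext => y; rewrite subr0.
Qed.

Let smooth1 (x : R) : \int[N]_z h (x + s * z) =
  normal_peak 1 / s * \int[leb]_y (h y * expR (- ((y - x) / s) ^+ 2 / 2)).
Proof.
have mh := continuous_measurable_fun ch.
rewrite Rintegral_normal_prob; last exact: measurableT_comp mh (measurable_affine x s).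
pose G y := h y * expR (- ((y - x) / s) ^+ 2 / 2).
have cG : continuous G by move=> y; apply: cvgM; [exact: ch|exact: continuous_gauss].
have G0 y : 0 <= G y by rewrite mulr_ge0// expR_ge0.
have Gi : leb.-integrable setT (EFin \o G).
  apply: dominated_integrable hi _ => [|y]; first exact: continuous_measurable_fun.
  by rewrite ger0_norm// ler_piMr// expR_gauss_le1.
rewrite -/G (Rintegral_affine x s0 cG G0) -RintegralZl//; last first.
  apply/integrableP; split.
    apply/measurable_EFinP; apply: measurable_funM => //.
    exact: measurableT_comp (continuous_measurable_fun cG) (measurable_affine x s).
  under eq_integral => z _ do rewrite /= ger0_norm ?mulr_ge0// ?ltW//.
  rewrite -(integral_affine x s0 cG G0).
  by have /integrableP[_] := Gi; under eq_integral => z _ do rewrite /= ger0_norm//.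
apply: eq_Rintegral => z _; rewrite normal_pdf01 /G.
have -> : (x + s * z - x) / s = z by field; rewrite gt_eqF.
by field; rewrite gt_eqF.
Qed.

(** The Gaussian kernel exp(-((y - x)/s)^2/2) is itself the mean of cos((y - x) U / s). Two
    exchanges of integrals then leave [mu] visible only through its cosine integrals, with frequency
    u/s and phase uy/s. *)
Lemma Rintegral_gauss_smoothing :
  \int[mu]_x \int[N]_z h (x + s * z) =
  \int[leb]_y (h y * (normal_peak 1 / s *
     \int[N]_u \int[mu]_x cos (u / s * x - u / s * y))).
Proof.
have mh := continuous_measurable_fun ch.
have mufin := finite_measure_lty mu.
have Nfin : (N setT < +oo)%E by rewrite probability_setT ltry.
have hgi x : leb.-integrable setT (EFin \o (fun y => h y * expR (- ((y - x) / s) ^+ 2 / 2))).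
  apply: dominated_integrable hi _ => [|y].
    by apply: measurable_funM => //; exact: continuous_measurable_fun.
  by rewrite ger0_norm ?mulr_ge0 ?expR_ge0// ler_piMr// expR_gauss_le1.
have mg : measurable_fun setT (fun z : RM * RM => (z.2 : R) - z.1).
  by apply: measurable_funB; [exact: measurable_snd|exact: measurable_fst].
under eq_Rintegral do rewrite smooth1 -RintegralZl//.
rewrite (@Rintegral_swap _ _ _ _ _ mu leb
  (fun z => normal_peak 1 / s * (h z.2 * expR (- ((z.2 - z.1) / s) ^+ 2 / 2)))
  (fun=> normal_peak 1 / s) h) //; first last.
- move=> x y /=; rewrite ger0_norm ?mulr_ge0 ?invr_ge0 ?normal_peak_ge0 ?expR_ge0 ?(ltW s0)//.
  by rewrite ler_wpM2l ?mulr_ge0 ?invr_ge0 ?normal_peak_ge0 ?(ltW s0)// ler_piMr// expR_gauss_le1.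
- exact: finite_measure_integrable_cst.
- apply: measurable_funM => //; apply: measurable_funM.
    exact: (measurableT_comp mh measurable_snd).
  exact: (measurableT_comp measurable_gauss mg).
apply: eq_Rintegral => y _ /=.
have ei : mu.-integrable setT (EFin \o (fun x : R => expR (- ((y - x) / s) ^+ 2 / 2))).
  apply: (bounded_integrable (K := 1)) => // [|x].
    apply: (measurableT_comp measurable_gauss).
    by apply: measurable_funB => //.
  by rewrite ger0_norm ?expR_ge0// expR_gauss_le1.
transitivity (h y * (normal_peak 1 / s) * \int[mu]_x expR (- ((y - x) / s) ^+ 2 / 2)).
  by rewrite -[RHS]RintegralZl//; apply: eq_Rintegral => x _; rewrite mulrCA mulrA.
rewrite -mulrA; congr (_ * (_ * _)).
transitivity (\int[mu]_x \int[N]_u cos ((y - x) / s * u)).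
  by apply: eq_Rintegral => x _; rewrite normal_characteristic_function.
transitivity (\int[N]_u \int[mu]_x cos ((y - x) / s * u)).
  apply: (@Rintegral_swap _ _ _ _ _ mu N
    (fun z => cos ((y - z.1) / s * z.2)) (fun=> 1) (fun=> 1)) => //.
  - apply: measurableT_comp; first by apply: continuous_measurable_fun; exact: continuous_cos.
    apply: measurable_funM; last exact: measurable_snd.
    apply: measurable_funM => //.
    by apply: measurable_funB => //; exact: measurable_fst.
  - exact: finite_measure_integrable_cst.
  - exact: finite_measure_integrable_cst.
  - by move=> x u /=; rewrite mulr1 ler_norml cos_geN1 cos_le1.
apply: eq_Rintegral => u _; apply: eq_Rintegral => x _ /=.
by rewrite -cosN; congr cos; ring.
Qed.

End Smoothing.
Lemma finite_bounded_integrable d (T : measurableType d) (R : realType)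
  (mu : {finite_measure set T -> \bar R}) (f : T -> R) (K : R) :
  measurable_fun setT f -> (forall x, `|f x| <= K) ->
  mu.-integrable setT (EFin \o f).
Proof. exact: bounded_integrable (finite_measure_lty mu). Qed.

Lemma measurable_Rintegral_param d1 d2 (T1 : measurableType d1) (T2 : measurableType d2)
    (R : realType) (mu : {finite_measure set T2 -> \bar R}) (f : T1 * T2 -> R) (K : R) :
  measurable_fun setT f -> (forall z, `|f z| <= K) ->
  measurable_fun setT (fun x => \int[mu]_y f (x, y)).
Proof.
move=> mf fK; have mufin := finite_measure_lty mu.
have fi x : mu.-integrable setT (EFin \o (fun y => f (x, y))).
  by apply: (bounded_integrable (K := K)) => //; exact: measurableT_comp.
have Ki : mu.-integrable setT (EFin \o (fun _ => K)) by exact: finite_measure_integrable_cst.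
(* Measurability of partial integrals is available for nonnegative functions, hence the shift by
   K. *)
have -> : (fun x => \int[mu]_y f (x, y)) =
    (fun x => fine (\int[mu]_y (f (x, y) + K)%:E)%E - \int[mu]_y K).
  by apply/funext => x; apply/esym/eqP; rewrite subr_eq -RintegralD.
apply: measurable_funB => //; apply: measurableT_comp; first exact: fine_measurable.
apply: (@measurable_fun_fubini_tonelli_F _ _ _ _ _ mu (fun z => (f z + K)%:E)) => [|z].
  by apply/measurable_EFinP; exact: measurable_funD.
by rewrite lee_fin -lerBlDr sub0r; have := fK z; rewrite ler_norml => /andP[].
Qed.

Lemma cvgn_le_lim (R : realType) (u : nat -> R) (l M : R) :
  u n @[n --> \oo] --> l -> (forall n, u n <= M) -> l <= M.
Proof.
move=> ul uM; rewrite -(cvg_lim _ ul)//; apply: limr_le; first exact: cvgP ul.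
exact: nearW.
Qed.

Section Cutoff.
Context {R : realType}.
Local Notation leb := (@lebesgue_measure R).

(** A Lipschitz, compactly supported substitute for the indicator of [-k, k]: it is 1 there and 0
    outside [-(k+1), k+1]. *)
Definition cutoff (k : nat) (x : R) : R := Num.max 0 (Num.min 1 (k.+1%:R - `|x|)).

Lemma cutoff_ge0 k x : 0 <= cutoff k x. Proof. by rewrite le_max lexx. Qed.

Lemma cutoff_le1 k x : cutoff k x <= 1.
Proof. by rewrite ge_max ler01 ge_min lexx. Qed.

Lemma cutoff_lipschitz k x y : `|cutoff k x - cutoff k y| <= 1 * `|x - y|.
Proof.
rewrite mul1r /cutoff; have := ler_dist_dist x y.
set a := `|x|; set b := `|y|; move: (`|x - y|) => c; set K := k.+1%:R.
rewrite !ler_norml => /andP[h1 h2].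
have c0 : 0 <= c by lra.
have : - c <= Num.min 1 (K - a) - Num.min 1 (K - b) <= c.
  by case: (leP 1 (K - a)); case: (leP 1 (K - b)) => *; apply/andP; split; lra.
move: (Num.min _ _) (Num.min _ _) => u v /andP[h3 h4].
by case: (leP 0 u); case: (leP 0 v) => *; apply/andP; split; lra.
Qed.

Lemma cutoff_near k x : `|x| <= k%:R -> cutoff k x = 1.
Proof.
move=> xk; rewrite /cutoff min_l ?max_r//.
by rewrite -natr1; lra.
Qed.

Lemma cutoff_far k x : k.+1%:R <= `|x| -> cutoff k x = 0.
Proof. by move=> xk; rewrite /cutoff max_l// ge_min subr_le0 xk orbT. Qed.

Lemma integrable_cutoff k : leb.-integrable setT (EFin \o cutoff k).
Proof.
have mc := continuous_measurable_fun (lipschitz_continuous (@cutoff_lipschitz k)).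
apply: (@dominated_integrable _ _ _ leb _ (\1_(`[- k.+1%:R, k.+1%:R]))) => //.
  exact: integrable_indic_itv.
move=> x; rewrite ger0_norm ?cutoff_ge0// indicE.
case: (boolP (x \in _)) => [_|]; first exact: cutoff_le1.
rewrite notin_setE /= in_itv /= -ler_norml => /negP; rewrite -ltNge => /ltW xk.
by rewrite cutoff_far.
Qed.

End Cutoff.

Lemma ae_imply d (T : measurableType d) (R : realType)
    (mu : {measure set T -> \bar R}) (P Q : T -> Prop) :
  (forall x, P x -> Q x) -> {ae mu, forall x, P x} -> {ae mu, forall x, Q x}.
Proof. by move=> PQ; apply: filterS. Qed.

Section LevyContinuity.
Context {R : realType}.
Local Notation leb := (@lebesgue_measure R).
Local Notation N := (normal_prob (0 : R) 1).
Local Notation RM := (measurableTypeR R).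

Lemma smoothing_error (mu : {finite_measure set RM -> \bar R}) (h : R -> R) (L s K : R) :
  0 <= s -> (forall x, `|h x| <= K) ->
  (forall x y, `|h x - h y| <= L * `|x - y|) ->
  `|\int[mu]_x h x - \int[mu]_x \int[N]_z h (x + s * z)| <=
    L * s * (\int[N]_z `|z|) * fine (mu setT).
Proof.
move=> s0 hK hL; have ch := lipschitz_continuous hL.
have mh := continuous_measurable_fun ch.
have mufin := finite_measure_lty mu.
have Nfin : (N setT < +oo)%E by rewrite probability_setT ltry.
have ni := integrable_norm (@integrable_normal_id R).
have hNi x : N.-integrable setT (EFin \o (fun z => h (x + s * z))).
  apply: (bounded_integrable (K := K)) => //.
  exact: measurableT_comp mh (measurable_affine x s).
have L0 : 0 <= L by have := hL 1 0; rewrite subr0 normr1 mulr1; apply: le_trans.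
have err x : `|h x - \int[N]_z h (x + s * z)| <= L * s * \int[N]_z `|z|.
  rewrite -{1}(Rintegral_probability_cst N (h x)) -RintegralB//; last exact: finite_measure_integrable_cst.
  rewrite -RintegralZl//; apply: Rintegral_norm_le.
  - by apply: measurable_funB => //; exact: measurableT_comp mh (measurable_affine x s).
  - exact: (integrableZl_EFin _ ni).
  - move=> z; apply: (le_trans (hL _ _)).
    by rewrite opprD addNKr normrN normrM (ger0_norm s0) mulrA.
have i1 : mu.-integrable setT (EFin \o h) by exact: (bounded_integrable (K := K)).
have mS : measurable_fun setT (fun x : R => \int[N]_z h (x + s * z)).
  apply: continuous_measurable_fun; apply: (@lipschitz_continuous _ _ L) => x y.
  rewrite -RintegralB//.
  have <- : \int[N]_z (L * `|x - y|) = L * `|x - y| by exact: Rintegral_probability_cst.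
  apply: Rintegral_norm_le.
  - apply: measurable_funB; [exact: measurableT_comp mh (measurable_affine x s)|].
    exact: measurableT_comp mh (measurable_affine y s).
  - exact: finite_measure_integrable_cst.
  - by move=> z; rewrite (le_trans (hL _ _))// opprD addrACA subrr addr0.
have i2 : mu.-integrable setT (EFin \o (fun x => \int[N]_z h (x + s * z))).
  apply: (bounded_integrable (K := K)) => // x.
  rewrite -(Rintegral_probability_cst N K); apply: Rintegral_norm_le => //.
  - exact: measurableT_comp mh (measurable_affine x s).
  - exact: finite_measure_integrable_cst.
rewrite -RintegralB//.
have -> : L * s * (\int[N]_z `|z|) * fine (mu setT) = \int[mu]_x (L * s * (\int[N]_z `|z|)).
  by rewrite [RHS]/Rintegral integral_cst// fineM// fin_num_measure.
apply: Rintegral_norm_le => //; first exact: measurable_funB.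
exact: finite_measure_integrable_cst.
Qed.

Variables (G_ : nat -> {finite_measure set RM -> \bar R}) (G : {finite_measure set RM -> \bar R}).
Hypothesis cfG : forall u a : R,
  \int[G_ n]_x cos (u * x - a) @[n --> \oo] --> \int[G]_x cos (u * x - a).

Let mass_cvg : fine (G_ n setT) @[n --> \oo] --> fine (G setT).
Proof.
have h (mu : {finite_measure set RM -> \bar R}) : \int[mu]_x cos (0 * x - 0) = fine (mu setT).
  under eq_Rintegral do rewrite mul0r subr0 cos0.
  by rewrite /Rintegral integral_cst// mul1e.
have := @cfG 0 0; rewrite h.
by under eq_fun do rewrite h.
Qed.

Let mass_bounded : exists M, 0 <= M /\ forall n, fine (G_ n setT) <= M.
Proof.
have [M [_ hM]] := cvg_seq_bounded (cvgP _ mass_cvg).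
exists (`|M| + 1); split=> [|n]; first by rewrite addr_ge0.
by have /= := hM (`|M| + 1) (le_lt_trans (ler_norm _) (ltr_pwDr ltr01 (lexx _))) n I; apply: le_trans; exact: ler_norm.
Qed.

Let measurable_cos_affine (a b : R) : measurable_fun setT (fun x : R => cos (a * x - b)).
Proof.
apply: measurableT_comp; first by apply: continuous_measurable_fun; exact: continuous_cos.
by apply: measurable_funB => //; exact: measurable_funM.
Qed.

Let cf_bound (mu : {finite_measure set RM -> \bar R}) (a b : R) : `|\int[mu]_x cos (a * x - b)| <= fine (mu setT).
Proof.
rewrite (_ : fine (mu setT) = \int[mu]_x 1); last by rewrite [RHS]/Rintegral integral_cst// mul1e.
apply: Rintegral_norm_le; first exact: measurable_cos_affine.
  exact: finite_measure_integrable_cst.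
by move=> x; rewrite ler_norml cos_geN1 cos_le1.
Qed.

Let measurable_cf (mu : {finite_measure set RM -> \bar R}) (s y : R) :
  measurable_fun setT (fun u : R => \int[mu]_x cos (u / s * x - u / s * y)).
Proof.
apply: (@measurable_Rintegral_param _ _ _ _ _ mu (fun z : RM * RM => cos (z.1 / s * z.2 - z.1 / s * y)) 1); last first.
  by move=> z; rewrite ler_norml cos_geN1 cos_le1.
apply: measurableT_comp; first by apply: continuous_measurable_fun; exact: continuous_cos.
by apply: measurable_funB; apply: measurable_funM => //; apply: measurable_funM => //; exact: measurable_fst.
Qed.

(** After smoothing, the measures occur only through their cosine integrals, which converge.
    Dominated convergence applies in the frequency, then in y, where the integrability of h for
    Lebesgue measure is used. *)
Let smooth_cvg (h : R -> R) (s : R) : 0 < s -> continuous h -> (forall x, 0 <= h x) ->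
  leb.-integrable setT (EFin \o h) ->
  \int[G_ n]_x \int[N]_z h (x + s * z) @[n --> \oo] --> \int[G]_x \int[N]_z h (x + s * z).
Proof.
move=> s0 ch h0 hi.
have mh := continuous_measurable_fun ch.
have Nfin : (N setT < +oo)%E by rewrite probability_setT ltry.
have [M [M0 GM]] := mass_bounded.
rewrite Rintegral_gauss_smoothing//.
under eq_fun do rewrite Rintegral_gauss_smoothing//.
apply: (@Rintegral_dominated_cvg _ _ _ leb (fun n y => h y * (normal_peak 1 / s *
     \int[N]_u \int[G_ n]_x cos (u / s * x - u / s * y))) _ (fun y => normal_peak 1 / s * M * h y)).
- move=> n; apply: measurable_funM => //; apply: measurable_funM => //.
  have mI : measurable_fun setT (fun z : RM * RM => \int[G_ n]_x cos (z.2 / s * x - z.2 / s * z.1)).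
    apply: (@measurable_Rintegral_param _ _ _ _ _ (G_ n)
      (fun z : (RM * RM) * RM => cos (z.1.2 / s * z.2 - z.1.2 / s * z.1.1)) 1); last first.
      by move=> z; rewrite ler_norml cos_geN1 cos_le1.
    have m12 : measurable_fun setT (fun z : (RM * RM) * RM => z.1.2 : R).
      exact: (measurableT_comp measurable_snd measurable_fst).
    have m11 : measurable_fun setT (fun z : (RM * RM) * RM => z.1.1 : R).
      exact: (measurableT_comp measurable_fst measurable_fst).
    apply: measurableT_comp; first by apply: continuous_measurable_fun; exact: continuous_cos.
    by apply: measurable_funB; apply: measurable_funM => //; apply: measurable_funM.
  apply: (@measurable_Rintegral_param _ _ _ _ _ N
    (fun z : RM * RM => \int[G_ n]_x cos (z.2 / s * x - z.2 / s * z.1)) M) => // z.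
  by rewrite (le_trans (cf_bound _ _ _)).
- move=> y; apply: cvgMr; apply: cvgMr.
  apply: (@Rintegral_dominated_cvg _ _ _ N (fun n u => \int[G_ n]_x cos (u / s * x - u / s * y)) _ (fun=> M)).
  + by move=> n; exact: measurable_cf.
  + by move=> u; exact: cfG.
  + exact: finite_measure_integrable_cst.
  + by move=> n u; rewrite (le_trans (cf_bound _ _ _)).
- exact: (integrableZl_EFin _ hi).
- move=> n y; rewrite normrM ger0_norm// mulrC ler_wpM2r//.
  rewrite normrM ger0_norm ?mulr_ge0 ?normal_peak_ge0 ?invr_ge0 ?(ltW s0)//.
  rewrite ler_wpM2l ?mulr_ge0 ?normal_peak_ge0 ?invr_ge0 ?(ltW s0)//.
  rewrite -(Rintegral_probability_cst N M); apply: Rintegral_norm_le.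
  + exact: measurable_cf.
  + exact: finite_measure_integrable_cst.
  + by move=> u; rewrite (le_trans (cf_bound _ _ _)).
Qed.

Let lipschitz_cvg (h : R -> R) (L K : R) : (forall x, 0 <= h x) ->
  (forall x, `|h x| <= K) -> (forall x y, `|h x - h y| <= L * `|x - y|) ->
  leb.-integrable setT (EFin \o h) ->
  \int[G_ n]_x h x @[n --> \oo] --> \int[G]_x h x.
Proof.
move=> h0 hK hL hi; have [M [M0 GM]] := mass_bounded.
have GM' : fine (G setT) <= M.
  exact: cvgn_le_lim mass_cvg GM.
have L0 : 0 <= L by have := hL 1 0; rewrite subr0 normr1 mulr1; apply: le_trans.
set A := \int[N]_z `|z|.
have A0 : 0 <= A by apply: Rintegral_ge0.
apply/cvgrPdist_le => e e0.
(* The smoothing error is at most L s A M, uniformly over the measures because their masses are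
   bounded; the added 1 avoids a division by zero. *)
pose s := e / (3 * (L * A * M + 1)).
have LAM : 0 <= L * A * M by rewrite !mulr_ge0.
have s0 : 0 < s by rewrite divr_gt0// mulr_gt0// ltr_wpDl.
have sE : L * s * A * M <= e / 3.
  rewrite (_ : L * s * A * M = (L * A * M) * s); last by ring.
  have : s * (3 * (L * A * M + 1)) = e by rewrite /s divfK// gt_eqF// mulr_gt0// ltr_wpDl.
  by move: LAM s0; set q := L * A * M; clearbody q s; nra.
have er (mu : {finite_measure set RM -> \bar R}) : fine (mu setT) <= M ->
    `|\int[mu]_x h x - \int[mu]_x \int[N]_z h (x + s * z)| <= e / 3.
  move=> mM; apply: (le_trans (smoothing_error mu (ltW s0) hK hL)).
  by apply: le_trans sE; rewrite -/A ler_wpM2l// mulr_ge0// mulr_ge0// ltW.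
have /cvgrPdist_le /(_ (e / 3)) := smooth_cvg s0 (lipschitz_continuous hL) h0 hi.
rewrite divr_gt0// => /(_ isT); apply: filterS => n.
have := er G GM'; have := er (G_ n) (GM n).
set a := \int[G]_x h x; set b := \int[G_ n]_x h x.
set a' := \int[G]_x _; set b' := \int[G_ n]_x _.
by rewrite !ler_norml => /andP[? ?] /andP[? ?] /andP[? ?]; apply/andP; split; lra.
Qed.

(** Integrability for Lebesgue measure is removed by a cutoff. Tightness comes for free: the masses
    and the integrals of each cutoff converge, so the mass that the n-th measure has outside the
    cutoff is eventually close to that of the limit. *)
Let lipschitz_cvg2 (h : R -> R) (L K : R) : (forall x, 0 <= h x) ->
  (forall x, `|h x| <= K) -> (forall x y, `|h x - h y| <= L * `|x - y|) ->
  \int[G_ n]_x h x @[n --> \oo] --> \int[G]_x h x.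
Proof.
move=> h0 hK hL.
have K0 : 0 <= K by apply: le_trans (hK 0).
have mh := continuous_measurable_fun (lipschitz_continuous hL).
have mc k := continuous_measurable_fun (lipschitz_continuous (@cutoff_lipschitz R k)).
have nc k (x : R) : `|cutoff k x| <= 1 by rewrite ger0_norm ?cutoff_ge0 ?cutoff_le1.
have hc k : \int[G_ n]_x (h x * cutoff k x) @[n --> \oo] --> \int[G]_x (h x * cutoff k x).
  apply: (@lipschitz_cvg _ (L + K) K).
  - by move=> x; rewrite mulr_ge0 ?cutoff_ge0.
  - by move=> x; rewrite normrM -[leRHS]mulr1 ler_pM.
  - move=> x y; rewrite (_ : _ - _ = (h x - h y) * cutoff k x + h y * (cutoff k x - cutoff k y)); last by ring.
    rewrite (le_trans (ler_normD _ _))// [leRHS]mulrDl !normrM lerD//.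
      by rewrite -[leRHS]mulr1 ler_pM.
    by rewrite ler_pM// (le_trans (cutoff_lipschitz _ _ _))// mul1r.
  - apply: dominated_integrable (integrableZl_EFin K (integrable_cutoff k)) _ => [|x].
      exact: measurable_funM mh (mc k).
    by rewrite normrM ler_pM// ger0_norm ?cutoff_ge0.
have cc k : \int[G_ n]_x cutoff k x @[n --> \oo] --> \int[G]_x cutoff k x.
  apply: (@lipschitz_cvg _ 1 1) => //; first exact: cutoff_ge0.
    exact: cutoff_lipschitz.
  exact: integrable_cutoff.
have hi (mu : {finite_measure set RM -> \bar R}) : mu.-integrable setT (EFin \o h).
  by apply: (bounded_integrable (K := K)) => //; exact: finite_measure_lty.
have ci (mu : {finite_measure set RM -> \bar R}) k : mu.-integrable setT (EFin \o cutoff k).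
  exact: (finite_bounded_integrable mu (mc k) (nc k)).
have hci (mu : {finite_measure set RM -> \bar R}) k : mu.-integrable setT (EFin \o (fun x => h x * cutoff k x)).
  apply: (bounded_integrable (K := K)); [exact: finite_measure_lty|exact: measurable_funM mh (mc k)|].
  by move=> x; rewrite normrM -[leRHS]mulr1 ler_pM.
have oi (mu : {finite_measure set RM -> \bar R}) : mu.-integrable setT (EFin \o (fun=> 1 : R)).
  exact: finite_measure_integrable_cst.
have int1 (mu : {finite_measure set RM -> \bar R}) : \int[mu]_x 1 = fine (mu setT).
  by rewrite /Rintegral integral_cst// mul1e.
have err (mu : {finite_measure set RM -> \bar R}) k :
    `|\int[mu]_x h x - \int[mu]_x (h x * cutoff k x)| <= K * (fine (mu setT) - \int[mu]_x cutoff k x).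
  have -> : fine (mu setT) - \int[mu]_x cutoff k x = \int[mu]_x (1 - cutoff k x).
    by rewrite (RintegralB measurableT (oi mu) (ci mu k)) int1.
  rewrite -(RintegralB measurableT (hi mu) (hci mu k)) -(RintegralZl K measurableT (integrableB_EFin (oi mu) (ci mu k))).
  apply: Rintegral_norm_le.
  - exact: measurable_funB mh (measurable_funM mh (mc k)).
  - exact: (integrableZl_EFin K (integrableB_EFin (oi mu) (ci mu k))).
  - move=> x; rewrite -[X in X - _]mulr1 -mulrBr normrM ler_pM// ger0_norm ?subr_ge0 ?cutoff_le1//.
have tG : K * (fine (G setT) - \int[G]_x cutoff k x) @[k --> \oo] --> 0.
  rewrite -(mulr0 K) -(subrr (fine (G setT))); apply: cvgMr; apply: cvgB; first exact: cvg_cst.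
  rewrite -int1; apply: (@Rintegral_dominated_cvg _ _ _ G cutoff _ (fun=> 1)); [exact: mc| |exact: oi|exact: nc].
  move=> x; apply: cvg_near_cst; exists (Num.truncn `|x|).+1 => // k /= xk.
  by rewrite cutoff_near// ltW// (lt_le_trans (truncnS_gt _))// ler_nat.
apply/cvgrPdist_le => e e0; have e4 : 0 < e / 4 by rewrite divr_gt0.
have /cvgrPdist_le /(_ _ e4) [k0 _ /(_ k0 (leqnn _))] := tG.
rewrite sub0r normrN => hk0.
have tn : K * (fine (G_ n setT) - \int[G_ n]_x cutoff k0 x) @[n --> \oo] --> K * (fine (G setT) - \int[G]_x cutoff k0 x).
  by apply: cvgMr; exact: cvgB.
move/cvgrPdist_le : tn => /(_ _ e4); move/cvgrPdist_le : (hc k0) => /(_ _ e4).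
apply: filterS2 => n.
have := err G k0; have := err (G_ n) k0; move: hk0.
set a := \int[G]_x h x; set b := \int[G_ n]_x h x.
set a' := \int[G]_x (h x * _); set b' := \int[G_ n]_x (h x * _).
set p := K * (fine (G setT) - _); set q := K * (fine (G_ n setT) - _).
by rewrite !ler_norml => /andP[? ?] /andP[? ?] /andP[? ?] /andP[? ?] /andP[? ?]; apply/andP; split; lra.
Qed.

Let lipschitz_cvg3 (h : R -> R) (L K : R) :
  (forall x, `|h x| <= K) -> (forall x y, `|h x - h y| <= L * `|x - y|) ->
  \int[G_ n]_x h x @[n --> \oo] --> \int[G]_x h x.
Proof.
move=> hK hL; have mh := continuous_measurable_fun (lipschitz_continuous hL).
have hi (mu : {finite_measure set RM -> \bar R}) : mu.-integrable setT (EFin \o h).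
  by apply: (bounded_integrable (K := K)) => //; exact: finite_measure_lty.
have E (mu : {finite_measure set RM -> \bar R}) :
    \int[mu]_x h x = \int[mu]_x (h x + K) - K * fine (mu setT).
  have Ki : mu.-integrable setT (EFin \o (fun=> K)) by exact: finite_measure_integrable_cst.
  rewrite (RintegralD measurableT (hi mu) Ki).
  by rewrite [X in _ + X - _]/Rintegral integral_cst// fineM ?fin_num_measure//= addrK.
rewrite E; under eq_fun do rewrite E.
apply: cvgB; last exact: cvgMr.
apply: (@lipschitz_cvg2 _ L (K + K)).
- by move=> x; have := hK x; rewrite ler_norml => /andP[? ?]; lra.
- move=> x; rewrite (le_trans (ler_normD _ _))// lerD// ger0_norm//.
  by apply: le_trans (hK 0).
- by move=> x y; rewrite opprD addrACA subrr addr0.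
Qed.

(** The Pasch-Hausdorff envelope: for bounded f, the least k-Lipschitz function above f. *)
Definition upper_envelope (f : R -> R) (k : nat) (x : R) : R :=
  sup [set f y - k%:R * `|x - y| | y in [set: R]].

(** One half of the portmanteau theorem. The envelopes converge to f at its continuity points, hence
    almost everywhere for the limit measure; k is fixed first, and n afterwards. *)
Let upper_cvg (f : R -> R) (K : R) : measurable_fun setT f ->
  (forall x, `|f x| <= K) ->
  {ae G, forall x : R, {for x, continuous f}} ->
  forall e, 0 < e -> \forall n \near \oo, \int[G_ n]_x f x <= \int[G]_x f x + e.
Proof.
move=> mf fK cf e e0; set up := upper_envelope f.
have fK2 x : - K <= f x <= K by rewrite -ler_norml.
have hs k x : has_sup [set f y - k%:R * `|x - y| | y in [set: R]].
  split; first by exists (f 0 - k%:R * `|x - 0|); exists 0.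
  exists K => _ [y _ <-]; have /andP[_] := fK2 y.
  have : 0 <= k%:R * `|x - y| by rewrite mulr_ge0.
  lra.
have up_ge k x : f x <= up k x.
  apply: ub_le_sup; first by case: (hs k x).
  by exists x => //; rewrite subrr normr0 mulr0 subr0.
have up_le k x z : (forall y, f y - k%:R * `|x - y| <= z) -> up k x <= z.
  by move=> hz; apply: ge_sup; [case: (hs k x)|move=> _ [y _ <-]].
have upK k x : `|up k x| <= K.
  rewrite ler_norml; apply/andP; split.
    by apply: le_trans (up_ge k x); case/andP: (fK2 x).
  apply: up_le => y; have /andP[_] := fK2 y.
  have : 0 <= k%:R * `|x - y| by rewrite mulr_ge0.
  lra.
have upL1 k x x' : up k x - up k x' <= k%:R * `|x - x'|.
  rewrite lerBlDr; apply: up_le => y.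
  have h : f y - k%:R * `|x' - y| <= up k x'.
    by apply: ub_le_sup; [case: (hs k x')|exists y].
  have := ler_distD x x' y; rewrite [ `|x' - x| ]distrC => h2.
  have := @ler_wpM2l _ k%:R (ler0n _ _) _ _ h2; rewrite mulrDr; lra.
have upL k x x' : `|up k x - up k x'| <= k%:R * `|x - x'|.
  by rewrite ler_norml upL1 lerNl opprB distrC upL1.
have upc : \int[G]_x up k x @[k --> \oo] --> \int[G]_x f x.
  apply: (@Rintegral_ae_dominated_cvg _ _ _ G up _ (fun=> K)) => //.
  - by move=> k; exact: continuous_measurable_fun (lipschitz_continuous (upL k)).
  - apply: ae_imply cf => x cx; apply/cvgrPdist_le => r r0.
    have /cvgrPdist_le /(_ _ r0) /nbhs_ballP[dl /= dl0 hdl] := cx.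
    (* For such k, a point at distance at least dl is penalised by 2K or more, which the oscillation
       of f cannot compensate. *)
    exists (Num.truncn (2 * K / dl)).+1 => // k /= hk.
    rewrite distrC ger0_norm ?subr_ge0// lerBlDr; apply: up_le => y.
    have kpos : 0 <= k%:R * `|x - y| by rewrite mulr_ge0.
    have [xy|xy] := ltP `|x - y| dl.
      by have := hdl y xy; rewrite distrC /= => /(le_trans (ler_norm _)); lra.
    have kd : 2 * K <= k%:R * dl.
      by rewrite -ler_pdivrMr// ltW// (lt_le_trans (truncnS_gt _))// ler_nat.
    have := @ler_wpM2l _ k%:R (ler0n _ _) _ _ xy.
    have /andP[? ?] := fK2 y; have /andP[? ?] := fK2 x; lra.
  - exact: finite_measure_integrable_cst.
have e2 : 0 < e / 2 by rewrite divr_gt0.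
have /cvgrPdist_le /(_ _ e2) [k _ /(_ k (leqnn _))] := upc.
rewrite ler_distlC => /andP[_ hk].
have /cvgrPdist_le /(_ _ e2) := @lipschitz_cvg3 (up k) k%:R K (upK k) (upL k).
apply: filterS => n; rewrite ler_distlC => /andP[_ hn].
have : \int[G_ n]_x f x <= \int[G_ n]_x up k x.
  apply: le_Rintegral => //.
    by apply: (bounded_integrable (K := K)) => //; exact: finite_measure_lty.
  apply: (bounded_integrable (K := K)) => //; first exact: finite_measure_lty.
  exact: continuous_measurable_fun (lipschitz_continuous (upL k)).
lra.
Qed.

(** The one-sided bound is applied to f and to - f. *)
Theorem levy_continuity (f : R -> R) (K : R) : measurable_fun setT f ->
  (forall x, `|f x| <= K) ->
  {ae G, forall x : R, {for x, continuous f}} ->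
  \int[G_ n]_x f x @[n --> \oo] --> \int[G]_x f x.
Proof.
move=> mf fK cf; apply/cvgrPdist_le => e e0.
have fi (mu : {finite_measure set RM -> \bar R}) : mu.-integrable setT (EFin \o f).
  by apply: (bounded_integrable (K := K)) => //; exact: finite_measure_lty.
have E (mu : {finite_measure set RM -> \bar R}) : \int[mu]_x (- f x) = - \int[mu]_x f x.
  by under eq_Rintegral do rewrite -mulN1r; rewrite (RintegralZl _ measurableT (fi mu)) mulN1r.
have h1 := upper_cvg mf fK cf e0.
have h2 : \forall n \near \oo, \int[G_ n]_x (- f x) <= \int[G]_x (- f x) + e.
  apply: (@upper_cvg (fun x => - f x) K) => //.
  - exact: measurable_funN.
  - by move=> x; rewrite normrN.
  - by apply: ae_imply cf => x cx; exact: cvgN.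
move: h1 h2; apply: filterS2 => n; rewrite !E ler_distlC => ? ?; apply/andP; split; lra.
Qed.

End LevyContinuity.
(** * Small-time asymptotics of the marginals *)

Section AddAtom.
Context {R : realType}.
Local Notation RM := (measurableTypeR R).
Variables (m : {nonneg R}) (mu : {finite_measure set RM -> \bar R}).

Definition add_atom0 := measure_add (mscale m (\d_(0 : RM))) mu.

HB.instance Definition _ := Measure.on add_atom0.

Let add_atom0_fin : fin_num_fun add_atom0.
Proof.
move=> A mA; rewrite /add_atom0 measure_addE fin_numD; apply/andP; split.
  by rewrite /mscale/= fin_numM// diracE.
exact: fin_num_measure.
Qed.

HB.instance Definition _ := Measure_isFinite.Build _ _ _ add_atom0 add_atom0_fin.

Lemma Rintegral_add_atom0 (f : R -> R) (K : R) : measurable_fun setT f ->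
  (forall x, `|f x| <= K) ->
  \int[add_atom0]_x f x = m%:num * f 0 + \int[mu]_x f x.
Proof.
move=> mf fK; have mf' : measurable_fun setT (EFin \o f) by exact/measurable_EFinP.
have fi2 := finite_bounded_integrable mu mf fK.
have I0 (g : R -> \bar R) : measurable_fun setT g -> (forall x, 0 <= g x)%E ->
    (\int[mscale m (\d_(0%R : RM))]_x g x = m%:num%:E * g 0%R)%E.
  move=> mg g0; rewrite ge0_integral_mscale// integral_dirac// diracT mul1e//.
have fi1 : (mscale m (\d_(0 : RM))).-integrable setT (EFin \o f).
  apply/integrableP; split => //; rewrite I0 ?ltry//.
  by apply/measurable_EFinP; apply: measurableT_comp.
rewrite /Rintegral integral_measure_add// fineD//; [|exact: integrable_fin_num..].
congr (_ + _); rewrite integralE !I0//; last first.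
- exact: measurable_funepos.
- exact: measurable_funeneg.
rewrite funeposE funenegE -EFinN -!EFin_max -!EFinM -EFinB /=.
by have [h|h] := leP (f 0) 0; [rewrite max_l|rewrite max_r ?oppr_le0 1?ltW]; rewrite ?oppr_ge0//; ring.
Qed.

Lemma ae_add_atom0 (Q : R -> Prop) : Q 0 -> {ae mu, forall x, Q x} ->
  {ae add_atom0, forall x, Q x}.
Proof.
(* The exceptional set may contain 0, which is now an atom; [Q 0] allows its removal. *)
move=> Q0 [A [mA A0 QA]]; exists (A `\ 0); split.
- exact: measurableD.
- transitivity (mscale m (\d_(0%R : RM)) (A `\ 0%R) + mu (A `\ 0%R))%E; first exact: measure_addE.
  have -> : mscale m (\d_(0%R : RM)) (A `\ 0%R) = 0%E.
    by rewrite /mscale /= diracE memNset ?mule0//= => -[].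
  rewrite add0e.
  apply/eqP; rewrite eq_le measure_ge0 andbT -A0.
  by apply: le_measure; rewrite ?inE//; exact: measurableD.
- move=> x /= nQ; split; first exact: QA.
  by move=> x0; apply: nQ; rewrite x0.
Qed.

End AddAtom.

(** * The Gaussian weight *)

Section Weight.
Context {R : realType}.
Implicit Type x : R.

Definition gauss_weight x : R := 1 - expR (- x ^+ 2 / 2).

Lemma gauss_weight_ge0 x : 0 <= gauss_weight x.
Proof. by rewrite subr_ge0 expR_gauss_le1. Qed.

Lemma gauss_weight0 : gauss_weight 0 = 0.
Proof. by rewrite /gauss_weight expr0n/= oppr0 mul0r expR0 subrr. Qed.

Lemma gauss_weight_le x : gauss_weight x <= Num.min (x ^+ 2) 1.
Proof.
rewrite le_min; apply/andP; split; rewrite /gauss_weight.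
  by have := expR_ge1Dx (- x ^+ 2 / 2); have := sqr_ge0 x; lra.
by have := expR_ge0 (- x ^+ 2 / 2); lra.
Qed.

Lemma gauss_weight_bounds x :
  x ^+ 2 / (2 + x ^+ 2) <= gauss_weight x <= x ^+ 2 / 2.
Proof.
rewrite /gauss_weight mulNr; have := expR_ge1Dx (- (x ^+ 2 / 2)).
rewrite expRN => lo; apply/andP; split; last by lra.
have x2 := sqr_ge0 x; have up := expR_ge1Dx (x ^+ 2 / 2).
have e0 := expR_gt0 (x ^+ 2 / 2).
rewrite ler_pdivrMr ?ltr_wpDr//.
have : (expR (x ^+ 2 / 2))^-1 * (2 + x ^+ 2) <= 2.
  by rewrite mulrC ler_pdivrMr//; lra.
move: x2; set y := x ^+ 2; set e := _^-1; lra.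
Qed.

(** The factor 3 is the value of 2 + x^2 at |x| = 1, where min(x^2, 1) changes form. *)
Lemma min_sqr_le x : Num.min (x ^+ 2) 1 <= 3 * gauss_weight x.
Proof.
have /andP[h _] := gauss_weight_bounds x; have x2 := sqr_ge0 x.
apply: (@le_trans _ _ (3 * (x ^+ 2 / (2 + x ^+ 2)))); last by rewrite ler_wpM2l.
rewrite mulrA ler_pdivlMr ?ltr_wpDr//.
by move: x2; set y := x ^+ 2; case: (leP y 1) => *; nra.
Qed.

Lemma gauss_weight_gt0 x : x != 0 -> 0 < gauss_weight x.
Proof.
move=> x0; have := min_sqr_le x; have : 0 < Num.min (x ^+ 2) 1.
  by rewrite lt_min ltr01 andbT exprn_even_gt0.
lra.
Qed.

Lemma continuous_gauss_weight : continuous gauss_weight.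
Proof.
by move=> x; apply: differentiable_continuous; apply/derivable1_diffP; apply: ex_derive.
Qed.

Lemma measurable_gauss_weight : measurable_fun setT gauss_weight.
Proof. exact: continuous_measurable_fun continuous_gauss_weight. Qed.

(* Averaging over [z] and [-z] keeps the formula free of sine terms. *)
Lemma gauss_weight_cos (u a x : R) : gauss_weight x * cos (u * x - a) =
  cos (u * x - a) - \int[normal_prob 0 1]_z
    (2^-1 * (cos ((u + z) * x - a) + cos ((u - z) * x - a))).
Proof.
rewrite /gauss_weight mulrBl mul1r; congr (_ - _).
rewrite mulrC -normal_characteristic_function -RintegralZl//; last first.
  apply: (@finite_bounded_integrable _ _ _ _ _ 1); first exact: measurable_cosM.
  by move=> z; rewrite ler_norml cos_geN1 cos_le1.
apply: eq_Rintegral => z _.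
rewrite (_ : (u + z) * x - a = (u * x - a) + x * z); last by ring.
rewrite (_ : (u - z) * x - a = (u * x - a) - x * z); last by ring.
by move: (u * x - a) (x * z) => p q; rewrite cosD cosB; field.
Qed.

End Weight.
Lemma measurable_invr (R : realType) : measurable_fun setT (fun x : R => x^-1).
Proof.
have m0 : measurable [set 0 : R] by [].
rewrite -(setUv [set 0]); apply/measurable_funU => //; first exact: measurableC.
split; first exact: measurable_fun_set1.
apply: open_continuous_measurable_fun; first by apply: closed_openC; exact: closed_eq.
by move=> x /set_mem /eqP x0; exact: inv_continuous.
Qed.

(** * The characteristic exponent and the weighted Lévy measure *)

Section LevyTriplet.
Context {R : realType}.
Local Notation RM := (measurableTypeR R).
Local Notation N := (normal_prob (0 : R) 1).

Section Exponent.
Variables (b c : R) (F : {measure set RM -> \bar R}).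

(** The characteristic exponent is - [exponent_re] + i [exponent_im]; the sign makes this part
    nonnegative. *)
Definition exponent_re (u : R) : R := c * u ^+ 2 / 2 + \int[F]_x (1 - cos (u * x)).

Definition exponent_im (u : R) : R :=
  u * b + \int[F]_x (sin (u * x) - u * x * \1_[set y : R | `|y| <= 1] x).

Hypothesis c0 : 0 <= c.
Hypothesis Fint : (\int[F]_x (Num.min (x ^+ 2) 1)%:E < +oo)%E.

Lemma measurable_unit_ball : measurable [set y : R | `|y| <= 1].
Proof.
have -> : [set y : R | `|y| <= 1] = `[-1, 1]%classic.
  by apply/seteqP; split => y /=; rewrite in_itv/= ler_norml.
exact: measurable_itv.
Qed.

Lemma integrable_min_sqr : F.-integrable setT (EFin \o (fun x : R => Num.min (x ^+ 2) 1)).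
Proof.
apply/integrableP; split.
  by apply/measurable_EFinP; apply: measurable_minr => //; exact: exprn_measurable.
apply: le_lt_trans Fint; rewrite le_eqVlt; apply/orP; left; apply/eqP.
by apply: eq_integral => x _ /=; rewrite ger0_norm// le_min sqr_ge0 ler01.
Qed.

Lemma integrable_le_min_sqr (g : R -> R) (K : R) : measurable_fun setT g ->
  (forall x, `|g x| <= K * Num.min (x ^+ 2) 1) -> F.-integrable setT (EFin \o g).
Proof.
by move=> mg gK; apply: (dominated_integrable _ (integrableZl_EFin K integrable_min_sqr) gK).
Qed.

Lemma integrable_gauss_weight : F.-integrable setT (EFin \o gauss_weight).
Proof.
apply: (@integrable_le_min_sqr _ 1); first exact: measurable_gauss_weight.
by move=> x; rewrite mul1r ger0_norm ?gauss_weight_ge0// gauss_weight_le.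
Qed.

Definition weighted_levy : {finite_measure set RM -> \bar R} :=
  @density_measure _ RM R F gauss_weight (@gauss_weight_ge0 R) integrable_gauss_weight.

Lemma Rintegral_weighted_levy (g : R -> R) : measurable_fun setT g ->
  \int[weighted_levy]_x g x = \int[F]_x (g x * gauss_weight x).
Proof.
move=> mg; apply: Rintegral_density => //; first exact: gauss_weight_ge0.
exact: measurable_gauss_weight.
Qed.

(* Valid although the left factor is junk at 0, since both sides vanish there. *)
Lemma divK_gauss_weight (g : R -> R) x : g 0 = 0 ->
  g x / gauss_weight x * gauss_weight x = g x.
Proof.
move=> g0; have [->|x0] := eqVneq x 0; first by rewrite g0 gauss_weight0 mulr0.
by rewrite divfK// gt_eqF// gauss_weight_gt0.
Qed.

Lemma Rintegral_levy (g : R -> R) : measurable_fun setT g -> g 0 = 0 ->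
  \int[F]_x g x = \int[weighted_levy]_x (g x / gauss_weight x).
Proof.
move=> mg g0; rewrite Rintegral_weighted_levy.
  by apply: eq_Rintegral => x _; rewrite divK_gauss_weight.
apply: measurable_funM => //; apply: measurableT_comp; [exact: measurable_invr|exact: measurable_gauss_weight].
Qed.

Lemma one_sub_cos_le_min (u x : R) : 1 - cos (u * x) <= 2 * (1 + u ^+ 2) * Num.min (x ^+ 2) 1.
Proof.
have h1 := one_sub_cos_le (u * x); have h2 := one_sub_cos_le2 (u * x).
have u2 := sqr_ge0 u; have x2 := sqr_ge0 x; rewrite exprMn in h1.
by case: (leP (x ^+ 2) 1) => x1; [|lra]; have := mulr_ge0 u2 x2; lra.
Qed.

Lemma sin_compensated_le_min (u x : R) :
  `|sin (u * x) - u * x * \1_[set y : R | `|y| <= 1] x| <= 2 * (1 + u ^+ 2) * Num.min (x ^+ 2) 1.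
Proof.
have u2 := sqr_ge0 u; have x2 := sqr_ge0 x.
rewrite indicE; have [x1|x1] := boolP (x \in [set y : R | `|y| <= 1]).
  rewrite mulr1 (le_trans (norm_sin_sub_le_sqr _))// exprMn.
  move: x1; rewrite inE /= => x1.
  have x21 : x ^+ 2 <= 1 by rewrite -real_normK ?num_real// expr_le1.
  by rewrite min_l//; lra.
rewrite mulr0 subr0 (le_trans (sin_max _))//.
move: x1; rewrite notin_setE /= => /negP; rewrite -ltNge => x1.
have x21 : 1 <= x ^+ 2 by rewrite -real_normK ?num_real// exprn_ege1// ltW.
by rewrite min_r//; lra.
Qed.

Lemma measurable_sin_compensated u :
  measurable_fun setT (fun x : R => sin (u * x) - u * x * \1_[set y : R | `|y| <= 1] x).
Proof.
apply: measurable_funB; first exact: measurable_sinM.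
apply: measurable_funM; first exact: measurable_funM.
by apply: measurable_indic; exact: measurable_unit_ball.
Qed.

Lemma measurable_one_sub_cos u : measurable_fun setT (fun x : R => 1 - cos (u * x)).
Proof. by apply: measurable_funB => //; exact: measurable_cosM. Qed.

Lemma integrable_one_sub_cos u : F.-integrable setT (EFin \o (fun x : R => 1 - cos (u * x))).
Proof.
apply: (@integrable_le_min_sqr _ (2 * (1 + u ^+ 2))); first exact: measurable_one_sub_cos.
by move=> x; rewrite ger0_norm ?one_sub_cos_ge0 ?one_sub_cos_le_min.
Qed.

Lemma integrable_sin_compensated u : F.-integrable setT
  (EFin \o (fun x : R => sin (u * x) - u * x * \1_[set y : R | `|y| <= 1] x)).
Proof.
apply: (@integrable_le_min_sqr _ (2 * (1 + u ^+ 2))); first exact: measurable_sin_compensated.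
exact: sin_compensated_le_min.
Qed.

Lemma exponent_re_ge0 u : 0 <= exponent_re u.
Proof.
apply: addr_ge0; first by rewrite divr_ge0// mulr_ge0// sqr_ge0.
by apply: Rintegral_ge0 => x _; exact: one_sub_cos_ge0.
Qed.

(** Quadratic growth makes the difference quotients of the characteristic functions integrable in
    the frequency for the normal law, uniformly in n. *)
Lemma exponent_growth : exists C, 0 <= C /\
  forall u, exponent_re u + `|exponent_im u| <= C * (1 + u ^+ 2).
Proof.
set M := \int[F]_x Num.min (x ^+ 2) 1.
have M0 : 0 <= M by apply: Rintegral_ge0 => x _; rewrite le_min sqr_ge0 ler01.
exists (c / 2 + `|b| + 4 * M); split; first by rewrite !addr_ge0 ?mulr_ge0.
move=> u; have u2 := sqr_ge0 u.
have hM (g : R -> R) : measurable_fun setT g ->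
    (forall x, `|g x| <= 2 * (1 + u ^+ 2) * Num.min (x ^+ 2) 1) ->
    `|\int[F]_x g x| <= 2 * (1 + u ^+ 2) * M.
  move=> mg hg; rewrite -(RintegralZl _ measurableT integrable_min_sqr).
  exact: (Rintegral_norm_le _ (integrableZl_EFin _ integrable_min_sqr) hg).
have h1 := hM _ (measurable_sin_compensated u) (sin_compensated_le_min u).
have h2 : \int[F]_x (1 - cos (u * x)) <= 2 * (1 + u ^+ 2) * M.
  apply: (le_trans (ler_norm _) (hM _ (measurable_one_sub_cos u) _)) => x.
  by rewrite ger0_norm ?one_sub_cos_ge0 ?one_sub_cos_le_min.
have h3 : `|exponent_im u| <= `|b| * (1 + u ^+ 2) + 2 * (1 + u ^+ 2) * M.
  rewrite (le_trans (ler_normD _ _))// lerD// normrM mulrC ler_wpM2l//.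
  by rewrite -[u ^+ 2]real_normK ?num_real//; have := sqr_ge0 (`|u| - 2^-1); lra.
have : exponent_re u <= c / 2 * (1 + u ^+ 2) + 2 * (1 + u ^+ 2) * M.
  by apply: lerD => //; have := c0; lra.
by move: h3; move: (mulr_ge0 u2 M0); lra.
Qed.

End Exponent.
End LevyTriplet.
Lemma Rintegral_probability_le d (T : measurableType d) (R : realType)
    (P : probability T R) (f : T -> R) (K : R) :
  measurable_fun setT f -> (forall x, `|f x| <= K) -> `|\int[P]_x f x| <= K.
Proof.
move=> mf fK; rewrite -[leRHS](Rintegral_probability_cst P); apply: Rintegral_norm_le => //.
exact: finite_measure_integrable_cst.
Qed.

(** * Weak convergence of the weighted laws *)

Section SmallTime.
Context {R : realType}.
Local Notation RM := (measurableTypeR R).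
Local Notation N := (normal_prob (0 : R) 1).

Lemma damped_cos_bound (t k th a : R) : 0 <= t -> 0 <= k ->
  `|expR (- (t * k)) * cos (t * th - a) - cos a| <= t * (k + `|th|).
Proof.
move=> t0 k0; rewrite -(cosN a).
rewrite (_ : _ - _ = expR (- (t * k)) * (cos (t * th - a) - cos (- a)) +
   (expR (- (t * k)) - 1) * cos (- a)); last by ring.
have e0 := expR_ge0 (- (t * k)).
have e1 : expR (- (t * k)) <= 1 by rewrite -[leRHS]expR0 ler_expR oppr_le0 mulr_ge0.
have e2 := expR_ge1Dx (- (t * k)).
apply: (le_trans (ler_normD _ _)); rewrite [leLHS]addrC [leRHS]mulrDr; apply: lerD.
  rewrite normrM -[leRHS]mulr1 ler_pM//; last by rewrite ler_norml cos_geN1 cos_le1.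
  by rewrite ler_norml; apply/andP; split; have := mulr_ge0 t0 k0; lra.
rewrite normrM (ger0_norm e0) -[leRHS]mul1r ler_pM//.
by rewrite (le_trans (cos_lipschitz _ _))// opprK subrK normrM (ger0_norm t0).
Qed.

(** A derivative in t at t = 0, read along the sequence [D n]. *)
Lemma damped_cos_cvg (D : nat -> R) (k th a : R) :
  (forall n, 0 < D n) -> D n @[n --> \oo] --> 0 ->
  (D n)^-1 * (expR (- (D n * k)) * cos (D n * th - a) - cos a) @[n --> \oo] -->
    th * sin a - k * cos a.
Proof.
move=> D0 Dc; pose g (t : R) : R := expR (- (t * k)) * cos (t * th - a).
have dg : is_derive (0 : R) (1 : R) g (th * sin a - k * cos a).
  rewrite /g; apply: is_derive_eq; rewrite /GRing.scale /= !mul0r oppr0 expR0 sub0r sinN cosN; ring.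
have := @derivable_nbhs _ _ _ g 0 1.
case: dg => dg dgE.
have : h^-1 *: (g (h *: 1 + 0) - g 0) @[h --> 0^'] --> 'D_1 g 0.
  by move: dg => /cvg_ex [l hl]; rewrite /derive (cvg_lim _ hl).
rewrite dgE => /cvgr_dnbhsP /(_ D) h _.
have {}h := h (conj (fun n => lt0r_neq0 (D0 n)) Dc).
move: h; rewrite (_ : (fun _ => _) = fun n => (D n)^-1 * (expR (- (D n * k)) * cos (D n * th - a) - cos a))//.
apply/funext => n; rewrite /g /GRing.scale /= mulr1 addr0 !mul0r oppr0 expR0 sub0r cosN mul1r//.
Qed.

Variables (b c : R) (F : {measure set RM -> \bar R}).
Hypothesis c0 : 0 <= c.
Hypothesis Fint : (\int[F]_x (Num.min (x ^+ 2) 1)%:E < +oo)%E.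
Variables (mu : nat -> probability RM R) (D : nat -> R).
Hypothesis D0 : forall n, 0 < D n.
Hypothesis Dc : D n @[n --> \oo] --> 0.
Hypothesis muE : forall n u a, \int[mu n]_x cos (u * x - a) =
  expR (- (D n * exponent_re c F u)) * cos (D n * exponent_im b F u - a).

Local Notation kap := (exponent_re c F).
Local Notation the := (exponent_im b F).
Local Notation GF := (weighted_levy Fint).

Let nu_wi n : (mu n).-integrable setT (EFin \o (fun x => (D n)^-1 * gauss_weight x)).
Proof.
apply: integrableZl_EFin; apply: (@finite_bounded_integrable _ _ _ _ _ 1).
  exact: measurable_gauss_weight.
move=> x; rewrite ger0_norm ?gauss_weight_ge0// (le_trans (gauss_weight_le x))//.
by rewrite ge_min lexx orbT.
Qed.

Let nu_w0 n x : 0 <= (D n)^-1 * gauss_weight x.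
Proof. by rewrite mulr_ge0 ?gauss_weight_ge0// invr_ge0 ltW. Qed.

Let nu n : {finite_measure set RM -> \bar R} := @density_measure _ RM R (mu n) _ (nu_w0 n) (nu_wi n).

Let nuE n (g : R -> R) : measurable_fun setT g ->
  \int[nu n]_x g x = \int[mu n]_x (g x * ((D n)^-1 * gauss_weight x)).
Proof.
move=> mg; apply: (@Rintegral_density _ RM R (mu n) (nu n) _ (nu_w0 n)) => //.
by apply: measurable_funM => //; exact: measurable_gauss_weight.
Qed.

Let c2 : {nonneg R} := NngNum (divr_ge0 c0 (ler0n R 2)).
Let G := add_atom0 c2 GF.

Let measurable_cosB (u a : R) : measurable_fun setT (fun x : R => cos (u * x - a)).
Proof.
apply: measurableT_comp; first by apply: continuous_measurable_fun; exact: continuous_cos.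
by apply: measurable_funB => //; exact: measurable_funM.
Qed.

Let cos_le (x : R) : `|cos x| <= 1.
Proof. by rewrite ler_norml cos_geN1 cos_le1. Qed.

Let e n u a := \int[mu n]_x cos (u * x - a).

Let nu_cf n u a : \int[nu n]_x cos (u * x - a) =
  \int[N]_z ((D n)^-1 * (e n u a - 2^-1 * (e n (u + z) a + e n (u - z) a))).
Proof.
have ci : (mu n).-integrable setT (EFin \o (fun x => cos (u * x - a))).
  exact: (finite_bounded_integrable (mu n) (measurable_cosB u a) (fun x => cos_le _)).
rewrite nuE; last exact: measurable_cosB.
transitivity ((D n)^-1 * \int[mu n]_x (gauss_weight x * cos (u * x - a))).
  rewrite -RintegralZl//.
    by apply: eq_Rintegral => x _; ring.
  apply: (@finite_bounded_integrable _ _ _ _ _ 1).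
    by apply: measurable_funM; [exact: measurable_gauss_weight|exact: measurable_cosB].
  move=> x; rewrite normrM -[leRHS]mulr1 ler_pM// ger0_norm ?gauss_weight_ge0//.
  by rewrite (le_trans (gauss_weight_le x))// ge_min lexx orbT.
pose p (x z : R) : R := 2^-1 * (cos ((u + z) * x - a) + cos ((u - z) * x - a)).
have p1 x z : `|p x z| <= 1.
  rewrite /p normrM ger0_norm// -[leRHS](mulVf (x := 2))// ler_wpM2l//.
  by rewrite (le_trans (ler_normD _ _))// (_ : 2 = 1 + 1) ?lerD.
have mp : measurable_fun setT (fun q : RM * RM => p q.1 q.2).
  have mcos := continuous_measurable_fun (@continuous_cos R).
  apply: measurable_funM => //; apply: measurable_funD; apply: (measurableT_comp mcos).
    by apply: measurable_funB => //; apply: measurable_funM => //; apply: measurable_funD.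
  by apply: measurable_funB => //; apply: measurable_funM => //; apply: measurable_funB.
have mP : measurable_fun setT (fun x : RM => \int[N]_z p x z).
  by apply: (@measurable_Rintegral_param _ _ _ _ _ N (fun q => p q.1 q.2) 1) => // q.
have Pi : (mu n).-integrable setT (EFin \o (fun x => \int[N]_z p x z)).
  apply: (@finite_bounded_integrable _ _ _ _ _ 1) => // x.
  apply: Rintegral_probability_le => //.
  exact: (measurableT_comp mp (measurable_pair1 x)).
have mpz z : measurable_fun setT (fun x : RM => p x z).
  exact: (measurableT_comp mp (measurable_pair2 z)).
have cosi v : (mu n).-integrable setT (EFin \o (fun x => cos (v * x - a))).
  exact: (finite_bounded_integrable (mu n) (measurable_cosB v a) (fun x => cos_le _)).
have ez z : 2^-1 * (e n (u + z) a + e n (u - z) a) = \int[mu n]_x p x z.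
  rewrite /p (RintegralZl _ measurableT (integrableD_EFin (cosi _) (cosi _))).
  by rewrite (RintegralD measurableT (cosi _) (cosi _)).
under [RHS]eq_Rintegral do rewrite ez.
have mQ : measurable_fun setT (fun z : RM => \int[mu n]_x p x z).
  apply: (@measurable_Rintegral_param _ _ _ _ _ (mu n) (fun q : RM * RM => p q.2 q.1) 1) => //.
  have msw : measurable_fun setT (fun q : RM * RM => (q.2, q.1)).
    by apply: measurable_fun_pair; [exact: measurable_snd|exact: measurable_fst].
  exact: (measurableT_comp mp msw).
have Qi : N.-integrable setT (EFin \o (fun z => \int[mu n]_x p x z)).
  apply: (@finite_bounded_integrable _ _ _ _ _ 1) => // z.
  exact: Rintegral_probability_le.
have e0i : N.-integrable setT (EFin \o (fun=> e n u a)) by exact: finite_measure_integrable_cst.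
rewrite (RintegralZl _ measurableT (integrableB_EFin e0i Qi)); congr (_ * _).
rewrite (RintegralB measurableT e0i Qi) Rintegral_probability_cst.
under eq_Rintegral do rewrite gauss_weight_cos.
rewrite (RintegralB measurableT ci Pi); congr (_ - _).
apply: (@Rintegral_swap _ _ _ _ _ (mu n) N (fun q => p q.1 q.2) (fun=> 1) (fun=> 1)) => //.
- exact: finite_measure_integrable_cst.
- exact: finite_measure_integrable_cst.
- by move=> x z /=; rewrite mulr1.
Qed.

(** Terms linear in the frequency disappear from the second difference in z. The quadratic term
    leaves (c/2) z^2, and the jumps leave cos(ux - a)(1 - cos(zx)). Dividing by the weight moves the
    jump integral to the finite measure [GF], where integrals can be exchanged. *)
Let limit_integrand u a z :
  the u * sin a - kap u * cos a
  - 2^-1 * (the (u + z) * sin a - kap (u + z) * cos a + (the (u - z) * sin a - kap (u - z) * cos a))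
  = c / 2 * cos a * z ^+ 2 + \int[GF]_x (cos (u * x - a) * (1 - cos (z * x)) / gauss_weight x).
Proof.
have g0 : (fun x : R => cos (u * x - a) * (1 - cos (z * x))) 0 = 0.
  by rewrite /= !mulr0 cos0 subrr mulr0.
have mg : measurable_fun setT (fun x : R => cos (u * x - a) * (1 - cos (z * x))).
  by apply: measurable_funM => //; exact: measurable_one_sub_cos.
rewrite -(Rintegral_levy Fint mg g0).
pose A (v : R) := \int[F]_x (1 - cos (v * x)).
pose B (v : R) := \int[F]_x (sin (v * x) - v * x * \1_[set y : R | `|y| <= 1] x).
have Ai := integrable_one_sub_cos Fint.
have Bi := integrable_sin_compensated Fint.
have Ei v : F.-integrable setT (EFin \o (fun x => sin a * (sin (v * x) - v * x * \1_[set y : R | `|y| <= 1] x) - cos a * (1 - cos (v * x)))).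
  exact: (integrableB_EFin (integrableZl_EFin _ (Bi v)) (integrableZl_EFin _ (Ai v))).
have E v : sin a * B v - cos a * A v = \int[F]_x (sin a * (sin (v * x) - v * x * \1_[set y : R | `|y| <= 1] x) - cos a * (1 - cos (v * x))).
  rewrite (RintegralB measurableT (integrableZl_EFin _ (Bi v)) (integrableZl_EFin _ (Ai v))).
  by rewrite (RintegralZl _ measurableT (Ai v)) (RintegralZl _ measurableT (Bi v)).
transitivity (c / 2 * cos a * z ^+ 2 + ((sin a * B u - cos a * A u) -
    2^-1 * ((sin a * B (u + z) - cos a * A (u + z)) + (sin a * B (u - z) - cos a * A (u - z))))).
  by rewrite /exponent_re /exponent_im -/(A u) -/(A (u + z)) -/(A (u - z)) -/(B u) -/(B (u + z)) -/(B (u - z)); field.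
congr (_ + _); rewrite !E.
rewrite -(RintegralD measurableT (Ei _) (Ei _)) -(RintegralZl _ measurableT (integrableD_EFin (Ei _) (Ei _))).
rewrite -(RintegralB measurableT (Ei _) (integrableZl_EFin _ (integrableD_EFin (Ei _) (Ei _)))).
apply: eq_Rintegral => x _; set I := \1_ _ x.
have -> : (u + z) * x = u * x + z * x by ring.
have -> : (u - z) * x = u * x - z * x by ring.
rewrite !mulrDl !mulNr.
by move: (u * x) (z * x) => p q; rewrite !sinD !cosD !sinN !cosN; field.
Qed.

Let nu_cvg u a : \int[nu n]_x cos (u * x - a) @[n --> \oo] --> \int[G]_x cos (u * x - a).
Proof.
have [C [C0 hC]] := @exponent_growth R b c F c0 Fint.
pose f n (z : R) := (D n)^-1 * (e n u a - 2^-1 * (e n (u + z) a + e n (u - z) a)).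
pose q n v := (D n)^-1 * (e n v a - cos a).
have fE n z : f n z = q n u - 2^-1 * (q n (u + z) + q n (u - z)).
  by rewrite /f /q; move: (e n u a) (e n (u + z) a) (e n (u - z) a) => p1 p2 p3; field; rewrite gt_eqF.
pose l v := the v * sin a - kap v * cos a.
have q_cvg v : q n v @[n --> \oo] --> l v.
  by rewrite /q /e; under eq_fun do rewrite muE; exact: damped_cos_cvg.
have q_le n v : `|q n v| <= C * (1 + v ^+ 2).
  rewrite /q /e muE normrM gtr0_norm ?invr_gt0// ler_pdivrMl//.
  apply: (le_trans (damped_cos_bound _ _ _ _)); [exact: ltW|exact: exponent_re_ge0|].
  by rewrite ler_wpM2l ?hC// ltW.
pose H (z : R) := \int[GF]_x (cos (u * x - a) * (1 - cos (z * x)) / gauss_weight x).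
have mem n (s : R) : measurable_fun setT (fun z : R => e n (u + s * z) a).
  apply: (@measurable_Rintegral_param _ _ RM RM _ (mu n) (fun p => cos ((u + s * p.1) * p.2 - a)) 1) => //.
  apply: measurableT_comp; first by apply: continuous_measurable_fun; exact: continuous_cos.
  apply: measurable_funB => //; apply: measurable_funM; last exact: measurable_snd.
  by apply: measurable_funD => //; apply: measurable_funM => //; exact: measurable_fst.
have mf n : measurable_fun setT (f n).
  have m1 := mem n 1; have m2 := mem n (-1).
  rewrite (_ : f n = fun z => (D n)^-1 * (e n u a - 2^-1 * (e n (u + 1 * z) a + e n (u + (-1) * z) a))).
    apply: measurable_funM => //; apply: measurable_funB => //; apply: measurable_funM => //.
    exact: measurable_funD.
  by apply/funext => z; rewrite mul1r mulN1r.
have f_cvg z : f n z @[n --> \oo] --> c / 2 * cos a * z ^+ 2 + H z.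
  rewrite -limit_integrand -/(l _) -/(l _) -/(l _); under eq_fun do rewrite fE.
  by apply: cvgB => //; apply: cvgMr; exact: cvgD.
have gi : N.-integrable setT (EFin \o (fun z : R => C * (2 + 2 * u ^+ 2 + z ^+ 2))).
  apply: integrableZl_EFin; apply: integrableD_EFin; last exact: integrable_normal_sqr.
  exact: finite_measure_integrable_cst.
have f_le n z : `|f n z| <= C * (2 + 2 * u ^+ 2 + z ^+ 2).
  rewrite fE; have := q_le n u; have := q_le n (u + z); have := q_le n (u - z).
  rewrite !ler_norml => /andP[? ?] /andP[? ?] /andP[? ?].
  rewrite (_ : C * (2 + 2 * u ^+ 2 + z ^+ 2) = C * (1 + u ^+ 2) + 2^-1 * (C * (1 + (u + z) ^+ 2) + C * (1 + (u - z) ^+ 2))); last by field.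
  by apply/andP; split; lra.
have fint : \int[N]_z f n z @[n --> \oo] --> \int[N]_z (c / 2 * cos a * z ^+ 2 + H z).
  exact: (@Rintegral_dominated_cvg _ _ _ N f _ (fun z : R => C * (2 + 2 * u ^+ 2 + z ^+ 2))).
rewrite (Rintegral_add_atom0 _ _ (measurable_cosB u a) (fun x => cos_le _)) mulr0 sub0r cosN /=.
(* What is left is the Gaussian mean in z: z^2 has mean 1, whence the atom of mass c/2, and 1 -
   cos(zx) has mean w(x), whence the weighted Lévy measure. *)
suff -> : c / 2 * cos a + \int[GF]_x cos (u * x - a) = \int[N]_z (c / 2 * cos a * z ^+ 2 + H z).
  by under eq_fun do rewrite nu_cf.
have ml : measurable_fun setT (fun z : R => c / 2 * cos a * z ^+ 2 + H z).
  exact: (measurable_fun_cvg (h := f)).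
have li : N.-integrable setT (EFin \o (fun z : R => c / 2 * cos a * z ^+ 2 + H z)).
  apply: (dominated_integrable _ gi) => // z.
  by apply: (cvgn_le_lim (cvg_norm (f_cvg z))) => n; exact: f_le.
have z2i := integrableZl_EFin (c / 2 * cos a) (@integrable_normal_sqr R).
have Hi : N.-integrable setT (EFin \o H).
  have := integrableB_EFin li z2i; congr (is_true (_.-integrable _ _)).
  by apply/funext => z /=; rewrite addrAC subrr add0r.
rewrite (RintegralD measurableT z2i Hi) (RintegralZl _ measurableT (@integrable_normal_sqr R)).
rewrite normal_second_moment mulr1; congr (_ + _).
have mg : measurable_fun setT (fun x : R => cos (u * x - a) * gauss_weight x).
  by apply: measurable_funM; [exact: measurable_cosB|exact: measurable_gauss_weight].
rewrite Rintegral_weighted_levy; last exact: measurable_cosB.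
rewrite (Rintegral_levy Fint mg) ?gauss_weight0 ?mulr0//.
transitivity (\int[GF]_x \int[N]_z (cos (u * x - a) * (1 - cos (z * x)) / gauss_weight x)).
  apply: eq_Rintegral => x _.
  have cosi : N.-integrable setT (EFin \o (fun z => cos (x * z))).
    exact: (finite_bounded_integrable N (measurable_cosM x) (fun x => cos_le _)).
  have i1 : N.-integrable setT (EFin \o (fun=> 1 : R)) by exact: finite_measure_integrable_cst.
  transitivity (\int[N]_z (cos (u * x - a) / gauss_weight x * (1 - cos (x * z)))).
    rewrite (RintegralZl _ measurableT (integrableB_EFin i1 cosi)) (RintegralB measurableT i1 cosi).
    by rewrite Rintegral_probability_cst normal_characteristic_function mulrAC.
  by apply: eq_Rintegral => z _; rewrite (mulrC x); ring.
(* The bound 6 (1 + z^2) comes from 1 - cos(zx) <= 2 (1 + z^2) min(x^2, 1) and min(x^2, 1) <= 3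
   w(x). *)
apply: (@Rintegral_swap _ _ RM RM _ GF N (fun p => cos (u * p.1 - a) * (1 - cos (p.2 * p.1)) / gauss_weight p.1)
  (fun=> 6) (fun z => 1 + z ^+ 2)).
- have mcos := continuous_measurable_fun (@continuous_cos R).
  apply: measurable_funM; first apply: measurable_funM.
  + by apply: (measurableT_comp mcos); apply: measurable_funB => //; apply: measurable_funM => //; exact: measurable_fst.
  + apply: measurable_funB => //; apply: (measurableT_comp mcos).
    by apply: measurable_funM; [exact: measurable_snd|exact: measurable_fst].
  + apply: measurableT_comp; first exact: measurable_invr.
    by apply: measurableT_comp; [exact: measurable_gauss_weight|exact: measurable_fst].
- exact: finite_measure_integrable_cst.
- apply: integrableD_EFin; last exact: integrable_normal_sqr.
  exact: finite_measure_integrable_cst.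
- move=> x z /=; have [->|x0] := eqVneq x 0.
    by rewrite !mulr0 cos0 subrr mulr0 mul0r normr0 mulr_ge0// addr_ge0// sqr_ge0.
  have w0 := gauss_weight_gt0 x0.
  rewrite normrM [ `|_^-1| ]gtr0_norm ?invr_gt0// ler_pdivrMr// normrM -[leLHS]mulrC.
  have h : 1 - cos (z * x) <= 6 * (1 + z ^+ 2) * gauss_weight x.
    apply: (le_trans (one_sub_cos_le_min _ _)).
    rewrite (_ : 6 * (1 + z ^+ 2) * gauss_weight x = 2 * (1 + z ^+ 2) * (3 * gauss_weight x)); last by ring.
    by rewrite ler_wpM2l ?min_sqr_le// mulr_ge0// addr_ge0// sqr_ge0.
  rewrite (ger0_norm (one_sub_cos_ge0 _)); apply: le_trans h.
  by rewrite ler_piMr// one_sub_cos_ge0.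
Qed.

(** Continuity at 0 is a separate hypothesis because the limit measure has an atom of mass c/2
    there, which an F-almost everywhere condition does not control. *)
Lemma small_time_weighted (h : R -> R) (K : R) : measurable_fun setT h ->
  (forall x, `|h x| <= K) -> {for 0, continuous h} ->
  {ae F, forall x : R, {for x, continuous h}} ->
  (D n)^-1 * \int[mu n]_x (h x * gauss_weight x) @[n --> \oo] -->
    c / 2 * h 0 + \int[F]_x (h x * gauss_weight x).
Proof.
move=> mh hK h0 hF.
have hGF : {ae GF, forall x : R, {for x, continuous h}}.
  have [A [mA A0 QA]] := hF; exists A; split => //.
  by apply: null_set_integral => //; apply/measurable_EFinP; apply: measurable_funTS; exact: measurable_gauss_weight.
have := levy_continuity nu_cvg mh hK (ae_add_atom0 c2 h0 hGF).
rewrite (Rintegral_add_atom0 _ _ mh hK) Rintegral_weighted_levy//=.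
suff -> : (fun n => \int[nu n]_x h x) =
  (fun n => (D n)^-1 * \int[mu n]_x (h x * gauss_weight x)) by [].
apply/funext => n; rewrite nuE// -RintegralZl//; last first.
  apply: (@finite_bounded_integrable _ _ _ _ _ K).
    by apply: measurable_funM => //; exact: measurable_gauss_weight.
  move=> x; rewrite normrM -[leRHS]mulr1 ler_pM// ger0_norm ?gauss_weight_ge0//.
  by rewrite (le_trans (gauss_weight_le x))// ge_min lexx orbT.
by apply: eq_Rintegral => x _; ring.
Qed.

End SmallTime.
Lemma gauss_weight_sub (R : realType) (x : R) :
  `|x ^+ 2 - 2 * gauss_weight x| <= x ^+ 2 * gauss_weight x.
Proof.
have /andP[] := gauss_weight_bounds x; have := sqr_ge0 x.
rewrite ler_pdivrMr ?ltr_wpDr ?sqr_ge0//.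
move: (x ^+ 2) (gauss_weight x) => y w y0 h1 h2.
by rewrite ger0_norm; lra.
Qed.

Lemma near0_norm_lt (R : realType) (d : R) : 0 < d -> \forall x \near (0 : R), `|x| < d.
Proof.
by move=> d0; apply/nbhs_ballP; exists d => //= y; rewrite -ball_normE /= sub0r normrN.
Qed.

Section SmallTimeConsequences.
Context {R : realType}.
Local Notation RM := (measurableTypeR R).
Variables (b c : R) (F : {measure set RM -> \bar R}).
Hypothesis c0 : 0 <= c.
Hypothesis Fint : (\int[F]_x (Num.min (x ^+ 2) 1)%:E < +oo)%E.
Variables (mu : nat -> probability RM R) (D : nat -> R).
Hypothesis D0 : forall n, 0 < D n.
Hypothesis Dc : D n @[n --> \oo] --> 0.
Hypothesis muE : forall n u a, \int[mu n]_x cos (u * x - a) =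
  expR (- (D n * exponent_re c F u)) * cos (D n * exponent_im b F u - a).

(** f is divided by the weight, and the quotient is extended to 0 so as to be bounded and continuous
    there. *)
Lemma small_time_quadratic (f : R -> R) (K l : R) : measurable_fun setT f ->
  (forall x, `|f x| <= K) ->
  (forall e, 0 < e -> exists2 d, 0 < d &
     forall x, `|x| < d -> `|f x - l * x ^+ 2| <= e * x ^+ 2) ->
  {ae F, forall x : R, {for x, continuous f}} ->
  (D n)^-1 * \int[mu n]_x f x @[n --> \oo] --> c * l + \int[F]_x f x.
Proof.
move=> mf fK fl cf.
have f0 : f 0 = 0.
  have [d d0 /(_ 0)] := fl 1 ltr01; rewrite normr0 => /(_ d0).
  by rewrite expr0n/= !mulr0 subr0 normr_le0 => /eqP.
(* The weight is equivalent to x^2/2, so 2 l is the limit of the quotient at 0. *)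
pose h (x : R) : R := if x == 0 then 2 * l else f x / gauss_weight x.
have hw (x : R) : h x * gauss_weight x = f x.
  rewrite /h; have [->|x0] := eqVneq x 0; first by rewrite gauss_weight0 mulr0 f0.
  by rewrite divfK// gt_eqF// gauss_weight_gt0.
have w_ge (x : R) : x ^+ 2 <= (2 + x ^+ 2) * gauss_weight x.
  have /andP[h1 _] := gauss_weight_bounds x; have x2 := sqr_ge0 x.
  by rewrite mulrC -ler_pdivrMr// ltr_wpDr.
have w_le (x : R) : gauss_weight x <= x ^+ 2 / 2 by case/andP: (gauss_weight_bounds x).
have mh : measurable_fun setT h.
  apply: measurable_fun_ifT => //.
  - exact: measurable_fun_eqr.
  - apply: measurable_funM => //; apply: measurableT_comp; first exact: measurable_invr.
    exact: measurable_gauss_weight.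
have K0 : 0 <= K by apply: le_trans (fK 0).
have [K' hK'] : exists K', forall x, `|h x| <= K'.
  have [d d0 hd] := fl 1 ltr01.
  (* One term for x = 0, one for 0 < |x| < d, where |f| <= (1 + |l|) x^2, and one for |x| >= d,
     where the weight is bounded below. *)
  exists (`|2 * l| + (1 + `|l|) * (2 + d ^+ 2) + K * ((2 + d ^+ 2) / d ^+ 2)) => x.
  have d2 : 0 < d ^+ 2 by rewrite exprn_gt0.
  have p1 : 0 <= (1 + `|l|) * (2 + d ^+ 2) by rewrite mulr_ge0 ?addr_ge0// ltW.
  have p2 : 0 <= K * ((2 + d ^+ 2) / d ^+ 2) by rewrite mulr_ge0// divr_ge0// ?addr_ge0// ltW.
  rewrite /h; case: eqVneq => [_|x0]; first by rewrite -addrA lerDl addr_ge0.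
  have w0 := gauss_weight_gt0 x0.
  rewrite normrM [ `|_^-1| ]gtr0_norm ?invr_gt0// ler_pdivrMr//.
  have n2l : 0 <= `|2 * l| * gauss_weight x by rewrite mulr_ge0// ltW.
  have [xd|xd] := ltP `|x| d.
    have : `|f x| <= (1 + `|l|) * x ^+ 2.
      have := hd x xd; rewrite mul1r => h1.
      rewrite -(subrK (l * x ^+ 2) (f x)) (le_trans (ler_normD _ _))// mulrDl mul1r lerD//.
      by rewrite normrM [ `|x ^+ 2| ]ger0_norm// sqr_ge0.
    have x2d : x ^+ 2 <= d ^+ 2 by rewrite -real_normK ?num_real// lerXn2r ?nnegrE// ltW.
    have q : (1 + `|l|) * x ^+ 2 <= (1 + `|l|) * (2 + d ^+ 2) * gauss_weight x.
      rewrite -mulrA ler_wpM2l ?addr_ge0// (le_trans (w_ge x))// ler_wpM2r ?lerD2l// ltW//.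
    have := mulr_ge0 p2 (ltW w0); lra.
  have x2d : d ^+ 2 <= x ^+ 2 by rewrite -[x ^+ 2]real_normK ?num_real// lerXn2r ?nnegrE// ltW.
  have q : 1 <= (2 + d ^+ 2) / d ^+ 2 * gauss_weight x.
    rewrite mulrAC ler_pdivlMr// mul1r.
    have /andP[h1 _] := gauss_weight_bounds x.
    have x2 : 0 < 2 + x ^+ 2 by rewrite ltr_wpDr// sqr_ge0.
    have : d ^+ 2 / (2 + d ^+ 2) <= x ^+ 2 / (2 + x ^+ 2).
      rewrite ler_pdivrMr ?ltr_wpDr ?(ltW d2)// mulrAC ler_pdivlMr//; lra.
    move=> /le_trans /(_ h1); rewrite ler_pdivrMr ?ltr_wpDr ?(ltW d2)//; lra.
  have := ler_wpM2l K0 q; rewrite mulr1 mulrA => q'.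
  have := mulr_ge0 p1 (ltW w0); have := fK x; lra.
have h0 : {for 0, continuous h}.
  apply/cvgrPdist_le => e e0.
  (* For |x| < 1 one has x^2 <= 3 w(x), so e/6 contributes e/2; the other half pays for replacing l
     x^2 by 2 l w(x). *)
  have [d d0 hd] := fl (e / 6) (divr_gt0 e0 (ltr0n R 6)).
  pose d' := Num.min d (Num.min 1 (e / (2 * (`|l| + 1)))).
  have l1 : 0 < `|l| + 1 by rewrite ltr_wpDl.
  have d'0 : 0 < d' by rewrite !lt_min d0 ltr01 divr_gt0// mulr_gt0.
  suff hb (x : R) : `|x| < d' -> `|h 0 - h x| <= e.
    by near=> x; apply: hb; near: x; exact: near0_norm_lt.
  rewrite !lt_min => /and3P[xd x1 xe].
  rewrite {1}/h eqxx /h; case: eqVneq => [_|x0]; first by rewrite subrr normr0 ltW.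
  have w0 := gauss_weight_gt0 x0.
  rewrite distrC -(mulfK (lt0r_neq0 w0) (2 * l)) -mulrBl.
  rewrite normrM [ `|_^-1| ]gtr0_norm ?invr_gt0// ler_pdivrMr//.
  have -> : f x - 2 * l * gauss_weight x = (f x - l * x ^+ 2) + l * (x ^+ 2 - 2 * gauss_weight x) by ring.
  apply: (le_trans (ler_normD _ _)).
  have hx := hd x xd.
  have n1 : `|x| ^+ 2 <= `|x| by rewrite expr2 ler_piMl// ltW.
  have x2 : x ^+ 2 = `|x| ^+ 2 by rewrite real_normK ?num_real.
  have wx := w_ge x.
  have xp := sqr_ge0 x.
  have r1 : `|x ^+ 2 - 2 * gauss_weight x| <= x ^+ 2 * gauss_weight x.
    exact: gauss_weight_sub.
  have r2 : `|l| * x ^+ 2 <= e / 2.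
    rewrite x2; apply: (@le_trans _ _ ((`|l| + 1) * `|x|)); first by rewrite ler_pM// lerDl.
    move: xe; rewrite ltr_pdivlMr ?mulr_gt0// => /ltW; lra.
  have r3 : `|l * (x ^+ 2 - 2 * gauss_weight x)| <= e / 2 * gauss_weight x.
    rewrite normrM (le_trans (ler_wpM2l (normr_ge0 l) r1))// mulrA ler_wpM2r// ltW//.
  have r4 : x ^+ 2 <= 3 * gauss_weight x.
    apply: (le_trans wx); rewrite ler_wpM2r ?(ltW w0)//.
    by rewrite x2; move: x1 n1; lra.
  have := ler_wpM2l (ltW (divr_gt0 e0 (ltr0n R 6))) r4; lra.
have hF : {ae F, forall x : R, {for x, continuous h}}.
  apply: ae_imply cf => x cx; have [->//|x0] := eqVneq x 0.
  have cq : {for x, continuous (fun y => f y / gauss_weight y)}.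
    apply: cvgM => //; apply: cvgV; last exact: continuous_gauss_weight.
    by rewrite gt_eqF// gauss_weight_gt0.
  have hx : h x = f x / gauss_weight x by rewrite /h (negbTE x0).
  rewrite /prop_for /continuous_at hx; apply: cvg_trans cq.
  apply: near_eq_cvg; near=> y; rewrite /h ifF//; apply/negbTE.
  by near: y; apply: (@cvgr_neq0 _ _ _ _ _ id x) => //; exact: cvg_id.
have := small_time_weighted c0 Fint D0 Dc muE mh hK' h0 hF.
under eq_fun do under eq_Rintegral do rewrite hw.
under eq_Rintegral do rewrite hw.
rewrite {1}/h eqxx (_ : c / 2 * (2 * l) = c * l)//; by field.
Unshelve. all: by end_near. Qed.

(** A continuous localisation at 0: it is 1 for |x| <= 1/(m+1) and 0 for |x| >= 2/(m+1). *)
Definition near_cutoff (m : nat) (x : R) : R := cutoff 1 (m.+1%:R * x).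

Lemma near_cutoff_bounds m x : 0 <= near_cutoff m x <= 1.
Proof. by rewrite cutoff_ge0 cutoff_le1. Qed.

Lemma near_cutoff_eq1 m x : `|x| <= m.+1%:R^-1 -> near_cutoff m x = 1.
Proof.
move=> xm; apply: cutoff_near; rewrite normrM ger0_norm// mulrC.
by rewrite -ler_pdivlMr// mul1r.
Qed.

Lemma near_cutoff_eq0 m x : 2 / m.+1%:R <= `|x| -> near_cutoff m x = 0.
Proof.
move=> xm; apply: cutoff_far; rewrite normrM ger0_norm// mulrC.
by rewrite -ler_pdivrMr.
Qed.

Lemma continuous_near_cutoff m : continuous (near_cutoff m).
Proof.
apply: (@lipschitz_continuous _ _ m.+1%:R) => x y.
by rewrite (le_trans (cutoff_lipschitz _ _ _))// mul1r -mulrBr normrM ger0_norm.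
Qed.

Lemma near_cutoff_cvg0 (k : R -> R) :
  measurable_fun setT k -> k 0 = 0 -> F.-integrable setT (EFin \o k) ->
  \int[F]_x (k x * near_cutoff m x) @[m --> \oo] --> 0.
Proof.
move=> mk k0 ki; have -> : (0 : R) = \int[F]_x (fun _ : R => 0) x.
  by rewrite /Rintegral integral0.
have ki' : F.-integrable setT (EFin \o (fun x => `|k x|)) by exact: integrable_norm.
apply: (@Rintegral_dominated_cvg _ _ _ F (fun m x => k x * near_cutoff m x) (fun=> 0) (fun x => `|k x|)) => //.
- by move=> m; apply: measurable_funM => //; exact: continuous_measurable_fun (continuous_near_cutoff (m := m)).
- move=> x; have [->|x0] := eqVneq x 0; first by rewrite k0; under eq_fun do rewrite mul0r; exact: cvg_cst.
  apply: cvg_near_cst; exists (Num.truncn (2 / `|x|)).+1 => // m /= Mm.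
  rewrite near_cutoff_eq0 ?mulr0// ler_pdivrMr// mulrC -ler_pdivrMr ?normr_gt0//.
  by rewrite ltW// (lt_le_trans (truncnS_gt _))// ler_nat (leq_trans Mm).
- move=> m x; have /andP[h1 h2] := near_cutoff_bounds m x.
  by rewrite normrM (ger0_norm h1) ler_piMr.
Qed.

Lemma vanish_quadratic (f : R -> R) (K : R) (d : R) : 0 < d ->
  measurable_fun setT f -> (forall x, `|f x| <= K) ->
  (forall x, `|x| < d -> f x = 0) ->
  {ae F, forall x : R, {for x, continuous f}} ->
  F.-integrable setT (EFin \o f) /\
  (D n)^-1 * \int[mu n]_x f x @[n --> \oo] --> \int[F]_x f x.
Proof.
move=> d0 mf fK f0 cf; split.
  have K0 : 0 <= K by apply: le_trans (fK 0).
  apply: (@integrable_le_min_sqr _ F Fint _ (K * (1 + (d ^+ 2)^-1))) => // x.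
  have d2 : 0 < d ^+ 2 by rewrite exprn_gt0.
  have [xd|xd] := ltP `|x| d.
    rewrite f0// normr0 mulr_ge0 ?mulr_ge0 ?addr_ge0 ?invr_ge0 ?(ltW d2)//.
    by rewrite le_min sqr_ge0 ler01.
  have x2d : d ^+ 2 <= x ^+ 2 by rewrite -[x ^+ 2]real_normK ?num_real// lerXn2r ?nnegrE// ltW.
  apply: (le_trans (fK x)); rewrite -[leLHS]mulr1 -mulrA ler_wpM2l//.
  have i0 : 0 <= (d ^+ 2)^-1 by rewrite invr_ge0 ltW.
  case: (leP (x ^+ 2) 1) => x1; last by lra.
  rewrite -[leLHS](mulVf (lt0r_neq0 d2)) mulrDl mul1r.
  by rewrite -[leLHS]add0r lerD ?sqr_ge0// ler_wpM2l.
have := @small_time_quadratic f K 0 mf fK _ cf; rewrite mulr0 add0r; apply.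
move=> e e0; exists d => // x xd; rewrite f0// mul0r subrr normr0.
by rewrite mulr_ge0 ?sqr_ge0// ltW.
Qed.

(** Transfer from a reference function k, whose limit exceeds F(k) by j. The part of g away from 0
    converges to its F-integral; the part near 0 is at most A times that of k, whose limit is j plus
    an integral that vanishes as the cutoff shrinks. With j = 0 a bound O(k) is enough; otherwise A
    has to be small. *)
Lemma small_time_compare (k g : R -> R) (Kk Kg A j d : R) :
  continuous k -> k 0 = 0 -> (forall x, 0 <= k x <= Kk) ->
  F.-integrable setT (EFin \o k) ->
  (D n)^-1 * \int[mu n]_x k x @[n --> \oo] --> \int[F]_x k x + j ->
  measurable_fun setT g -> (forall x, `|g x| <= Kg) ->
  {ae F, forall x : R, {for x, continuous g}} ->
  0 <= A -> 0 < d -> (forall x, `|x| < d -> `|g x| <= A * k x) ->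
  F.-integrable setT (EFin \o g) /\
  (forall e, 0 < e -> \forall n \near \oo,
    `|(D n)^-1 * \int[mu n]_x g x - \int[F]_x g x| <= A * j + e).
Proof.
move=> ck k0 kK ki kj mg gK cg A0 d0 gk.
have mk := continuous_measurable_fun ck.
have k_ge0 x : 0 <= k x by case/andP: (kK x).
have mch m := continuous_measurable_fun (continuous_near_cutoff (m := m)).
pose gin m x := g x * near_cutoff m x; pose gout m x := g x * (1 - near_cutoff m x).
pose kin m x := k x * near_cutoff m x; pose kout m x := k x * (1 - near_cutoff m x).
have cut01 m x : 0 <= 1 - near_cutoff m x <= 1.
  by have := near_cutoff_bounds m x; lra.
have mgin m : measurable_fun setT (gin m) by apply: measurable_funM => //; exact: mch.
have mkin m : measurable_fun setT (kin m) by apply: measurable_funM => //; exact: mch.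
have mgout m : measurable_fun setT (gout m).
  by apply: measurable_funM => //; apply: measurable_funB => //; exact: mch.
have mkout m : measurable_fun setT (kout m).
  by apply: measurable_funM => //; apply: measurable_funB => //; exact: mch.
have md m : 0 < m.+1%:R^-1 :> R by rewrite invr_gt0.
have gout_cvg m := @vanish_quadratic (gout m) Kg _ (md m) (mgout m).
have kout_cvg m := @vanish_quadratic (kout m) Kk _ (md m) (mkout m).
have cc m (x : R) : {for x, continuous (fun y => 1 - near_cutoff m y)}.
  by apply: cvgB; [exact: cvg_cst|exact: continuous_near_cutoff].
have {}gout_cvg m : F.-integrable setT (EFin \o gout m) /\
  (D n)^-1 * \int[mu n]_x gout m x @[n --> \oo] --> \int[F]_x gout m x.
  apply: gout_cvg.
  - move=> x; rewrite normrM -[leRHS]mulr1 ler_pM// ger0_norm; by case/andP: (cut01 m x).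
  - by move=> x xm; rewrite /gout near_cutoff_eq1 ?subrr ?mulr0// ltW.
  - by apply: ae_imply cg => x cx; apply: cvgM; [exact: cx|exact: cc].
have {}kout_cvg m : F.-integrable setT (EFin \o kout m) /\
  (D n)^-1 * \int[mu n]_x kout m x @[n --> \oo] --> \int[F]_x kout m x.
  apply: kout_cvg.
  - move=> x; rewrite normrM -[leRHS]mulr1 ler_pM//; first by rewrite ger0_norm//; case/andP: (kK x).
    by rewrite ger0_norm; case/andP: (cut01 m x).
  - by move=> x xm; rewrite /kout near_cutoff_eq1 ?subrr ?mulr0// ltW.
  - by apply/aeW => x; apply: cvgM; [exact: ck|exact: cc].
have [M hM] : exists M : nat, forall m, (M <= m)%N -> 2 / m.+1%:R < d.
  exists (Num.truncn (2 / d)).+1 => m Mm.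
  rewrite ltr_pdivrMr// mulrC -ltr_pdivrMr// (lt_le_trans (truncnS_gt _))// ler_nat.
  by rewrite (leq_trans Mm).
have gkin m x : (M <= m)%N -> `|gin m x| <= A * kin m x.
  move=> Mm; have /andP[c1 _] := near_cutoff_bounds m x.
  rewrite normrM (ger0_norm c1) /kin mulrA; have [xd|xd] := ltP `|x| d.
    by rewrite ler_wpM2r// gk.
  by rewrite near_cutoff_eq0 ?mulr0// (le_trans (ltW (hM m Mm))).
have kin_le m x : `|kin m x| <= k x.
  have /andP[c1 c2] := near_cutoff_bounds m x.
  by rewrite normrM (ger0_norm c1) ger0_norm// ler_piMr.
have kini m : F.-integrable setT (EFin \o kin m).
  by apply: (dominated_integrable _ ki (kin_le m)); exact: mkin.
have gini m : (M <= m)%N -> F.-integrable setT (EFin \o gin m).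
  move=> Mm; apply: (dominated_integrable _ (integrableZl_EFin A (kini m)) (fun x => gkin m x Mm)).
  exact: mgin.
have gE m x : g x = gin m x + gout m x by rewrite /gin /gout; ring.
have kE m x : k x = kin m x + kout m x by rewrite /kin /kout; ring.
have gi : F.-integrable setT (EFin \o g).
  have := integrableD_EFin (gini M (leqnn M)) (gout_cvg M).1.
  by rewrite (_ : (fun x => _) = g)//; apply/funext => x; rewrite -gE.
split => // e e0.
have kin0 : \int[F]_x kin m x @[m --> \oo] --> 0 by exact: near_cutoff_cvg0.
have eA : 0 < e / (4 * (A + 1)) by rewrite divr_gt0// mulr_gt0// ltr_wpDl.
have [m Mm hm] : exists2 m, (M <= m)%N & \int[F]_x kin m x <= e / (4 * (A + 1)).
  have /cvgrPdist_le /(_ _ eA) [m0 _ hm0] := kin0.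
  exists (maxn M m0); first exact: leq_maxl.
  have := hm0 (maxn M m0) (leq_maxr _ _); rewrite sub0r normrN.
  exact: le_trans (ler_norm _).
have kin_ge0 : 0 <= \int[F]_x kin m x.
  by apply: Rintegral_ge0 => x _; rewrite mulr_ge0//; case/andP: (near_cutoff_bounds m x).
have hA : A * \int[F]_x kin m x <= e / 4.
  have := ler_wpM2l A0 hm; have : (A + 1) * (e / (4 * (A + 1))) = e / 4.
    by field; rewrite gt_eqF// ltr_wpDl.
  by move: eA; set q := e / (4 * _); lra.
have mui n (f : R -> R) (K : R) : measurable_fun setT f -> (forall x, `|f x| <= K) ->
  (mu n).-integrable setT (EFin \o f).
  by move=> mf fK; exact: (finite_bounded_integrable (mu n) mf fK).
have kKn x : `|k x| <= Kk by rewrite ger0_norm//; case/andP: (kK x).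
have kin_cvg : (D n)^-1 * \int[mu n]_x kin m x @[n --> \oo] --> \int[F]_x kin m x + j.
  have -> : \int[F]_x kin m x + j = \int[F]_x k x + j - \int[F]_x kout m x.
    have -> : \int[F]_x k x = \int[F]_x kin m x + \int[F]_x kout m x.
      rewrite -(RintegralD measurableT (kini m) (kout_cvg m).1).
      by apply: eq_Rintegral => x _; rewrite -kE.
    ring.
  have -> : (fun n => (D n)^-1 * \int[mu n]_x kin m x) =
      (fun n => (D n)^-1 * \int[mu n]_x k x - (D n)^-1 * \int[mu n]_x kout m x).
    apply/funext => n; rewrite -mulrBr; congr (_ * _).
    have i1 : (mu n).-integrable setT (EFin \o k) by exact: (mui n k Kk).
    have i2 : (mu n).-integrable setT (EFin \o kout m).
      apply: (mui n (kout m) Kk) => // x.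
      rewrite normrM -[leRHS]mulr1 ler_pM// ger0_norm; by case/andP: (cut01 m x).
    by rewrite -(RintegralB measurableT i1 i2); apply: eq_Rintegral => x _; rewrite (kE m x) addrK.
  exact: cvgB (kout_cvg m).2.
have ke : 0 < e / (4 * (A + 1)) by [].
move/cvgrPdist_le : kin_cvg => /(_ _ ke); have /cvgrPdist_le /(_ (e / 4)) := (gout_cvg m).2.
rewrite divr_gt0// => /(_ isT); apply: filterS2 => n hg hk.
have iin : (mu n).-integrable setT (EFin \o gin m).
  apply: (mui n (gin m) Kg) => // x.
  have /andP[c1 c2] := near_cutoff_bounds m x.
  by rewrite normrM -[leRHS]mulr1 ler_pM// ger0_norm.
have iout : (mu n).-integrable setT (EFin \o gout m).
  apply: (mui n (gout m) Kg) => // x.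
  rewrite normrM -[leRHS]mulr1 ler_pM// ger0_norm; by case/andP: (cut01 m x).
have kini' : (mu n).-integrable setT (EFin \o kin m).
  apply: (mui n (kin m) Kk) => // x; exact: (le_trans (kin_le m x)) (le_trans (ler_norm _) (kKn x)).
have E1 : \int[mu n]_x g x = \int[mu n]_x gin m x + \int[mu n]_x gout m x.
  by rewrite -(RintegralD measurableT iin iout); apply: eq_Rintegral => x _; rewrite -gE.
have E2 : \int[F]_x g x = \int[F]_x gin m x + \int[F]_x gout m x.
  by rewrite -(RintegralD measurableT (gini m Mm) (gout_cvg m).1); apply: eq_Rintegral => x _; rewrite -gE.
have B1 : `|\int[mu n]_x gin m x| <= A * \int[mu n]_x kin m x.
  rewrite -(RintegralZl _ measurableT kini'); apply: (Rintegral_norm_le _ (integrableZl_EFin A kini') (fun x => gkin m x Mm)); exact: mgin.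
have B2 : `|\int[F]_x gin m x| <= A * \int[F]_x kin m x.
  rewrite -(RintegralZl _ measurableT (kini m)); apply: (Rintegral_norm_le _ (integrableZl_EFin A (kini m)) (fun x => gkin m x Mm)); exact: mgin.
have B3 : `|(D n)^-1 * \int[mu n]_x gin m x| <= A * ((D n)^-1 * \int[mu n]_x kin m x).
  by rewrite normrM gtr0_norm ?invr_gt0// mulrCA ler_wpM2l// invr_ge0 ltW.
rewrite E1 E2 mulrDr.
move: hg hk B3; set p := _^-1 * _; set q := _^-1 * _; set r := _^-1 * _ => hg hk B3.
have fin (Ik w I J p' q' r' : R) : A * Ik <= e / 4 -> (A + 1) * w = e / 4 -> 0 < w ->
    `|Ik + j - q'| <= w -> `|r'| <= A * q' -> `|J - p'| <= e / 4 -> `|I| <= A * Ik ->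
    `|r' + p' - (I + J)| <= A * j + e.
  clear -A0; move=> t1 t2 t3 t4 t5 t6 t7.
  have t8 : q' <= Ik + j + w by move: t4; rewrite ler_norml => /andP[]; lra.
  have t9 := ler_wpM2l A0 t8.
  rewrite (_ : _ - _ = r' - (J - p') - I); last by ring.
  apply: (le_trans (ler_normB _ _)); apply: (le_trans (lerD (ler_normB _ _) (lexx _))).
  lra.
apply: (fin _ _ _ _ _ _ _ hA _ eA hk B3 hg B2).
by field; rewrite gt_eqF// ltr_wpDl.
Qed.

(** What is removed from k by a cutoff near 0 has to be small uniformly in n; the remainder vanishes
    near 0, so that its limit is known. *)
Lemma small_time_tail (k : R -> R) (K : R) :
  continuous k -> k 0 = 0 -> (forall x, 0 <= k x <= K) ->
  F.-integrable setT (EFin \o k) ->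
  (forall e : R, 0 < e -> exists M, forall m n, (M <= m)%N ->
     (D n)^-1 * \int[mu n]_x (k x * near_cutoff m x) <= e) ->
  (D n)^-1 * \int[mu n]_x k x @[n --> \oo] --> \int[F]_x k x.
Proof.
move=> ck k0 kK ki tl; have mk := continuous_measurable_fun ck.
have k_ge0 x : 0 <= k x by case/andP: (kK x).
have kKn x : `|k x| <= K by rewrite ger0_norm//; case/andP: (kK x).
pose kin m x := k x * near_cutoff m x; pose kout m x := k x * (1 - near_cutoff m x).
have mch m := continuous_measurable_fun (continuous_near_cutoff (m := m)).
have mkin m : measurable_fun setT (kin m) by apply: measurable_funM => //; exact: mch.
have mkout m : measurable_fun setT (kout m).
  by apply: measurable_funM => //; apply: measurable_funB => //; exact: mch.
have kin_le m x : `|kin m x| <= k x.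
  have /andP[c1 c2] := near_cutoff_bounds m x.
  by rewrite normrM (ger0_norm c1) ger0_norm// ler_piMr.
have kout_le m x : `|kout m x| <= k x.
  have /andP[c1 c2] := near_cutoff_bounds m x.
  by rewrite normrM (ger0_norm (k_ge0 x)) ger0_norm ?subr_ge0// ler_piMr// gerBl.
have md m : 0 < m.+1%:R^-1 :> R by rewrite invr_gt0.
have [] : True /\ forall m, (D n)^-1 * \int[mu n]_x kout m x @[n --> \oo] --> \int[F]_x kout m x.
  split=> // m.
  apply: (vanish_quadratic (md m) (mkout m) _ _ _).2 => [x|x xm|].
  - exact: le_trans (kout_le m x) (le_trans (ler_norm _) (kKn x)).
  - by rewrite /kout near_cutoff_eq1 ?subrr ?mulr0// ltW.
  - apply/aeW => x; apply: cvgM; first exact: ck.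
    by apply: cvgB; [exact: cvg_cst|exact: continuous_near_cutoff].
move=> _ kout_cvg.
have kE m x : k x = kin m x + kout m x by rewrite /kin /kout; ring.
have kini m : F.-integrable setT (EFin \o kin m).
  by apply: (dominated_integrable _ ki (kin_le m)); exact: mkin.
have kouti m : F.-integrable setT (EFin \o kout m).
  by apply: (dominated_integrable _ ki (kout_le m)); exact: mkout.
apply/cvgrPdist_le => e e0; have e3 : 0 < e / 3 by rewrite divr_gt0.
have [M hM] := tl _ e3.
have /cvgrPdist_le /(_ _ e3) [m0 _ hm0] := near_cutoff_cvg0 mk k0 ki.
pose m := maxn M m0.
have B1 : `|\int[F]_x kin m x| <= e / 3.
  by have := hm0 m (leq_maxr _ _); rewrite sub0r normrN.
have /cvgrPdist_le /(_ _ e3) := kout_cvg m; apply: filterS => n hk.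
have E2 : \int[F]_x k x = \int[F]_x kin m x + \int[F]_x kout m x.
  by rewrite -(RintegralD measurableT (kini m) (kouti m)); apply: eq_Rintegral => x _; rewrite -kE.
have i1 : (mu n).-integrable setT (EFin \o kin m).
  apply: (finite_bounded_integrable (mu n) (K := K)) => [|x]; first exact: mkin.
  exact: le_trans (kin_le m x) (le_trans (ler_norm _) (kKn x)).
have i2 : (mu n).-integrable setT (EFin \o kout m).
  apply: (finite_bounded_integrable (mu n) (K := K)) => [|x]; first exact: mkout.
  exact: le_trans (kout_le m x) (le_trans (ler_norm _) (kKn x)).
have E1 : \int[mu n]_x k x = \int[mu n]_x kin m x + \int[mu n]_x kout m x.
  by rewrite -(RintegralD measurableT i1 i2); apply: eq_Rintegral => x _; rewrite -kE.
have B2 : `|(D n)^-1 * \int[mu n]_x kin m x| <= e / 3.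
  rewrite ger0_norm; first by apply: hM; exact: leq_maxl.
  rewrite mulr_ge0 ?invr_ge0 ?(ltW (D0 n))//; apply: Rintegral_ge0 => x _.
  by rewrite mulr_ge0//; case/andP: (near_cutoff_bounds m x).
rewrite E1 E2 mulrDr; move: B1 B2 hk.
move: (\int[F]_x kin m x) (\int[F]_x kout m x) (_^-1 * _) (_^-1 * _) => p q u v B1 B2 hk.
rewrite (_ : _ - _ = p - v + (q - u)); last by ring.
by rewrite (le_trans (ler_normD _ _))// (le_trans (lerD (ler_normB _ _) (lexx _)))//; lra.
Qed.

End SmallTimeConsequences.

(** * Dyadic sums comparable with powers *)

Section DyadicSums.
Context {R : realType}.

Lemma powR_ge1 (y s : R) : 1 <= y -> 0 <= s -> 1 <= y `^ s.
Proof.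
move=> y1 s0; have := @ge0_ler_powR R s s0 1 y; rewrite powR1 !nnegrE.
by apply => //; exact: le_trans y1.
Qed.

Lemma powR_gt1 (y s : R) : 1 < y -> 0 < s -> 1 < y `^ s.
Proof.
move=> y1 s0; have := @gt0_ltr_powR R s s0 1 y; rewrite powR1 !nnegrE.
by apply => //; exact: le_trans (ltW y1).
Qed.

Lemma powR_le1 (y s : R) : 0 <= y <= 1 -> 0 <= s -> y `^ s <= 1.
Proof.
move=> /andP[y0 y1] s0; have := @ge0_ler_powR R s s0 y 1; rewrite powR1 !nnegrE.
by apply.
Qed.

Lemma ge0_tail_le (t : nat -> R) (B : R) : (forall j, 0 <= t j) ->
  (forall n, \sum_(0 <= j < n) t j <= B) ->
  forall e : R, 0 < e -> exists N, forall M, \sum_(N <= j < M) t j <= e.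
Proof.
move=> t0 tB e e0.
have nd : nondecreasing_seq (series t).
  by apply/nondecreasing_seqP => n; rewrite /series/= big_nat_recr//= lerDl.
have ub : has_ubound (range (series t)) by exists B => _ [n _ <-]; exact: tB.
have /cvg_ex [l] : cvgn (series t) by exact: nondecreasing_is_cvgn.
move=> /cvgrPdist_le /(_ _ (divr_gt0 e0 (ltr0n R 2))) [N _ hN].
exists N => M; have [MN|NM] := leqP M N; first by rewrite big_geq// ltW.
have h1 := hN N (leqnn N); have h2 := hN M (ltnW NM).
have : series t M = series t N + \sum_(N <= j < M) t j.
  by rewrite /series/= (@big_cat_nat _ _ _ N)//= ltnW.
move: h1 h2; rewrite !ler_norml => /andP[a1 a2] /andP[a3 a4].
by move: a1 a2 a3 a4; move: (series t M) (series t N) (\sum_(N <= j < M) t j) (l : R) => u v z k; lra.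
Qed.

Lemma geometric_sum_le (q : R) n : 0 <= q < 1 -> \sum_(0 <= j < n) q ^+ j <= (1 - q)^-1.
Proof.
move=> /andP[q0 q1]; have q1' : 0 < 1 - q by rewrite subr_gt0.
rewrite big_mkord -[leRHS]mul1r ler_pdivlMr// mulrC -opprB mulNr -subrX1 opprB.
by rewrite lerBlDr lerDl exprn_ge0.
Qed.

(* The invariant [C y^s - D y^p] is reproduced by [S_(n+1)(y) = y^p + 2^-s S_n(2y)]. *)
Lemma dyadic_sum_le (s : R) (p : nat) : 0 < s < p%:R ->
  exists C : R, 0 <= C /\ forall n y, 0 <= y ->
    \sum_(0 <= j < n) (2 `^ (- s)) ^+ j * Num.min 1 ((2 ^+ j * y) ^+ p) <=
      C * Num.min 1 (y `^ s).
Proof.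
move=> /andP[s0 sp]; set q := 2 `^ (- s).
have q0 : 0 < q by exact: powR_gt0.
have qs : q * 2 `^ s = 1 by rewrite /q powRN mulVf// gt_eqF// powR_gt0.
have ts1 : 1 < 2 `^ s by apply: powR_gt1; rewrite ?ltr1n.
have q1 : q < 1 by move: qs q0 ts1; nra.
have pq : 1 < 2 ^+ p * q.
  rewrite -powR_mulrn// /q -powRD ?pnatr_eq0 ?implybT//.
  by apply: powR_gt1; rewrite ?ltr1n ?subr_gt0.
have p_gt0 : (0 < p)%N by rewrite -(ltr0n R) (lt_trans s0).
(* B bounds the whole geometric sum. D solves D 2^p q = D + 1, so that the new term y^p is absorbed
   by the recursion. *)
pose B := (1 - q)^-1; pose D := (2 ^+ p * q - 1)^-1.
have B0 : 0 < B by rewrite invr_gt0 subr_gt0.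
have D0 : 0 < D by rewrite invr_gt0 subr_gt0.
have DE : D * (2 ^+ p * q) = D + 1.
  by have : D * (2 ^+ p * q - 1) = 1; [rewrite mulVf// gt_eqF// subr_gt0|lra].
(* For y >= 1/2 the point 2y leaves [0, 1] and the recursion stops. There y^s >= 2^-s, so C y^s >= B
   + D and the uniform bound B suffices. *)
pose C := 2 `^ s * (B + D).
pose S n y := \sum_(0 <= j < n) q ^+ j * Num.min 1 ((2 ^+ j * y) ^+ p).
have SB n y : S n y <= B.
  apply: le_trans (geometric_sum_le n _); last by rewrite q1 ltW.
  by apply: ler_sum => j _; rewrite ler_piMr ?exprn_ge0 ?(ltW q0)// ge_min lexx.
have CBD : B + D <= C by rewrite /C ler_peMl ?(ltW ts1)// addr_ge0// ltW.
have yps y : 0 <= y <= 1 -> y ^+ p <= y `^ s.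
  move=> /andP[]; rewrite le_eqVlt => /predU1P[<- _|y0 y1].
    by rewrite expr0n (gtn_eqF p_gt0) powR_ge0.
  by rewrite -powR_mulrn ?(ltW y0)// ger_powR ?y0// ltW.
have key n : forall y, 0 <= y <= 1 -> S n y <= C * y `^ s - D * y ^+ p.
  elim: n => [|n IH] y /andP[y0 y1].
    rewrite /S big_geq// subr_ge0.
    have h1 := yps y; rewrite y0 y1 in h1; have {h1} := h1 isT.
    have : D <= C by lra.
    by have := exprn_ge0 p y0; have := powR_ge0 y s; nra.
  have [yh|yh] := leP 2^-1 y.
    have h : 2 `^ s * y `^ s >= 1.
      rewrite -powRM// powR_ge1 ?(ltW s0)//.
      by move: yh; lra.
    have h2 : y ^+ p <= 1 by rewrite exprn_ile1.
    have h3 := SB n.+1 y.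
    have h4 : C * y `^ s >= B + D.
      rewrite /C mulrAC -[leLHS]mul1r ler_wpM2r// addr_ge0// ltW//.
    have := ler_wpM2l (ltW D0) h2; lra.
  have y2 : 0 <= 2 * y <= 1 by rewrite mulr_ge0//=; move: yh; lra.
  have SE : S n.+1 y <= y ^+ p + q * S n (2 * y).
    rewrite /S big_nat_recl// expr0 !mul1r lerD//; first by rewrite ge_min lexx orbT.
    rewrite mulr_sumr; apply: ler_sum => j _.
    by rewrite mulrA -exprS mulrA -exprSr.
  apply: (le_trans SE); have := ler_wpM2l (ltW q0) (IH _ y2).
  rewrite powRM// exprMn => h.
  have h2 : q * (C * (2 `^ s * y `^ s)) = C * y `^ s.
    by rewrite mulrCA (mulrA q) qs mul1r.
  have h3 : q * (D * (2 ^+ p * y ^+ p)) = (D + 1) * y ^+ p by rewrite -DE; ring.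
  by move: h; rewrite mulrBr h2 h3; lra.
have C0 : 0 <= C by lra.
exists C; split=> // n y y0; rewrite -/(S n y).
have [y1|y1] := leP y 1.
  have ys1 : y `^ s <= 1 by rewrite powR_le1 ?y0// ltW.
  rewrite min_r//; have := key n y; rewrite y0 y1 => /(_ isT).
  by have := mulr_ge0 (ltW D0) (exprn_ge0 p y0); lra.
rewrite min_l; last by rewrite powR_ge1// ltW.
by have := SB n y; lra.
Qed.

Lemma dyadic_bracket (N : nat) (x : R) : 0 < x -> x <= (2 ^+ N)^-1 ->
  exists2 j, (N <= j)%N & 2^-1 <= 2 ^+ j * x <= 1.
Proof.
move=> x0 xN.
have ex : exists j, 1 < 2 ^+ j.+1 * x.
  exists (Num.truncn x^-1).+1.
  rewrite -ltr_pdivrMr// div1r (lt_le_trans (truncnS_gt _))//.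
  rewrite -natrX ler_nat.
  exact: (leq_trans (leqnSn _) (ltnW (@ltn_expl 2 _ isT))).
case: (ex_minnP ex) => j hj jmin.
have jN : (N <= j)%N.
  rewrite leqNgt; apply/negP => jN; move: hj; apply/negP; rewrite -leNgt.
  rewrite -ler_pdivlMr// div1r; apply: (@le_trans _ _ (2 ^+ N)).
    by rewrite ler_weXn2l// ler1n.
  by rewrite -[leLHS]invrK lef_pV2// posrE invr_gt0 exprn_gt0.
exists j => //; apply/andP; split.
  by move: hj; rewrite exprS -mulrA; lra.
case: j jN hj jmin => [|j] jN hj jmin.
  rewrite expr0 mul1r; move: jN xN; rewrite leqn0 => /eqP ->.
  by rewrite expr0 invr1.
by rewrite leNgt; apply/negP => h; have := jmin j h; rewrite ltnn.
Qed.

(** A single term does it, at the scale where 1/2 <= 2^j |x| <= 1: there |x|^r <= 2^(-rj), and 1 -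
    cos(2^j x) is at least 3/8 * 1/4 = 3/32. *)
Lemma powR_le_dyadic (r : R) (N : nat) (x : R) : 0 < r -> x != 0 -> `|x| <= (2 ^+ N)^-1 ->
  exists2 j, (N <= j)%N &
    `|x| `^ r <= 32 / 3 * ((2 `^ (- r)) ^+ j * (1 - cos (2 ^+ j * x))).
Proof.
move=> r0 x0 xN; have ax : 0 < `|x| by rewrite normr_gt0.
have [j Nj /andP[h1 h2]] := dyadic_bracket ax xN; exists j => //.
have q0 : 0 < 2 `^ (- r) by move=> *; exact: powR_gt0.
have hq : `|x| `^ r <= (2 `^ (- r)) ^+ j.
  rewrite -powR_mulrn ?(ltW q0)// -powRrM mulrC powRrM powRN powR_mulrn//.
  rewrite -[leRHS]mul1r ler_pdivlMr ?powR_gt0 ?exprn_gt0// -powRM ?exprn_ge0//.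
  by rewrite powR_le1 ?(ltW r0)// mulrC h2 andbT mulr_ge0 ?exprn_ge0.
have hc : 3 / 32 <= 1 - cos (2 ^+ j * x).
  have nx : `|2 ^+ j * x| = 2 ^+ j * `|x| by rewrite normrM ger0_norm ?exprn_ge0.
  have := @one_sub_cos_ge R (2 ^+ j * x); rewrite nx h2 => /(_ isT).
  rewrite -[X in _ * X <= _]real_normK ?num_real// nx => h.
  have : (2^-1) ^+ 2 <= (2 ^+ j * `|x|) ^+ 2 by rewrite lerXn2r ?nnegrE// (le_trans _ h1).
  by move: h; rewrite !expr2; lra.
apply: (le_trans hq); rewrite mulrCA ler_peMr ?exprn_ge0 ?(ltW q0)//; lra.
Qed.

End DyadicSums.

Section Phi.
Context {R : realType}.
Local Notation RM := (measurableTypeR R).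
Variable r : R.
Hypothesis r0 : 0 < r.

Lemma phiE x : phi r x = Num.min 1 (`|x| `^ r).
Proof. by rewrite /phi gt_eqF. Qed.

Lemma phi_ge0 x : 0 <= phi r x.
Proof. by rewrite phiE le_min ler01 powR_ge0. Qed.

Lemma phi_le1 x : phi r x <= 1.
Proof. by rewrite phiE ge_min lexx. Qed.

Lemma phi_at0 : phi r 0 = 0.
Proof. by rewrite phiE normr0 powR0 ?gt_eqF// min_r. Qed.

Lemma phi_small x : `|x| <= 1 -> phi r x = `|x| `^ r.
Proof. by move=> x1; rewrite phiE min_r// powR_le1 ?normr_ge0// ltW. Qed.

Lemma phi_large x : 1 <= `|x| -> phi r x = 1.
Proof. by move=> x1; rewrite phiE min_l// powR_ge1// ltW. Qed.

Lemma continuous_norm_powR : continuous (fun x : R => `|x| `^ r).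
Proof.
move=> x; have [->|x0] := eqVneq x 0.
  apply/cvgrPdist_lt => e e0; rewrite normr0 powR0 ?gt_eqF//.
  have d0 : 0 < e `^ r^-1 by exact: powR_gt0.
  suff hx (y : R) : `|y| < e `^ r^-1 -> `|0 - `|y| `^ r| < e.
    by near=> y; apply: hx; near: y; exact: near0_norm_lt.
  move=> yd; rewrite sub0r normrN ger0_norm ?powR_ge0//.
  have -> : e = (e `^ r^-1) `^ r by rewrite -powRrM mulVf ?gt_eqF// powRr1// ltW.
  by rewrite gt0_ltr_powR// nnegrE// ltW.
have ax : 0 < `|x| by rewrite normr_gt0.
apply: (@continuous_comp _ _ _ (fun y : R => `|y|) (fun y : R => y `^ r)).
  exact: norm_continuous.
apply: differentiable_continuous; apply/derivable1_diffP.
by apply: derivable_powR; rewrite in_itv/= ax.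
Unshelve. all: by end_near. Qed.

Lemma continuous_phi : continuous (phi r : R -> R).
Proof.
have -> : phi r = (fun x : R => Num.min 1 (`|x| `^ r)) by apply/funext => x; rewrite phiE.
move=> x; apply: (@continuous_min R R (fun=> 1) (fun y => `|y| `^ r)).
  exact: cvg_cst.
exact: continuous_norm_powR.
Qed.

Lemma measurable_phi : measurable_fun setT (phi r : R -> R).
Proof. exact: continuous_measurable_fun continuous_phi. Qed.

Lemma integrable_phi (F : {measure set RM -> \bar R}) : I_set F r ->
  F.-integrable setT (EFin \o (phi r : R -> R)).
Proof.
move=> [_ Fr]; apply/integrableP; split; first by apply/measurable_EFinP; exact: measurable_phi.
apply: le_lt_trans Fr; rewrite le_eqVlt; apply/orP; left; apply/eqP.
by apply: eq_integral => x _ /=; rewrite ger0_norm// phi_ge0.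
Qed.

End Phi.

Section PhiOrder.
Context {R : realType}.
Local Notation RM := (measurableTypeR R).

Lemma phi_le (r s x : R) : 0 < r -> r <= s -> phi s x <= phi r x.
Proof.
move=> r0 rs; have s0 := lt_le_trans r0 rs.
have [x1|x1] := leP `|x| 1; last by rewrite !phi_large// ltW.
rewrite !phi_small//; have [->|x0] := eqVneq x 0.
  by rewrite normr0 !powR0 ?gt_eqF.
by rewrite ger_powR// normr_gt0 x0.
Qed.

Lemma phi1E (x : R) : phi 1 x = Num.min 1 `|x|.
Proof. by rewrite phiE// powRr1. Qed.

Lemma I_set_le (F : {measure set RM -> \bar R}) (r s : R) :
  0 < r -> r <= s -> I_set F r -> I_set F s.
Proof.
move=> r0 rs [_ Fr]; have s0 := lt_le_trans r0 rs; split; first exact: ltW.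
apply: le_lt_trans Fr; apply: ge0_le_integral => //.
- by move=> x _; rewrite lee_fin phi_ge0.
- by apply/measurable_EFinP; exact: measurable_phi.
- by apply/measurable_EFinP; exact: measurable_phi.
- by move=> x _; rewrite lee_fin phi_le.
Qed.

End PhiOrder.

Lemma integrable_norm_EFin d (T : measurableType d) (R : realType)
    (mu : {measure set T -> \bar R}) (f : T -> R) :
  mu.-integrable setT (EFin \o f) -> mu.-integrable setT (EFin \o (fun x => `|f x|)).
Proof. exact: integrable_norm. Qed.

Lemma Rintegral_sum_nat d (T : measurableType d) (R : realType)
    (mu : {measure set T -> \bar R}) (h : nat -> T -> R) N M :
  (forall j, mu.-integrable setT (EFin \o h j)) ->
  mu.-integrable setT (EFin \o (fun x => \sum_(N <= j < M) h j x)) /\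
  \int[mu]_x (\sum_(N <= j < M) h j x) = \sum_(N <= j < M) \int[mu]_x h j x.
Proof.
move=> hi; have base (f : T -> R) : f =1 (fun=> 0) ->
    mu.-integrable setT (EFin \o f) /\ \int[mu]_x f x = 0.
  move=> f0; have -> : f = (fun=> 0) by apply/funext.
  by split; [exact: integrable0|rewrite /Rintegral integral0].
elim: M => [|M [i1 e1]].
  by rewrite big_geq//; apply: base => x; rewrite big_geq.
have [NM|MN] := leqP N M; last by rewrite big_geq//; apply: base => x; rewrite big_geq.
have fE : (fun x => \sum_(N <= j < M.+1) h j x) = (fun x => \sum_(N <= j < M) h j x + h M x).
  by apply/funext => x; rewrite big_nat_recr.
split; first by rewrite fE; exact: integrableD_EFin.
by rewrite fE (RintegralD measurableT i1 (hi M)) e1 big_nat_recr.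
Qed.

(** * The characteristic exponent at dyadic frequencies *)

Section DyadicExponent.
Context {R : realType}.
Local Notation RM := (measurableTypeR R).
Variables (b : R) (F : {measure set RM -> \bar R}).
Hypothesis Fint : (\int[F]_x (Num.min (x ^+ 2) 1)%:E < +oo)%E.

Lemma sqr_min_cos (v : R) : 1 - cos v <= 2 * Num.min 1 (`|v| ^+ 2).
Proof.
have h1 := one_sub_cos_le v; have h2 := one_sub_cos_le2 v.
rewrite real_normK ?num_real//; have := sqr_ge0 v.
by case: (leP 1 (v ^+ 2)) => _; lra.
Qed.

Lemma dyadic_integral_bounded (r A : R) (h : nat -> R -> R) : 0 < r -> I_set F r ->
  (forall j, F.-integrable setT (EFin \o h j)) ->
  (forall n x, \sum_(0 <= j < n) h j x <= A * phi r x) ->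
  forall n, \sum_(0 <= j < n) \int[F]_x h j x <= A * \int[F]_x phi r x.
Proof.
move=> r0 Ir hi hA n; have [i1 <-] := Rintegral_sum_nat 0 n hi.
rewrite -(RintegralZl _ measurableT (integrable_phi r0 Ir)).
apply: le_Rintegral => //; first exact: integrableZl_EFin (integrable_phi r0 Ir).
Qed.

(** Under the integral the sum is at most a multiple of [phi r], and this is where r in I enters.
    The quadratic bound of 1 - cos allows p = 2, hence all r < 2. *)
Lemma dyadic_exponent_re (r : R) : 0 < r < 2 -> I_set F r -> exists B, forall n,
  \sum_(0 <= j < n) (2 `^ (- r)) ^+ j * exponent_re 0 F (2 ^+ j) <= B.
Proof.
move=> /andP[r0 r2] Ir; have [|C [C0 hC]] := @dyadic_sum_le R r 2; first by rewrite r0.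
have ci j := integrableZl_EFin ((2 `^ (- r)) ^+ j) (integrable_one_sub_cos Fint (2 ^+ j)).
exists (2 * C * \int[F]_x phi r x) => n.
apply: le_trans (dyadic_integral_bounded (A := 2 * C) r0 Ir ci _ n).
  rewrite le_eqVlt; apply/orP; left; apply/eqP; apply: eq_bigr => j _.
  rewrite /exponent_re !mul0r add0r.
  by rewrite (RintegralZl _ measurableT (integrable_one_sub_cos Fint (2 ^+ j))).
move=> {}n x; have h := hC n `|x| (normr_ge0 x); rewrite -phiE// in h.
rewrite -mulrA; apply: le_trans (ler_wpM2l (ler0n R 2) h).
rewrite mulr_sumr; apply: ler_sum => j _.
rewrite mulrCA ler_wpM2l ?exprn_ge0 ?powR_ge0//.
by have := sqr_min_cos (2 ^+ j * x); rewrite normrM [ `|2 ^+ j| ]ger0_norm ?exprn_ge0.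
Qed.

Lemma norm_sin_le_min (v : R) : `|sin v| <= Num.min 1 `|v|.
Proof. by rewrite le_min sin_max norm_sin_le. Qed.

Lemma integrable_sin1 (u : R) : I_set F 1 -> F.-integrable setT (EFin \o (fun x : R => sin (u * x))).
Proof.
move=> I1; have i1 := integrable_phi ltr01 I1.
apply: (dominated_integrable _ (integrableZl_EFin (1 + `|u|) i1)); first exact: measurable_sinM.
move=> x; apply: (le_trans (norm_sin_le_min _)); rewrite phi1E normrM.
have u0 := normr_ge0 u; have x0 := normr_ge0 x; have := mulr_ge0 u0 x0.
by case: (leP 1 (`|u| * `|x|)); case: (leP 1 `|x|) => ? ? ?; nra.
Qed.

Lemma integrable_unit_id : I_set F 1 ->
  F.-integrable setT (EFin \o (fun x : R => x * \1_[set y : R | `|y| <= 1] x)).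
Proof.
move=> I1; apply: (dominated_integrable _ (integrable_phi ltr01 I1)).
  by apply: measurable_funM => //; apply: measurable_indic; exact: measurable_unit_ball.
move=> x; rewrite indicE; case: (boolP (x \in _)).
  by rewrite inE /= => x1; rewrite mulr1 phi1E min_r.
by rewrite mulr0 normr0 phi_ge0.
Qed.

Lemma bbarE : bbar F b = b - \int[F]_x (x * \1_[set y : R | `|y| <= 1] x).
Proof.
rewrite /bbar; congr (_ - _); rewrite Rintegral_mkcond; apply: eq_Rintegral => x _.
rewrite patchE indicE; case: (x \in _); rewrite ?mulr1 ?mulr0//.
Qed.

Lemma exponent_im_bbar u : I_set F 1 ->
  exponent_im b F u = u * bbar F b + \int[F]_x sin (u * x).
Proof.
move=> I1; rewrite /exponent_im bbarE.
have i2 := integrableZl_EFin u (integrable_unit_id I1).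
transitivity (u * b + (\int[F]_x sin (u * x) - \int[F]_x (u * (x * \1_[set y : R | `|y| <= 1] x)))).
  congr (_ + _); rewrite -(RintegralB measurableT (integrable_sin1 u I1) i2).
  by apply: eq_Rintegral => x _; rewrite mulrA.
by rewrite (RintegralZl _ measurableT (integrable_unit_id I1)); ring.
Qed.

(** Without drift only the integral of the sine remains, and |sin v| <= min(1, |v|) allows p = 1. A
    nonzero drift would contribute a multiple of the divergent sum of 2^((1-r)j). *)
Lemma dyadic_exponent_im_lt1 (r : R) : 0 < r < 1 -> I_set F r -> bbar F b = 0 ->
  exists B, forall n,
  \sum_(0 <= j < n) (2 `^ (- r)) ^+ j * `|exponent_im b F (2 ^+ j)| <= B.
Proof.
move=> /andP[r0 r1] Ir bb; have [|C [C0 hC]] := @dyadic_sum_le R r 1; first by rewrite r0.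
have I1 := I_set_le r0 (ltW r1) Ir.
pose h j (x : R) := (2 `^ (- r)) ^+ j * `|sin (2 ^+ j * x)|.
have hi j : F.-integrable setT (EFin \o h j).
  by apply: integrableZl_EFin; apply: integrable_norm_EFin; exact: integrable_sin1.
exists (C * \int[F]_x phi r x) => n.
apply: le_trans (dyadic_integral_bounded (A := C) r0 Ir hi _ n).
  apply: ler_sum => j _; rewrite exponent_im_bbar// bb mulr0 add0r.
  rewrite (RintegralZl _ measurableT (integrable_norm_EFin (integrable_sin1 (2 ^+ j) I1))).
  rewrite ler_wpM2l ?exprn_ge0 ?powR_ge0//.
  by apply: le_normr_Rintegral => //; exact: integrable_sin1.
move=> {}n x; rewrite phiE//; apply: le_trans (hC n `|x| (normr_ge0 x)).
apply: ler_sum => j _; rewrite ler_wpM2l ?exprn_ge0 ?powR_ge0//.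
rewrite (le_trans (norm_sin_le_min _))// expr1 normrM [ `|2 ^+ j| ]ger0_norm ?exprn_ge0//.
Qed.

(** For |x| <= 1 and v = 2^j x, the compensated sine is at most 2 |v| min(1, |v|). Taking out one
    factor |x| reduces the exponent r to r - 1 < 1. The drift contributes the convergent sum of
    2^(-(r-1)j), so that it need not vanish. *)
Lemma dyadic_exponent_im_gt1 (r : R) : 1 < r < 2 -> I_set F r ->
  exists B, forall n,
  \sum_(0 <= j < n) (2 `^ (- r)) ^+ j * `|exponent_im b F (2 ^+ j)| <= B.
Proof.
move=> /andP[r1 r2] Ir; have r0 : 0 < r by rewrite (lt_trans _ r1).
have [|C [C0 hC]] := @dyadic_sum_le R (r - 1) 1; first by move: r1 r2; lra.
pose s := r - 1; have s0 : 0 < s by rewrite subr_gt0.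
have aE j : (2 `^ (- r)) ^+ j * 2 ^+ j = (2 `^ (- s)) ^+ j.
  rewrite -exprMn; congr (_ ^+ _); rewrite -[X in _ * X](powRr1)// -powRD ?pnatr_eq0 ?implybT//.
  by rewrite /s; congr (_ `^ _); ring.
have q01 (t : R) : 0 < t -> 0 <= (2 : R) `^ (- t) < 1.
  move=> t0; rewrite powR_ge0/= powRN invf_lt1 ?powR_gt0//; apply: powR_gt1 => //.
  by rewrite ltr1n.
pose g (u x : R) := sin (u * x) - u * x * \1_[set y : R | `|y| <= 1] x.
pose h j (x : R) := (2 `^ (- r)) ^+ j * `|g (2 ^+ j) x|.
have hi j : F.-integrable setT (EFin \o h j).
  by apply: integrableZl_EFin; apply: integrable_norm_EFin; exact: integrable_sin_compensated.
pose A := 2 * C + (1 - 2 `^ (- r))^-1.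
have hA n x : \sum_(0 <= j < n) h j x <= A * phi r x.
  have B0 : 0 <= (1 - 2 `^ (- r))^-1 by rewrite invr_ge0 subr_ge0 ltW//; case/andP: (q01 r r0).
  have [x1|x1] := leP `|x| 1.
    rewrite phi_small//.
    have := hC n `|x| (normr_ge0 x); rewrite min_r; last by rewrite powR_le1 ?normr_ge0 ?subr_ge0 ?(ltW r1).
    move=> /(ler_wpM2l (normr_ge0 x)); rewrite [X in _ <= X]mulrCA mulr_powRB1// => h1.
    apply: (@le_trans _ _ (2 * (C * `|x| `^ r))); last first.
      by rewrite mulrA ler_wpM2r ?powR_ge0// /A lerDl.
    apply: le_trans (ler_wpM2l (ler0n R 2) h1).
    rewrite !mulr_sumr; apply: ler_sum => j _.
    rewrite -/s -aE /h /g indicE mem_set//= mulr1 expr1.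
    have a0 : 0 <= (2 `^ (- r)) ^+ j by rewrite exprn_ge0 ?powR_ge0.
    rewrite (_ : 2 * _ = (2 `^ (- r)) ^+ j *
      (2 * (2 ^+ j * (`|x| * Num.min 1 (2 ^+ j * `|x|))))); last by ring.
    rewrite ler_wpM2l//; set v := 2 ^+ j * x.
    have -> : 2 ^+ j * (`|x| * Num.min 1 (2 ^+ j * `|x|)) = `|v| * Num.min 1 `|v|.
      by rewrite /v normrM [ `|2 ^+ j| ]ger0_norm ?exprn_ge0// mulrA.
    have l1 := norm_sin_sub_le_norm v; have l2 := norm_sin_sub_le_sqr v.
    rewrite -[v ^+ 2]real_normK ?num_real// expr2 in l2.
    by case: (leP 1 `|v|) => _; lra.
  rewrite phi_large ?(ltW x1)// mulr1; apply: (@le_trans _ _ (1 - 2 `^ (- r))^-1); last first.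
    by rewrite /A lerDr mulr_ge0.
  apply: le_trans (geometric_sum_le n (q01 r r0)); apply: ler_sum => j _.
  rewrite /h /g indicE memNset/=; last by apply/negP; rewrite -ltNge.
  by rewrite mulr0 subr0 ler_piMr ?exprn_ge0 ?powR_ge0 ?sin_max.
exists (`|b| * (1 - 2 `^ (- s))^-1 + A * \int[F]_x phi r x) => n.
have h1 := dyadic_integral_bounded r0 Ir hi hA n.
have h2 := ler_wpM2l (normr_ge0 b) (geometric_sum_le n (q01 s s0)).
apply: le_trans (lerD h2 h1); rewrite mulr_sumr -big_split/=; apply: ler_sum => j _.
rewrite (RintegralZl _ measurableT (integrable_norm_EFin (integrable_sin_compensated Fint (2 ^+ j)))).
rewrite -aE mulrCA -mulrDr ler_wpM2l ?exprn_ge0 ?powR_ge0//.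
rewrite /exponent_im (le_trans (ler_normD _ _))// lerD//.
  by rewrite normrM [ `|2 ^+ j| ]ger0_norm ?exprn_ge0// mulrC.
by apply: le_normr_Rintegral => //; exact: integrable_sin_compensated.
Qed.

End DyadicExponent.

(** * Mass near 0 in the absence of a Gaussian part *)

Section PureJump.
Context {R : realType}.
Local Notation RM := (measurableTypeR R).
Variables (b : R) (F : {measure set RM -> \bar R}).
Hypothesis Fint : (\int[F]_x (Num.min (x ^+ 2) 1)%:E < +oo)%E.
Variables (mu : nat -> probability RM R) (D : nat -> R).
Hypothesis D0 : forall n, 0 < D n.
Hypothesis Dc : D n @[n --> \oo] --> 0.
Hypothesis muE : forall n u a, \int[mu n]_x cos (u * x - a) =
  expR (- (D n * exponent_re 0 F u)) * cos (D n * exponent_im b F u - a).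

(** Near 0 the function [phi r] is below the dyadic sum, and only frequencies 2^j with j >= N occur
    because the cutoff lives on |x| <= 2^-N. The mean of each term is explicit, and 1 - e^(-k)
    cos(y) <= k + (1 - cos(y)). *)
Lemma phi_near_le (r : R) (N m n : nat) (B : R) : 0 < r ->
  (2 : R) / m.+1%:R <= (2 ^+ N)^-1 ->
  (forall M, \sum_(N <= j < M) (2 `^ (- r)) ^+ j * (exponent_re 0 F (2 ^+ j) +
     (D n)^-1 * (1 - cos (D n * exponent_im b F (2 ^+ j)))) <= B) ->
  (D n)^-1 * \int[mu n]_x (phi r x * near_cutoff m x) <= 32 / 3 * B.
Proof.
move=> r0 mN hB; have Dn := D0 n.
pose a j := ((2 : R) `^ (- r)) ^+ j.
have a0 j : 0 <= a j by rewrite exprn_ge0 ?powR_ge0.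
pose h j (x : R) := a j * (1 - cos (2 ^+ j * x)).
have h0 j x : 0 <= h j x by rewrite mulr_ge0 ?one_sub_cos_ge0.
have mh j : measurable_fun setT (fun x : R => 1 - cos (2 ^+ j * x)) by exact: measurable_one_sub_cos.
have ci j : (mu n).-integrable setT (EFin \o (fun x : R => 1 - cos (2 ^+ j * x))).
  apply: (finite_bounded_integrable (mu n) (K := 2)) => [|x]; first exact: mh.
  by rewrite ger0_norm ?one_sub_cos_ge0 ?one_sub_cos_le2.
have hi j : (mu n).-integrable setT (EFin \o h j) by exact: integrableZl_EFin.
pose p (x : R) := phi r x * near_cutoff m x.
(* No finite sum dominates [p]. The minimum is bounded by 1 and, at each x, equals [p x] once M is
   large, so dominated convergence replaces an infinite sum. *)
pose f M (x : R) := Num.min (p x) (32 / 3 * \sum_(N <= j < M) h j x).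
have p01 x : 0 <= p x <= 1.
  have /andP[n1 n2] := near_cutoff_bounds m x.
  by rewrite mulr_ge0 ?phi_ge0//= mulr_ile1 ?phi_ge0 ?phi_le1.
have mp : measurable_fun setT p.
  apply: measurable_funM; first exact: measurable_phi.
  exact: continuous_measurable_fun (continuous_near_cutoff (m := m)).
have S0 M x : 0 <= 32 / 3 * \sum_(N <= j < M) h j x by rewrite mulr_ge0// sumr_ge0.
have Si M := (Rintegral_sum_nat N M hi).1.
have Si' M := integrableZl_EFin (32 / 3) (Si M).
have mf M : measurable_fun setT (f M).
  by apply: measurable_minr; [exact: mp|exact: integrable_measurable (Si' M)].
have f01 M x : `|f M x| <= 1.
  rewrite ger0_norm; first by rewrite ge_min; case/andP: (p01 x) => _ ->.
  by rewrite le_min S0 andbT; case/andP: (p01 x).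
have fp x : f ^~ x @ \oo --> p x.
  suff [j hj] : exists j, forall M, (j < M)%N -> p x <= 32 / 3 * \sum_(N <= j < M) h j x.
    apply: cvg_near_cst; exists j.+1 => // M /= jM.
    by rewrite /f min_l// hj.
  have [->|x0] := eqVneq x 0; first by exists 0%N => M _; rewrite /p phi_at0// mul0r.
  have [xm|xm] := leP (2 / m.+1%:R) `|x|.
    by exists 0%N => M _; rewrite /p near_cutoff_eq0// mulr0.
  have xN := le_trans (ltW xm) mN.
  have [j Nj hj] := powR_le_dyadic r0 x0 xN; exists j => M jM.
  have /andP[n1 n2] := near_cutoff_bounds m x.
  apply: (@le_trans _ _ (phi r x)); first by rewrite ler_piMr ?phi_ge0.
  apply: (@le_trans _ _ (`|x| `^ r)); first by rewrite phiE// ge_min lexx orbT.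
  apply: (le_trans hj); rewrite ler_wpM2l//.
  rewrite (@big_cat_nat _ _ _ j)//= ?(ltnW jM)// (@big_ltn _ _ _ j)// addrCA lerDl.
  by rewrite addr_ge0// sumr_ge0.
have lim : \int[mu n]_x f M x @[M --> \oo] --> \int[mu n]_x p x.
  apply: (@Rintegral_dominated_cvg _ _ _ (mu n) f p (fun=> 1)) => //.
  exact: finite_measure_integrable_cst.
rewrite ler_pdivrMl//; apply: (cvgn_le_lim lim) => M.
have fi : (mu n).-integrable setT (EFin \o f M).
  by apply: (finite_bounded_integrable (mu n) (K := 1)) => [|x]; [exact: mf|exact: f01].
apply: (@le_trans _ _ (\int[mu n]_x (32 / 3 * \sum_(N <= j < M) h j x))).
  by apply: le_Rintegral => // x _; rewrite ge_min lexx orbT.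
rewrite (RintegralZl _ measurableT (Si M)) mulrCA ler_wpM2l// (Rintegral_sum_nat N M hi).2.
rewrite -ler_pdivrMl//; apply: le_trans (hB M); rewrite mulr_sumr; apply: ler_sum => j _.
rewrite (RintegralZl _ measurableT (ci j)) mulrCA -/(a j) ler_wpM2l//.
have cosi : (mu n).-integrable setT (EFin \o (fun x : R => cos (2 ^+ j * x))).
  apply: (finite_bounded_integrable (mu n) (K := 1)) => [|x]; last by rewrite ler_norml cos_geN1 cos_le1.
  exact: measurable_cosM.
have -> : \int[mu n]_x (1 - cos (2 ^+ j * x)) = 1 - expR (- (D n * exponent_re 0 F (2 ^+ j))) * cos (D n * exponent_im b F (2 ^+ j)).
  have onei : (mu n).-integrable setT (EFin \o (fun _ : R => 1 : R)).
    exact: finite_measure_integrable_cst.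
  rewrite (RintegralB measurableT onei cosi).
  rewrite (Rintegral_probability_cst (mu n)); congr (_ - _).
  have := muE n (2 ^+ j) 0; rewrite subr0 => <-.
  by apply: eq_Rintegral => x _; rewrite subr0.
rewrite ler_pdivrMl// [leRHS]mulrDr (mulVKf (lt0r_neq0 Dn)).
have e1 := expR_ge1Dx (- (D n * exponent_re 0 F (2 ^+ j))).
have e2 : expR (- (D n * exponent_re 0 F (2 ^+ j))) <= 1.
  by rewrite -[leRHS]expR0 ler_expR oppr_le0 mulr_ge0 ?exponent_re_ge0// ltW.
have e3 := cos_le1 (D n * exponent_im b F (2 ^+ j)).
move: e1 e2 e3; move: (D n * exponent_re _ _ _) (cos _) (expR _) => k z w; nra.
Qed.

Lemma small_time_phi (r : R) : 0 < r < 2 -> I_set F r ->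
  (forall e : R, 0 < e -> exists N, forall M n,
    \sum_(N <= j < M) (2 `^ (- r)) ^+ j *
      ((D n)^-1 * (1 - cos (D n * exponent_im b F (2 ^+ j)))) <= e) ->
  (D n)^-1 * \int[mu n]_x phi r x @[n --> \oo] --> \int[F]_x phi r x.
Proof.
move=> /andP[r0 r2] Ir tl.
have hk (x : R) : 0 <= phi r x <= 1 by rewrite phi_ge0// phi_le1.
apply: (small_time_tail (lexx (0 : R)) Fint D0 Dc muE (continuous_phi r0) (phi_at0 r0) hk (integrable_phi r0 Ir)).
(* The factor 3/32 undoes the 32/3 of [phi_near_le]; each of the two tails receives half of e. *)
move=> e e0; have e4 : 0 < 3 / 32 * (e / 2) by rewrite mulr_gt0// divr_gt0.
have [|B hB] := @dyadic_exponent_re _ _ Fint r _ Ir; first by rewrite r0.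
have k0 j : 0 <= (2 `^ (- r)) ^+ j * exponent_re 0 F (2 ^+ j).
  by rewrite mulr_ge0 ?exponent_re_ge0 ?exprn_ge0 ?powR_ge0.
have [N1 h1] := ge0_tail_le k0 hB e4.
have [N2 h2] := tl _ e4.
pose N := maxn N1 N2.
(* For m beyond this index, 2/(m+1) <= 2^-N, so the cutoff sees scales from N on only. *)
exists (2 * 2 ^ N)%N => m n Nm.
have -> : e = 32 / 3 * (3 / 32 * (e / 2) + 3 / 32 * (e / 2)) by field.
apply: (@phi_near_le r N) => //.
  rewrite ler_pdivrMr// mulrC ler_pdivlMr ?exprn_gt0// -natrX -natrM ler_nat.
  by rewrite (leq_trans Nm).
move=> M; under eq_bigr do rewrite mulrDr; rewrite big_split/=; apply: lerD.
  have [MN|NM] := leqP M N; first by rewrite big_geq// ltW.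
  apply: le_trans (h1 M); rewrite [leRHS](@big_cat_nat _ _ _ N)/=; [|exact: leq_maxl|exact: ltnW].
  by rewrite lerDr sumr_ge0.
have [MN|NM] := leqP M N; first by rewrite big_geq// ltW.
apply: le_trans (h2 M n); rewrite [leRHS](@big_cat_nat _ _ _ N)/=; [|exact: leq_maxr|exact: ltnW].
rewrite lerDr sumr_ge0// => j _; rewrite mulr_ge0 ?exprn_ge0 ?powR_ge0//.
by rewrite mulr_ge0 ?one_sub_cos_ge0// invr_ge0 ltW.
Qed.

Lemma one_sub_cos_scaled_le (t v : R) : 0 < t -> t^-1 * (1 - cos (t * v)) <= `|v|.
Proof.
move=> t0; rewrite ler_pdivrMl//; have := cos_lipschitz 0 (t * v).
rewrite cos0 sub0r normrN normrM (gtr0_norm t0).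
by move=> /(le_trans (ler_norm _)).
Qed.

Lemma small_time_phi_abs (r : R) : 0 < r < 2 -> I_set F r ->
  (exists B, forall n,
    \sum_(0 <= j < n) (2 `^ (- r)) ^+ j * `|exponent_im b F (2 ^+ j)| <= B) ->
  (D n)^-1 * \int[mu n]_x phi r x @[n --> \oo] --> \int[F]_x phi r x.
Proof.
move=> r02 Ir [B hB]; apply: small_time_phi => // e e0.
have t0 j : 0 <= ((2 : R) `^ (- r)) ^+ j * `|exponent_im b F (2 ^+ j)|.
  by rewrite mulr_ge0 ?exprn_ge0 ?powR_ge0.
have [N hN] := ge0_tail_le t0 hB e0; exists N => M n; apply: le_trans (hN M).
apply: ler_sum => j _; rewrite ler_wpM2l ?exprn_ge0 ?powR_ge0//.
exact: one_sub_cos_scaled_le.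
Qed.

Lemma cvg_seq_ubound (u : nat -> R) (l : R) : u n @[n --> \oo] --> l -> exists B, forall n, `|u n| <= B.
Proof.
move=> /cvgP /cvg_seq_bounded [B [_ hB]]; exists (B + 1) => n.
by apply: (hB (B + 1)) => //; rewrite ltrDl.
Qed.

(* The exponents of [X_t / t] vanish as [t -> 0]. *)
Lemma exponent_im_zoom (s : nat -> R) (u : R) : I_set F 1 -> bbar F b = 0 ->
  (forall n, 0 < s n) -> s n @[n --> \oo] --> 0 ->
  s n * exponent_im b F (u / s n) @[n --> \oo] --> 0.
Proof.
move=> I1 bb s0 sc; have -> : (0 : R) = \int[F]_x (fun _ : R => 0) x by rewrite /Rintegral integral0.
have i1 := integrable_phi ltr01 I1.
have [B hB] := cvg_seq_ubound sc.
have -> : (fun n => s n * exponent_im b F (u / s n)) = (fun n => \int[F]_x (s n * sin (u / s n * x))).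
  apply/funext => n; rewrite exponent_im_bbar// bb mulr0 add0r.
  by rewrite (RintegralZl _ measurableT (integrable_sin1 (u / s n) I1)).
have bnd n x : `|s n * sin (u / s n * x)| <= (B + `|u|) * phi 1 x.
  have sB := hB n; rewrite normrM; rewrite gtr0_norm// in sB; rewrite gtr0_norm//.
  have sn := s0 n.
  have h1 : s n * `|sin (u / s n * x)| <= s n.
    by rewrite ler_piMr ?sin_max// ltW.
  have h2 : s n * `|sin (u / s n * x)| <= `|u| * `|x|.
    apply: (le_trans (ler_wpM2l (ltW sn) (norm_sin_le _))).
    by rewrite !normrM normfV (gtr0_norm sn) mulrA mulrCA mulfV ?gt_eqF// mulr1.
  have u0 := normr_ge0 u; have x0 := normr_ge0 x.
  rewrite phi1E; case: (leP 1 `|x|) => x1; first by rewrite mulr1; lra.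
  by rewrite mulrDl; have := mulr_ge0 (le_trans (ltW sn) sB) x0; lra.
apply: (@Rintegral_dominated_cvg _ _ _ F _ (fun=> 0) (fun x => (B + `|u|) * phi 1 x)) => //.
- by move=> n; apply: measurable_funM => //; exact: measurable_sinM.
- move=> x; apply/cvgrPdist_le => e e0; move/cvgrPdist_le : sc => /(_ e e0).
  apply: filterS => n; rewrite !sub0r !normrN normrM; apply: le_trans.
  by rewrite ler_piMr ?sin_max.
- exact: integrableZl_EFin.
Qed.

Lemma exponent_re_zoom (s : nat -> R) (u : R) : I_set F 1 ->
  (forall n, 0 < s n) -> s n @[n --> \oo] --> 0 ->
  s n * exponent_re 0 F (u / s n) @[n --> \oo] --> 0.
Proof.
move=> I1 s0 sc.
have i1 := integrable_phi ltr01 I1.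
have [B hB] := cvg_seq_ubound sc.
have -> : (fun n => s n * exponent_re 0 F (u / s n)) = (fun n => \int[F]_x (s n * (1 - cos (u / s n * x)))).
  apply/funext => n; rewrite /exponent_re !mul0r add0r.
  by rewrite (RintegralZl _ measurableT (integrable_one_sub_cos Fint (u / s n))).
have -> : (0 : R) = \int[F]_x (fun _ : R => 0) x by rewrite /Rintegral integral0.
have bnd n x : `|s n * (1 - cos (u / s n * x))| <= (2 * B + `|u|) * phi 1 x.
  have sB := hB n; rewrite gtr0_norm// in sB.
  have sn := s0 n; rewrite ger0_norm ?mulr_ge0 ?one_sub_cos_ge0 ?(ltW sn)//.
  have h1 : s n * (1 - cos (u / s n * x)) <= s n * 2.
    by rewrite ler_pM2l// one_sub_cos_le2.
  have h2 : s n * (1 - cos (u / s n * x)) <= `|u| * `|x|.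
    have := @one_sub_cos_scaled_le (s n)^-1 (u * x); rewrite invr_gt0 => /(_ sn).
    by rewrite invrK mulrA (mulrC _ u) normrM.
  have u0 := normr_ge0 u; have x0 := normr_ge0 x.
  rewrite phi1E; case: (leP 1 `|x|) => x1; first by rewrite mulr1; lra.
  by rewrite mulrDl; have := mulr_ge0 (le_trans (ltW sn) sB) x0; lra.
apply: (@Rintegral_dominated_cvg _ _ _ F _ (fun=> 0) (fun x => (2 * B + `|u|) * phi 1 x)) => //.
- by move=> n; apply: measurable_funM => //; exact: measurable_one_sub_cos.
- move=> x; apply/cvgrPdist_le => e e0; move/cvgrPdist_le : sc => /(_ _ (divr_gt0 e0 (ltr0n R 2))).
  apply: filterS => n; rewrite !sub0r !normrN (gtr0_norm (s0 n)) => h.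
  rewrite ger0_norm ?mulr_ge0 ?one_sub_cos_ge0 ?(ltW (s0 n))//.
  apply: (@le_trans _ _ (s n * 2)); first by rewrite ler_pM2l// one_sub_cos_le2.
  by move: h; lra.
- exact: integrableZl_EFin.
Qed.

(** At r = 1 the sum of 2^-j |theta(2^j)| is not controlled by F([phi 1]); what is known is theta(u)
    = o(u). Hence |theta(2^j)| <= q 2^j for j >= N with q small, and 1 - cos(D theta(2^j)) <= 2
    min(1, (2^j D q)^2). The dyadic sum of these is at most 2 C D q, so that after division by D the
    bound no longer depends on n. *)
Lemma small_time_phi1 : I_set F 1 -> bbar F b = 0 ->
  (D n)^-1 * \int[mu n]_x phi 1 x @[n --> \oo] --> \int[F]_x phi 1 x.
Proof.
move=> I1 bb; apply: small_time_phi => //; first by rewrite ltr01 ltr1n.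
move=> e e0; have [|C [C0 hC]] := @dyadic_sum_le R 1 2; first by rewrite ltr01 ltr1n.
pose s j : R := (2 ^+ j)^-1.
have s0 j : 0 < s j by rewrite invr_gt0 exprn_gt0.
have sc : s j @[j --> \oo] --> 0.
  rewrite (_ : s = fun j => (2^-1) ^+ j); last by apply/funext => j; rewrite exprVn.
  by apply: cvg_expr; rewrite ger0_norm ?invr_ge0// invf_lt1// ltr1n.
have e4 : 0 < e / (2 * (C + 1)) by rewrite divr_gt0// mulr_gt0// ltr_wpDl.
have := exponent_im_zoom 1 I1 bb s0 sc; move=> /cvgrPdist_le /(_ _ e4) [N _ hN].
exists N => M n; set q := e / _ in e4 hN.
have th j : (N <= j)%N -> `|exponent_im b F (2 ^+ j)| <= q * 2 ^+ j.
  move=> Nj; have := hN j Nj; rewrite sub0r normrN div1r invrK normrM ger0_norm ?(ltW (s0 j))//.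
  by rewrite ler_pdivrMl ?exprn_gt0// mulrC.
have Dn := D0 n; pose y := D n * q; have y0 : 0 <= y by rewrite mulr_ge0// ltW.
have a0 j : 0 <= ((2 : R) `^ (- 1)) ^+ j by rewrite exprn_ge0 ?powR_ge0.
have step j : (N <= j)%N -> 1 - cos (D n * exponent_im b F (2 ^+ j)) <= 2 * Num.min 1 ((2 ^+ j * y) ^+ 2).
  move=> Nj; apply: (le_trans (sqr_min_cos _)); rewrite ler_wpM2l// le_min !ge_min lexx/=.
  have yj : 0 <= 2 ^+ j * y by apply: mulr_ge0 => //; exact: exprn_ge0.
  rewrite lerXn2r ?nnegrE ?orbT//.
  by rewrite normrM (gtr0_norm Dn) /y [leRHS]mulrCA (ler_pM2l Dn) [leRHS]mulrC th.
apply: (@le_trans _ _ ((D n)^-1 * (2 * (C * y)))); last first.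
  have -> : (D n)^-1 * (2 * (C * y)) = (2 * C) * q by rewrite /y; field; rewrite gt_eqF.
  rewrite /q mulrA ler_pdivrMr ?mulr_gt0 ?ltr_wpDl//; have := mulr_ge0 C0 (ltW e0); lra.
apply: (@le_trans _ _ ((D n)^-1 * (2 * \sum_(0 <= j < M) (2 `^ (- 1)) ^+ j * Num.min 1 ((2 ^+ j * y) ^+ 2)))); last first.
  rewrite ler_wpM2l ?invr_ge0 ?(ltW Dn)// ler_wpM2l//.
  apply: (le_trans (hC M y y0)); rewrite ler_wpM2l// ge_min powRr1// lexx orbT//.
have t0 j : 0 <= ((2 : R) `^ (- 1)) ^+ j * Num.min 1 ((2 ^+ j * y) ^+ 2).
  by rewrite mulr_ge0// le_min ler01 sqr_ge0.
have [MN|NM] := leqP M N.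
  by rewrite big_geq// mulr_ge0 ?invr_ge0 ?(ltW Dn)// mulr_ge0// sumr_ge0.
apply: (@le_trans _ _ ((D n)^-1 * (2 * \sum_(N <= j < M) (2 `^ (- 1)) ^+ j * Num.min 1 ((2 ^+ j * y) ^+ 2)))).
  rewrite !mulr_sumr [leLHS]big_nat [leRHS]big_nat; apply: ler_sum => j /andP[Nj _].
  rewrite mulrCA ler_wpM2l ?invr_ge0 ?(ltW Dn)//.
  by rewrite [leRHS]mulrCA ler_wpM2l// step.
rewrite ler_wpM2l ?invr_ge0 ?(ltW Dn)// ler_wpM2l//.
by rewrite [leRHS](@big_cat_nat _ _ _ N)//= ?(ltnW NM)// lerDr sumr_ge0.
Qed.

End PureJump.

Section Law.
Context d d' (T : measurableType d) (T' : measurableType d') {R : realType}.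
Variables (P : probability T R) (f : T -> T') (mf : measurable_fun setT f).

Definition law : probability T' R :=
  let mfm := isMeasurableFun.Build _ _ _ _ f mf in
  let Y : {mfun T >-> T'} := HB.pack f mfm in distribution P Y.

Lemma Rintegral_law (g : T' -> R) (K : R) : measurable_fun setT g ->
  (forall x, `|g x| <= K) -> \int[law]_x g x = \int[P]_w g (f w).
Proof.
move=> mg gK; rewrite /Rintegral /law integral_pushforward//.
- exact/measurable_EFinP.
- apply: (finite_bounded_integrable P (K := K)) => //.
  exact: (measurableT_comp mg mf).
Qed.

End Law.

Lemma cvgn_expR (R : realType) (u : nat -> R) (l : R) :
  u n @[n --> \oo] --> l -> expR (u n) @[n --> \oo] --> expR l.
Proof. by move=> ul; exact: (cvg_comp _ _ ul (@continuous_expR R l)). Qed.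

Lemma cvgn_cos (R : realType) (u : nat -> R) (l : R) :
  u n @[n --> \oo] --> l -> cos (u n) @[n --> \oo] --> cos l.
Proof. by move=> ul; exact: (cvg_comp _ _ ul (@continuous_cos R l)). Qed.

Lemma measurable_cos_affine (R : realType) (u a : R) :
  measurable_fun setT (fun x : R => cos (u * x - a)).
Proof.
apply: measurableT_comp; first by apply: continuous_measurable_fun; exact: continuous_cos.
by apply: measurable_funB => //; exact: measurable_funM.
Qed.

Lemma norm_cos_affine (R : realType) (u a x : R) : `|cos (u * x - a)| <= 1.
Proof. by rewrite ler_norml cos_geN1 cos_le1. Qed.

(** * The contribution of the drift when r = 1 *)

Section Drift.
Context {R : realType}.
Local Notation RM := (measurableTypeR R).
Variables (b : R) (F : {measure set RM -> \bar R}).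
Hypothesis Fint : (\int[F]_x (Num.min (x ^+ 2) 1)%:E < +oo)%E.
Variables (mu : nat -> probability RM R) (D : nat -> R).
Hypothesis D0 : forall n, 0 < D n.
Hypothesis Dc : D n @[n --> \oo] --> 0.
Hypothesis muE : forall n u a, \int[mu n]_x cos (u * x - a) =
  expR (- (D n * exponent_re 0 F u)) * cos (D n * exponent_im b F u - a).
Hypothesis I1 : I_set F 1.

Lemma phi1_lipschitz (x y : R) : `|phi 1 x - phi 1 y| <= `|x - y|.
Proof.
rewrite !phi1E; have := ler_dist_dist x y; move: `|x| `|y| `|x - y| => p q k.
rewrite !ler_norml => /andP[h1 h2].
by case: (leP 1 p); case: (leP 1 q) => *; apply/andP; split; lra.
Qed.

(** With a = beta D' the left side is at most 2 min(|a|, |y|): compare [phi 1 (y + a)] with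
    [phi 1 y] when y is the larger, with [phi 1 a] otherwise. Relative to D' this is negligible as
    soon as y is of smaller order than D'. *)
Lemma phi1_shift (D' beta y : R) : 0 < D' -> `|beta * D'| <= 1 ->
  `|phi 1 (y + beta * D') - phi 1 y - `|beta * D'| | <=
  2 * (1 + `|beta|) * D' * phi 1 (y / D').
Proof.
move=> D'0; set a := beta * D' => a1.
have h1 := phi1_lipschitz (y + a) y; rewrite (addrC y a) addrK -(addrC y a) in h1.
have h2 := phi1_lipschitz (y + a) a; rewrite addrK in h2.
have h3 : phi 1 a = `|a| by rewrite phi1E min_r.
have h4 : phi 1 y <= `|y| by rewrite phi1E ge_min lexx orbT.
have h5 := phi_ge0 ltr01 y.
have aE : `|a| = `|beta| * D' by rewrite normrM (gtr0_norm D'0).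
have yE : `|y| = D' * `|y / D'|.
  by rewrite normrM normfV (gtr0_norm D'0) mulrCA mulfV ?gt_eqF// mulr1.
have b0 := normr_ge0 beta; have z0 := normr_ge0 (y / D').
rewrite h3 in h2; rewrite (phi1E (y / D')).
apply: (@le_trans _ _ (2 * Num.min `|a| `|y|)).
  move: h1 h2 (normr_ge0 a); rewrite !ler_norml => /andP[p1 p2] /andP[p3 p4] p5.
  clear -p1 p2 p3 p4 p5 h4 h5.
  by case: (leP `|a| `|y|) => ?; apply/andP; split; lra.
rewrite -!mulrA ler_wpM2l//; rewrite yE aE.
move: b0 z0; move: `|beta| `|y / D'| => B z b0 z0.
have Dz := mulr_ge0 (ltW D'0) z0; have BD := mulr_ge0 b0 (ltW D'0).
have BDz := mulr_ge0 b0 Dz.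
clear -D'0 b0 z0 Dz BD BDz.
by case: (leP (B * D') (D' * z)); case: (leP 1 z) => *; nra.
Qed.

Let beta := bbar F b.

Let mshift n : measurable_fun setT (fun x : RM => x - beta * D n : RM).
Proof. exact: measurable_funB. Qed.

Let nu n := law (mu n) (mshift n).

Let nuE n u a : \int[nu n]_x cos (u * x - a) =
  expR (- (D n * exponent_re 0 F u)) * cos (D n * exponent_im (b - beta) F u - a).
Proof.
rewrite (Rintegral_law (mu n) (mshift n) (measurable_cos_affine u a) (norm_cos_affine u a)).
transitivity (\int[mu n]_x cos (u * x - (u * beta * D n + a))).
  by apply: eq_Rintegral => x _; congr cos; ring.
rewrite muE /exponent_im; congr (_ * cos _); ring.
Qed.

Let bbar0 : bbar F (b - beta) = 0.
Proof. by rewrite /beta /bbar; ring. Qed.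

Let mzoom n : measurable_fun setT (fun x : RM => x / D n : RM).
Proof. exact: measurable_funM. Qed.

Let zoom n := law (nu n) (mzoom n).

(** Once the drift is removed, X_D / D tends to 0 in law: its characteristic functions tend to 1 by
    the zoom lemmas, and the limit is a Dirac mass. *)
Lemma zoom_phi1 : \int[nu n]_x phi 1 (x / D n) @[n --> \oo] --> 0.
Proof.
have -> : (fun n => \int[nu n]_x phi 1 (x / D n)) = (fun n => \int[zoom n]_x phi 1 x).
  apply/funext => n.
  have phiK (x : R) : `|phi 1 x| <= 1 by rewrite ger0_norm ?phi_ge0 ?phi_le1.
  by rewrite (Rintegral_law (nu n) (mzoom n) (measurable_phi ltr01) phiK).
have -> : (0 : R) = \int[\d_(0 : RM)]_x phi 1 x.
  rewrite /Rintegral integral_dirac//; last by apply/measurable_EFinP; exact: measurable_phi.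
  by rewrite diracT mul1e/= phi_at0.
apply: (@levy_continuity _ zoom (\d_(0 : RM)) _ (phi 1) 1).
- move=> u a.
  have -> : \int[\d_(0 : RM)]_x cos (u * x - a) = cos a.
    rewrite /Rintegral integral_dirac//; last by apply/measurable_EFinP; exact: measurable_cos_affine.
    by rewrite diracT mul1e/= mulr0 sub0r cosN.
  have -> : (fun n => \int[zoom n]_x cos (u * x - a)) = (fun n =>
     expR (- (D n * exponent_re 0 F (u / D n))) * cos (D n * exponent_im (b - beta) F (u / D n) - a)).
    apply/funext => n; rewrite -nuE.
    rewrite (Rintegral_law (nu n) (mzoom n) (measurable_cos_affine u a) (norm_cos_affine u a)).
    by apply: eq_Rintegral => x _; congr cos; ring.
  have -> : cos a = expR (- 0) * cos (0 - a) by rewrite oppr0 expR0 mul1r sub0r cosN.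
  apply: cvgM.
    by apply: cvgn_expR; apply: cvgN; exact: (exponent_re_zoom Fint u I1 D0 Dc).
  apply: cvgn_cos; apply: cvgB; last exact: cvg_cst.
  exact: (exponent_im_zoom u I1 bbar0 D0 Dc).
- exact: measurable_phi.
- by move=> x; rewrite ger0_norm ?phi_ge0 ?phi_le1.
- by apply/aeW => x; exact: continuous_phi.
Qed.

(** The driftless laws have limit F([phi 1]). Putting back the shift bbar D adds |bbar| D up to an
    error of order D times the mean bounded in [zoom_phi1], so after division by D the extra term is
    |bbar|. *)
Lemma small_time_phi1_drift :
  (D n)^-1 * \int[mu n]_x phi 1 x @[n --> \oo] --> \int[F]_x phi 1 x + `|bbar F b|.
Proof.
have nu1 := small_time_phi1 Fint D0 Dc nuE I1 bbar0.
have phiK x : `|phi 1 x| <= 1 :> R by rewrite ger0_norm ?phi_ge0 ?phi_le1.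
have mphi1 := measurable_phi (ltr01 : 0 < (1 : R)).
suff : (D n)^-1 * \int[mu n]_x phi 1 x - ((D n)^-1 * \int[nu n]_x phi 1 x + `|beta|) @[n --> \oo] --> 0.
  move=> h; rewrite -[X in _ --> X]add0r.
  have Bc : (D n)^-1 * \int[nu n]_x phi 1 x + `|beta| @[n --> \oo] --> \int[F]_x phi 1 x + `|beta|.
    by apply: cvgD; [exact: nu1|exact: cvg_cst].
  rewrite (_ : (fun n => _) = (fun n => (D n)^-1 * \int[mu n]_x phi 1 x -
     ((D n)^-1 * \int[nu n]_x phi 1 x + `|beta|) + ((D n)^-1 * \int[nu n]_x phi 1 x + `|beta|))).
    exact: (cvgD h Bc).
  by apply/funext => n; rewrite subrK.
apply/cvgrPdist_le => e e0.
have e4 : 0 < e / (2 * (1 + `|beta|)) by rewrite divr_gt0// mulr_gt0// ltr_wpDr.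
have b1 : 0 < (`|beta| + 1)^-1 by rewrite invr_gt0 ltr_wpDl.
have := zoom_phi1; move=> /cvgrPdist_le /(_ _ e4).
move/cvgrPdist_le : Dc => /(_ _ b1); apply: filterS2 => n.
rewrite !sub0r !normrN (gtr0_norm (D0 n)) => hD hz.
have Dn := D0 n.
have small : `|beta * D n| <= 1.
  rewrite normrM (gtr0_norm Dn); have := ler_wpM2l (normr_ge0 beta) hD.
  move=> /le_trans; apply; rewrite ler_pdivrMr ?ltr_wpDl// mul1r lerDl//.
have -> : \int[mu n]_x phi 1 x = \int[nu n]_x phi 1 (x + beta * D n).
  transitivity (\int[mu n]_x phi 1 (x - beta * D n + beta * D n)).
    by apply: eq_Rintegral => x _; rewrite subrK.
  have mg : measurable_fun setT (fun x : R => phi 1 (x + beta * D n)).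
    by apply: (measurableT_comp mphi1); exact: measurable_funD.
  exact/esym/(Rintegral_law (mu n) (mshift n) mg (fun x => phiK (x + beta * D n))).
have i1 : (nu n).-integrable setT (EFin \o (fun x : R => phi 1 (x + beta * D n))).
  apply: (finite_bounded_integrable (nu n) (K := 1)) => [|x]; last exact: phiK.
  by apply: (measurableT_comp mphi1); exact: measurable_funD.
have i2 : (nu n).-integrable setT (EFin \o (fun x : R => phi 1 x)).
  by apply: (finite_bounded_integrable (nu n) (K := 1)) => [|x]; [exact: mphi1|exact: phiK].
have i3 : (nu n).-integrable setT (EFin \o (fun x : R => phi 1 (x / D n))).
  apply: (finite_bounded_integrable (nu n) (K := 1)) => [|x]; last exact: phiK.
  by apply: (measurableT_comp mphi1); exact: measurable_funM.
have ic : (nu n).-integrable setT (EFin \o (fun _ : R => `|beta * D n|)).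
  exact: finite_measure_integrable_cst.
have i12 := integrableB_EFin i1 i2.
have i12c := integrableB_EFin i12 ic.
have E : \int[nu n]_x (phi 1 (x + beta * D n) - phi 1 x - `|beta * D n|) =
    \int[nu n]_x phi 1 (x + beta * D n) - \int[nu n]_x phi 1 x - `|beta * D n|.
  rewrite (RintegralB measurableT i12 ic) (RintegralB measurableT i1 i2).
  by rewrite (Rintegral_probability_cst (nu n)).
have B : `|\int[nu n]_x (phi 1 (x + beta * D n) - phi 1 x - `|beta * D n|)| <=
    2 * (1 + `|beta|) * D n * \int[nu n]_x phi 1 (x / D n).
  rewrite -(RintegralZl _ measurableT i3).
  apply: (Rintegral_norm_le _ (integrableZl_EFin _ i3) _).
    exact: integrable_measurable i12c.
  by move=> x; exact: phi1_shift.
rewrite E in B; rewrite normrM (gtr0_norm Dn) in B.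
have alg (p q t D' : R) : D' != 0 -> D'^-1 * p - (D'^-1 * q + t) = D'^-1 * (p - q - t * D').
  by move=> D'0; field.
rewrite alg ?gt_eqF//.
rewrite normrM gtr0_norm ?invr_gt0// ler_pdivrMl//; apply: (le_trans B).
rewrite mulrAC mulrC ler_pM2l//.
have := le_trans (ler_norm _) hz; rewrite ler_pdivlMr ?mulr_gt0 ?ltr_wpDr//.
by rewrite mulrC.
Qed.

End Drift.

(** * Limits for functions that are O, o or equivalent at 0 *)

Section Moments.
Context {R : realType}.
Local Notation RM := (measurableTypeR R).
Variables (b : R) (F : {measure set RM -> \bar R}).
Hypothesis Fint : (\int[F]_x (Num.min (x ^+ 2) 1)%:E < +oo)%E.
Variables (mu : nat -> probability RM R) (D : nat -> R).
Hypothesis D0 : forall n, 0 < D n.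
Hypothesis Dc : D n @[n --> \oo] --> 0.
Hypothesis muE : forall n u a, \int[mu n]_x cos (u * x - a) =
  expR (- (D n * exponent_re 0 F u)) * cos (D n * exponent_im b F u - a).

Lemma small_time_phi_cvg (r : R) : 0 < r < 2 -> I_set F r ->
  1 < r \/ bbar F b = 0 ->
  (D n)^-1 * \int[mu n]_x phi r x @[n --> \oo] --> \int[F]_x phi r x.
Proof.
move=> r02 Ir; have /andP[r0 r2] := r02.
have [r1|r1|r1] := ltgtP 1 r.
- move=> _; apply: (small_time_phi_abs Fint D0 Dc muE) => //.
  by apply: dyadic_exponent_im_gt1 => //; rewrite r1.
- case=> // bb; apply: (small_time_phi_abs Fint D0 Dc muE) => //.
  by apply: dyadic_exponent_im_lt1 => //; rewrite r0.
- case=> // bb; rewrite -r1 in Ir *.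
  exact: (small_time_phi1 Fint D0 Dc muE).
Qed.

Lemma cvg_of_le_eps (u : nat -> R) (l : R) :
  (forall e : R, 0 < e -> \forall n \near \oo, `|u n - l| <= e) -> u n @[n --> \oo] --> l.
Proof.
by move=> h; apply/cvgrPdist_le => e /h; apply: filterS => n; rewrite distrC.
Qed.

Lemma small_time_bigO (r A d K : R) (f : R -> R) : 0 < r < 2 -> I_set F r ->
  1 < r \/ bbar F b = 0 ->
  measurable_fun setT f -> (forall x, `|f x| <= K) ->
  {ae F, forall x : R, {for x, continuous f}} ->
  0 < d -> (forall x, `|x| < d -> `|f x| <= A * `|x| `^ r) ->
  (D n)^-1 * \int[mu n]_x f x @[n --> \oo] --> \int[F]_x f x.
Proof.
move=> r02 Ir rb mf fK cf d0 fA; have /andP[r0 r2] := r02.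
have hk (x : R) : 0 <= phi r x <= 1 by rewrite phi_ge0// phi_le1.
have kj : (D n)^-1 * \int[mu n]_x phi r x @[n --> \oo] --> \int[F]_x phi r x + 0.
  by rewrite addr0; exact: small_time_phi_cvg.
have d1 : 0 < Num.min d 1 by rewrite lt_min d0 ltr01.
have fA' (x : R) : `|x| < Num.min d 1 -> `|f x| <= `|A| * phi r x.
  rewrite lt_min => /andP[xd x1]; rewrite phi_small ?(ltW x1)//.
  by rewrite (le_trans (fA x xd))// ler_wpM2r ?powR_ge0// ler_norm.
have [_ h] := small_time_compare (lexx (0 : R)) Fint D0 Dc muE (continuous_phi r0) (phi_at0 r0)
  hk (integrable_phi r0 Ir) kj mf fK cf (normr_ge0 A) d1 fA'.
by apply: cvg_of_le_eps => e e0; have := h e e0; rewrite mulr0 add0r.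
Qed.

(** Comparison with [phi 1] leaves A |bbar|, and A is arbitrarily small here. *)
Lemma small_time_littleo1 (K : R) (f : R -> R) : I_set F 1 ->
  measurable_fun setT f -> (forall x, `|f x| <= K) ->
  {ae F, forall x : R, {for x, continuous f}} ->
  (forall e : R, 0 < e -> exists2 d : R, 0 < d &
     forall x : R, `|x| < d -> `|f x| <= e * `|x|) ->
  F.-integrable setT (EFin \o f) /\
  (D n)^-1 * \int[mu n]_x f x @[n --> \oo] --> \int[F]_x f x.
Proof.
move=> I1 mf fK cf fo; have r0 : 0 < (1 : R) by [].
have hk (x : R) : 0 <= phi 1 x <= 1 by rewrite phi_ge0// phi_le1.
have kj := small_time_phi1_drift Fint D0 Dc muE I1.
have key (A : R) : 0 < A -> F.-integrable setT (EFin \o f) /\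
    (forall e, 0 < e -> \forall n \near \oo,
       `|(D n)^-1 * \int[mu n]_x f x - \int[F]_x f x| <= A * `|bbar F b| + e).
  move=> A0; have [d d0 fA] := fo A A0.
  have d1 : 0 < Num.min d 1 by rewrite lt_min d0 ltr01.
  have fA' (x : R) : `|x| < Num.min d 1 -> `|f x| <= A * phi 1 x.
    rewrite lt_min => /andP[xd x1]; rewrite phi_small ?(ltW x1)// powRr1//.
    exact: fA.
  exact: (small_time_compare (lexx (0 : R)) Fint D0 Dc muE (continuous_phi r0) (phi_at0 r0)
    hk (integrable_phi r0 I1) kj mf fK cf (ltW A0) d1 fA').
split; first exact: (key 1 ltr01).1.
apply: cvg_of_le_eps => e e0.
have b1 : 0 < 2 * (`|bbar F b| + 1) by rewrite mulr_gt0// ltr_wpDl.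
have [_ /(_ (e / 2))] := key (e / (2 * (`|bbar F b| + 1))) (divr_gt0 e0 b1).
rewrite divr_gt0// => /(_ isT); apply: filterS => n /le_trans; apply.
have : e / (2 * (`|bbar F b| + 1)) * `|bbar F b| <= e / 2.
  rewrite mulrAC ler_pdivrMr// (_ : e / 2 * _ = e * (`|bbar F b| + 1)); last by field.
  by rewrite ler_wpM2l ?(ltW e0)// lerDl.
by lra.
Qed.

Lemma small_time_equiv1 (K : R) (f : R -> R) : I_set F 1 ->
  measurable_fun setT f -> (forall x, `|f x| <= K) ->
  {ae F, forall x : R, {for x, continuous f}} ->
  (forall e : R, 0 < e -> exists2 d : R, 0 < d &
     forall x : R, `|x| < d -> `|f x - `|x| | <= e * `|x|) ->
  (D n)^-1 * \int[mu n]_x f x @[n --> \oo] --> \int[F]_x f x + `|bbar F b|.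
Proof.
move=> I1 mf fK cf fe; have r0 : 0 < (1 : R) by [].
have mphi := measurable_phi r0; have phii := integrable_phi r0 I1.
pose g (x : R) := f x - phi 1 x.
have mg : measurable_fun setT g by exact: measurable_funB.
have phiK (x : R) : `|phi 1 x| <= 1 by rewrite ger0_norm ?phi_ge0 ?phi_le1.
have gK (x : R) : `|g x| <= K + 1.
  by rewrite (le_trans (ler_normB _ _))// lerD.
have cg : {ae F, forall x : R, {for x, continuous g}}.
  by apply: ae_imply cf => x cx; apply: cvgB; [exact: cx|exact: continuous_phi].
have go (e : R) : 0 < e -> exists2 d : R, 0 < d & forall x : R, `|x| < d -> `|g x| <= e * `|x|.
  move=> e0; have [d d0 hd] := fe e e0; exists (Num.min d 1); first by rewrite lt_min d0 ltr01.
  move=> x; rewrite lt_min => /andP[xd x1].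
  by rewrite /g phi_small ?(ltW x1)// powRr1//; exact: hd.
have [gi gc] := small_time_littleo1 I1 mg gK cg go.
have E : f = (fun x => g x + phi 1 x) by apply/funext => x; rewrite /g subrK.
have -> : \int[F]_x f x + `|bbar F b| = \int[F]_x g x + (\int[F]_x phi 1 x + `|bbar F b|).
  by rewrite addrA E -(RintegralD measurableT gi phii); congr (_ + _); apply: eq_Rintegral.
have -> : (fun n => (D n)^-1 * \int[mu n]_x f x) =
    (fun n => (D n)^-1 * \int[mu n]_x g x + (D n)^-1 * \int[mu n]_x phi 1 x).
  apply/funext => n; rewrite -mulrDr; congr (_ * _).
  have i1 : (mu n).-integrable setT (EFin \o g) by exact: (finite_bounded_integrable (mu n) mg gK).
  have i2 : (mu n).-integrable setT (EFin \o (phi 1 : R -> R)).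
    exact: (finite_bounded_integrable (mu n) mphi phiK).
  by rewrite -(RintegralD measurableT i1 i2); apply: eq_Rintegral => x _; rewrite {1}E.
exact: (cvgD gc (small_time_phi1_drift Fint D0 Dc muE I1)).
Qed.

End Moments.

(** * The function classes in epsilon-delta form *)

Section Classes.
Context {R : realType}.

Lemma near0_ball (Q : R -> Prop) : (\forall x \near (0 : R), Q x) ->
  exists2 d : R, 0 < d & forall x, `|x| < d -> Q x.
Proof.
move=> /nbhs_ballP [d /= d0 hd]; exists d => // x xd; apply: hd.
by rewrite /ball /= sub0r normrN.
Qed.

Lemma bounded_fun_le (f : R -> R) : bounded_fun f -> exists K, forall x, `|f x| <= K.
Proof.
move=> [B [_ hB]]; exists (B + 1) => x; apply: (hB (B + 1)) => //.
by rewrite ltrDl.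
Qed.

Lemma classE''_le (r : R) (f : R -> R) : classE'' r f ->
  forall e : R, 0 < e -> exists2 d : R, 0 < d & forall x, `|x| < d -> `|f x| <= e * `|x| `^ r.
Proof.
move=> [_ _ _ /eqoP fo] e e0; apply: near0_ball; have := fo e e0.
by apply: filterS => x; rewrite [ `|abs_pow _ _| ]ger0_norm// powR_ge0.
Qed.

Lemma classE'_le (r : R) (f : R -> R) : classE' r f ->
  exists A d : R, 0 < d /\ forall x, `|x| < d -> `|f x| <= A * `|x| `^ r.
Proof.
move=> [_ _ _ /eqO_exP [A A0 fA]]; exists A.
have [d d0 hd] := near0_ball fA; exists d; split=> // x xd.
by have := hd x xd; rewrite [ `|abs_pow _ _| ]ger0_norm// powR_ge0.
Qed.

Lemma classE_le (r : R) (f : R -> R) : classE r f ->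
  forall e : R, 0 < e -> exists2 d : R, 0 < d &
    forall x, `|x| < d -> `|f x - `|x| `^ r| <= e * `|x| `^ r.
Proof.
move=> [_ _ _ /eqaddoP fo] e e0; apply: near0_ball; have := fo e e0.
by apply: filterS => x; rewrite [ `|abs_pow _ _| ]ger0_norm// powR_ge0.
Qed.

Lemma norm_powR2 (x : R) : `|x| `^ 2 = x ^+ 2.
Proof. by rewrite powR_mulrn// real_normK ?num_real. Qed.

End Classes.

(** * Law of large numbers *)

Section Uncorrelated.
Context d (T : measurableType d) (R : realType) (P : probability T R).
Variables (Z : nat -> T -> R) (K s : R).
Hypothesis mZ : forall i, measurable_fun setT (Z i).
Hypothesis ZK : forall i w, `|Z i w| <= K.
Hypothesis orth : forall i j, i != j -> \int[P]_w (Z i w * Z j w) = 0.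
Hypothesis var : forall i, \int[P]_w (Z i w ^+ 2) <= s.

Let S k w := \sum_(0 <= i < k) Z i w.

Let mS k : measurable_fun setT (S k).
Proof. exact: measurable_sum. Qed.

Let SK k w : `|S k w| <= k%:R * K.
Proof.
rewrite (le_trans (ler_norm_sum _ _ _))//; apply: (@le_trans _ _ (\sum_(0 <= i < k) K)).
  by apply: ler_sum => i _; exact: ZK.
by rewrite big_const_nat iter_addr_0 subn0 mulr_natl.
Qed.

Let SK2 k w : `|S k w ^+ 2| <= (k%:R * K) ^+ 2.
Proof.
by rewrite normrX lerXn2r ?nnegrE ?SK// (le_trans _ (SK k w)).
Qed.

Let iS2 k : P.-integrable setT (EFin \o (fun w => S k w ^+ 2)).
Proof.
by apply: (finite_bounded_integrable P (K := (k%:R * K) ^+ 2)) => //; exact: measurable_funX.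
Qed.

Lemma Rintegral_sqr_sum_uncorrelated k :
  \int[P]_w ((\sum_(0 <= i < k) Z i w) ^+ 2) <= k%:R * s.
Proof.
have ZZi i j : P.-integrable setT (EFin \o (fun w => Z i w * Z j w)).
  apply: (finite_bounded_integrable P (K := K * K)); first exact: measurable_funM.
  by move=> w; rewrite normrM ler_pM.
have Z2i i : P.-integrable setT (EFin \o (fun w => Z i w ^+ 2)) by exact: ZZi.
elim: k => [|k IH].
  rewrite mul0r (_ : (fun w => _) = (fun=> 0)); first by rewrite /Rintegral integral0.
  by apply/funext => w; rewrite big_geq// expr0n.
have [i1 e1] := Rintegral_sum_nat 0 k (fun i => ZZi i k).
have i2 := integrableZl_EFin 2 i1.
have E w : (\sum_(0 <= i < k.+1) Z i w) ^+ 2 =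
    S k w ^+ 2 + 2 * (\sum_(0 <= i < k) Z i w * Z k w) + Z k w ^+ 2.
  by rewrite big_nat_recr//= -mulr_suml -/(S k w); ring.
under eq_Rintegral do rewrite E.
have i12 := integrableD_EFin (iS2 k) i2.
rewrite (RintegralD measurableT i12 (Z2i k)) (RintegralD measurableT (iS2 k) i2).
rewrite (RintegralZl _ measurableT i1) e1 big_nat big1 ?mulr0 ?addr0; last first.
  by move=> i /andP[_ ik]; rewrite orth// ltn_eqF.
by rewrite -natr1 mulrDl mul1r lerD// var.
Qed.

Lemma chebyshev_uncorrelated k (l : R) : 0 < l ->
  measurable [set w | l <= `|\sum_(0 <= i < k) Z i w| ] /\
  (P [set w | (l <= `|\sum_(0 <= i < k) Z i w|)%R] <= (k%:R * s / l ^+ 2)%:E)%E.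
Proof.
move=> l0; set A := [set w | _].
have mA : measurable A.
  have -> : A = [set: T] `&` (fun w => `|S k w|) @^-1` `[l, +oo[%classic.
    by apply/seteqP; split => w /=; rewrite in_itv/= andbT// => -[].
  apply: measurableT_comp => //; exact: mS.
split=> //.
have PA : P A = (\int[P]_w (\1_A w))%:E.
  rewrite /Rintegral; under eq_integral do rewrite -/((EFin \o \1_A) _).
  by rewrite integral_indic// setIT fineK// fin_num_measure.
rewrite PA lee_fin ler_pdivlMr ?exprn_gt0//.
apply: le_trans (Rintegral_sqr_sum_uncorrelated k).
have iA : P.-integrable setT (EFin \o (\1_A : T -> R)).
  apply: (finite_bounded_integrable P (K := 1)) => // w.
  by rewrite indicE; case: (_ \in _); rewrite ?normr1 ?normr0.
rewrite mulrC -(RintegralZl _ measurableT iA); apply: le_Rintegral => //.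
- exact: integrableZl_EFin.
- exact: iS2.
- move=> w _; rewrite indicE; case: (boolP (w \in A)) => [|_]; last by rewrite mulr0 sqr_ge0.
  rewrite inE /A /= mulr1 => lS; rewrite -[leRHS]real_normK ?num_real//.
  by rewrite lerXn2r ?nnegrE// ltW.
Qed.

End Uncorrelated.

Section StepProcess.
Context d (T : measurableType d) (R : realType).

(* The supremum over the uncountably many [s] reduces to countably many
   conditions because the process only depends on [truncn (n s)]. *)
Lemma measurable_step_sup (Y : nat -> T -> R) (n : nat) (v t e : R) :
  (forall k, measurable_fun setT (Y k)) ->
  measurable [set w | (e%:E < ereal_sup
    [set `|Y (Num.truncn (n%:R * s)) w - v * s|%:E | s in `[0%R, t]%classic])%E].
Proof.
move=> mY.
pose I k := [set s : R | 0 <= s <= t /\ Num.truncn (n%:R * s) = k].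
pose O k := \bigcup_(s in I k) [set y : R | e < `|y - v * s|].
have oO k : open (O k).
  apply: bigcup_open => s _.
  have -> : [set y : R | e < `|y - v * s|] = (fun y => `|y - v * s|) @^-1` [set z : R | e < z].
    by [].
  apply: open_comp; last exact: open_gt.
  move=> y _; apply: (@lipschitz_continuous _ _ 1) => y1 y2.
  by rewrite mul1r (le_trans (ler_dist_dist _ _))// opprB addrA subrK.
have -> : [set w | (e%:E < ereal_sup
    [set `|Y (Num.truncn (n%:R * s)) w - v * s|%:E | s in `[0%R, t]%classic])%E] =
    \bigcup_k (Y k @^-1` O k).
  apply/seteqP; split => w /=.
    move=> /ereal_sup_gt [y [s + <-]]; rewrite /= in_itv/= lte_fin => st es.
    by exists (Num.truncn (n%:R * s)) => //; exists s.
  move=> [k _ [s [st sk] /= es]]; apply: (@lt_le_trans _ _ `|Y k w - v * s|%:E).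
    by rewrite lte_fin.
  by apply: ereal_sup_ubound; exists s; rewrite /= ?in_itv//= sk.
apply: bigcupT_measurable => k; rewrite -[X in measurable X]setTI.
by apply: mY => //; exact: open_measurable.
Qed.

End StepProcess.

Section GridBound.
Context {R : realType}.
Variables (g : nat -> R) (m m' l : R) (q : nat).
Hypothesis q0 : (0 < q)%N.
Hypothesis mm : `|m| <= m'.
Let S k := \sum_(0 <= i < k) (g i - m).
Let S' k := \sum_(0 <= i < k) (`|g i| - m').

(* Between grid points the sum of [g] is controlled by the increasing sum of [|g|]. *)
Lemma grid_bound (L k : nat) : (k < L * q)%N ->
  (forall j, (j <= L)%N -> `|S (j * q)| < l /\ `|S' (j * q)| < l) ->
  `|S k| < 3 * l + q%:R * (2 * m').
Proof.
move=> kL h; pose j := (k %/ q)%N.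
have jL : (j < L)%N by rewrite ltn_divLR.
have jk : (j * q <= k)%N by exact: leq_trunc_div.
have kj : (k <= j.+1 * q)%N by rewrite ltnW// ltn_ceil.
have [h1 h2] := h j (ltnW jL); have [_ h3] := h j.+1 jL.
have m'0 : 0 <= m' by rewrite (le_trans (normr_ge0 m)).
have E : S k = S (j * q) + \sum_(j * q <= i < k) (g i - m).
  by rewrite /S (@big_cat_nat _ _ _ (j * q)%N).
have E' : S' (j.+1 * q)%N = S' (j * q)%N + \sum_(j * q <= i < j.+1 * q) (`|g i| - m').
  by rewrite /S' (@big_cat_nat _ _ _ (j * q)%N)//= leq_mul2r leqnSn orbT.
have B1 : `|\sum_(j * q <= i < k) (g i - m)| <= \sum_(j * q <= i < j.+1 * q) (`|g i| + m').
  rewrite (le_trans (ler_norm_sum _ _ _))//.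
  apply: (@le_trans _ _ (\sum_(j * q <= i < k) (`|g i| + m'))).
    by apply: ler_sum => i _; rewrite (le_trans (ler_normB _ _))// lerD.
  rewrite [leRHS](@big_cat_nat _ _ _ k)//= lerDl sumr_ge0// => i _.
  by rewrite addr_ge0.
have B2 : \sum_(j * q <= i < j.+1 * q) (`|g i| + m') =
    \sum_(j * q <= i < j.+1 * q) (`|g i| - m') + q%:R * (2 * m').
  have -> : q%:R * (2 * m') = \sum_(j * q <= i < j.+1 * q) (2 * m').
    by rewrite big_const_nat iter_addr_0 mulSn addnK mulr_natl.
  by rewrite -big_split/=; apply: eq_bigr => i _; ring.
move: h1 h2 h3 B1; rewrite B2 E E'.
move: (S _) (S' _) (\sum_(_ <= i < k) _) (\sum_(_ <= i < _) _) (q%:R * _) => x x' y y' z.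
rewrite !ltr_norml !ler_norml => /andP[a1 a2] /andP[a3 a4] /andP[a5 a6] /andP[a7 a8].
by apply/andP; split; lra.
Qed.

End GridBound.

Section LawOfLargeNumbers.
Context d (T : measurableType d) (R : realType) (P : probability T R).
Variables (g : nat -> nat -> T -> R) (a K m m' s : nat -> R) (v B : R).
Hypothesis mg : forall n i, measurable_fun setT (g n i).
Hypothesis gK : forall n i w, `|g n i w| <= K n.
Hypothesis gm : forall n i, \int[P]_w g n i w = m n.
Hypothesis gm' : forall n i, \int[P]_w `|g n i w| = m' n.
Hypothesis gg : forall n i j, i != j -> \int[P]_w (g n i w * g n j w) = m n ^+ 2.
Hypothesis gg' : forall n i j, i != j -> \int[P]_w (`|g n i w| * `|g n j w|) = m' n ^+ 2.
Hypothesis gs : forall n i, \int[P]_w (g n i w ^+ 2) <= s n.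
Hypothesis a0 : forall n, 0 < a n.
Hypothesis mv : m n / a n @[n --> \oo] --> v.
Hypothesis mB : forall n, m' n <= B * a n.
Hypothesis sc : s n / (n%:R * a n ^+ 2) @[n --> \oo] --> 0.

Lemma centered_chebyshev (h : nat -> T -> R) (k : nat) (Kh mh sh l : R) :
  (forall i, measurable_fun setT (h i)) -> (forall i w, `|h i w| <= Kh) ->
  (forall i, \int[P]_w h i w = mh) ->
  (forall i j, i != j -> \int[P]_w (h i w * h j w) = mh ^+ 2) ->
  (forall i, \int[P]_w (h i w ^+ 2) <= sh) -> 0 < l ->
  measurable [set w | l <= `|\sum_(0 <= i < k) (h i w - mh)| ] /\
  (P [set w | (l <= `|\sum_(0 <= i < k) (h i w - mh)|)%R] <= (k%:R * sh / l ^+ 2)%:E)%E.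
Proof.
move=> mh_ hK hm hh hs l0.
have hi i : P.-integrable setT (EFin \o h i) by exact: (finite_bounded_integrable P (mh_ i) (hK i)).
have hhi i j : P.-integrable setT (EFin \o (fun w => h i w * h j w)).
  apply: (finite_bounded_integrable P (K := Kh * Kh)); first exact: measurable_funM.
  by move=> w; rewrite normrM ler_pM.
have ci (c : R) : P.-integrable setT (EFin \o (fun _ : T => c)) by exact: finite_measure_integrable_cst.
have prodE i j : \int[P]_w ((h i w - mh) * (h j w - mh)) = \int[P]_w (h i w * h j w) - mh ^+ 2.
  have i1 := integrableB_EFin (hhi i j) (integrableZl_EFin mh (hi i)).
  have i2 := integrableB_EFin i1 (integrableZl_EFin mh (hi j)).
  transitivity (\int[P]_w (h i w * h j w - mh * h i w - mh * h j w + mh ^+ 2)).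
    by apply: eq_Rintegral => w _; ring.
  rewrite (RintegralD measurableT i2 (ci _)).
  rewrite (RintegralB measurableT i1 (integrableZl_EFin mh (hi j))).
  rewrite (RintegralB measurableT (hhi i j) (integrableZl_EFin mh (hi i))).
  rewrite !(RintegralZl _ measurableT (hi _)) !hm (Rintegral_probability_cst P); ring.
apply: (@chebyshev_uncorrelated _ _ _ P (fun i w => h i w - mh) (Kh + `|mh|)) => //.
- by move=> i; exact: measurable_funB.
- by move=> i w; rewrite (le_trans (ler_normB _ _))// lerD.
- by move=> i j ij; rewrite prodE hh// subrr.
- move=> i; apply: le_trans (hs i).
  have : \int[P]_w (h i w * h i w) - mh ^+ 2 <= \int[P]_w (h i w * h i w).
    by rewrite gerBl sqr_ge0.
  by rewrite -prodE.
Qed.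

(** Chebyshev's inequality at the grid points gives probabilities of order s / (n a^2), and their
    number is fixed by e and t. Only pairwise decorrelation is used, for g and for |g|. *)
Lemma cvg_ucp_uncorrelated :
  cvg_ucp P (fun n t w => (n%:R * a n)^-1 * \sum_(0 <= i < Num.truncn (n%:R * t)) g n i w)
            (fun t _ => v * t).
Proof.
move=> t t0 e e0.
have m'0 n : 0 <= m' n by rewrite -(gm' n 0%N); apply: Rintegral_ge0 => w _.
have mm' n : `|m n| <= m' n.
  rewrite -(gm n 0%N) -(gm' n 0%N); apply: le_normr_Rintegral => //.
  exact: (finite_bounded_integrable P (mg n 0%N) (gK n 0%N)).
have B0 : 0 <= B.
  by have := le_trans (m'0 0%N) (mB 0%N); rewrite pmulr_lge0.
have s0 n : 0 <= s n by apply: le_trans (gs n 0%N); apply: Rintegral_ge0 => w _; exact: sqr_ge0.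
pose A n := [set w | (e%:E < ereal_sup [set `|(n%:R * a n)^-1 *
  (\sum_(0 <= i < Num.truncn (n%:R * s)) g n i w) - v * s|%:E | s in `[0%R, t]%classic])%E].
have mA n : measurable (A n).
  apply: (@measurable_step_sup _ T R (fun k w => (n%:R * a n)^-1 * \sum_(0 <= i < k) g n i w)).
  by move=> k; apply: measurable_funM => //; exact: measurable_sum.
rewrite -/(A _).
(* The mesh contributes about 2 B t / L to the normalised sum; L makes this at most e/8. *)
pose L := (Num.truncn (16 * B * t / e)).+1.
have L0 : 0 < L%:R :> R by rewrite ltr0n.
have hL : 2 * B * t / L%:R <= e / 8.
  rewrite ler_pdivrMr//; have := truncnS_gt (16 * B * t / e); rewrite -/L.
  by rewrite ltr_pdivrMr// => /ltW; lra.
(* The successor keeps [q n] positive and makes L * [q n] exceed the number of terms up to time t,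
   so the grid covers [0, t]. *)
pose q n := ((Num.truncn (n%:R * t)) %/ L).+1.
(* The total error is six eighths of e: three from the grid values, one from the mesh, one from the
   convergence of the means, one from the roundings of order 1/n. *)
pose l n := n%:R * a n * (e / 8).
pose S n k w := \sum_(0 <= i < k) (g n i w - m n).
pose S' n k w := \sum_(0 <= i < k) (`|g n i w| - m' n).
pose Bad n j := [set w | l n <= `|S n (j * q n)%N w|] `|` [set w | l n <= `|S' n (j * q n)%N w|].
pose C := 2 * L.+1%:R * L.+1%:R * (t + 1) * 64 / e ^+ 2.
have e2 : 0 < e ^+ 2 by rewrite exprn_gt0.
have qn n : (0 < n)%N -> (q n)%:R <= n%:R * (t / L%:R) + 1 :> R.
  move=> n0; rewrite /q -natr1 lerD2r mulrA ler_pdivlMr// -natrM.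
  apply: (@le_trans _ _ (Num.truncn (n%:R * t))%:R); first by rewrite ler_nat leq_trunc_div.
  by rewrite truncn_le mulr_ge0// ltW.
have PBad n j : (0 < n)%N -> (j <= L)%N -> measurable (Bad n j) /\
    (P (Bad n j) <= (2 * (L.+1%:R * (t + 1)) * 64 / e ^+ 2 * (s n / (n%:R * a n ^+ 2)))%:E)%E.
  move=> n0 jL; have nR : 0 < n%:R :> R by rewrite ltr0n.
  have l0 : 0 < l n by rewrite mulr_gt0 ?mulr_gt0 ?divr_gt0.
  have [m1 p1] := @centered_chebyshev (g n) (j * q n) (K n) (m n) (s n) (l n)
    (mg n) (gK n) (gm n) (@gg n) (gs n) l0.
  have mg' i : measurable_fun setT (fun w => `|g n i w|).
    by apply: measurableT_comp => //; exact: mg.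
  have gK' i w : `| `|g n i w| | <= K n by rewrite normr_id.
  have gs' i : \int[P]_w (`|g n i w| ^+ 2) <= s n.
    by under eq_Rintegral do rewrite real_normK ?num_real//.
  have [m2 p2] := @centered_chebyshev (fun i w => `|g n i w|) (j * q n) (K n) (m' n) (s n) (l n)
    mg' gK' (gm' n) (@gg' n) gs' l0.
  split; first exact: measurableU.
  apply: (le_trans (measureU2 _ m1 m2)); apply: (le_trans (leeD p1 p2)); rewrite -EFinD lee_fin.
  have jq : (j * q n)%:R <= n%:R * (L.+1%:R * (t + 1)) :> R.
    rewrite natrM mulrCA; apply: ler_pM => //; first by rewrite ler_nat (leq_trans jL).
    apply: (le_trans (qn n n0)); rewrite mulrDr mulr1 lerD//.
      by rewrite ler_pM2l// ler_pdivrMr// ler_peMr ?(ltW t0)// ler1n.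
    by rewrite ler1n.
  rewrite -mulr2n -[leLHS]mulr_natl; apply: (@le_trans _ _ (2 * (n%:R * (L.+1%:R * (t + 1)) * s n / l n ^+ 2))).
    rewrite ler_wpM2l// ler_wpM2r ?invr_ge0 ?sqr_ge0// ler_wpM2r//.
  rewrite le_eqVlt /l; apply/orP; left; apply/eqP; field.
  by rewrite !gt_eqF.
apply: (@squeeze_cvge _ _ _ _ (fun=> 0%E) _ (fun n => (C * (s n / (n%:R * a n ^+ 2)))%:E)); last 2 first.
- exact: cvg_cst.
- apply: cvg_EFin; first by near=> n.
  rewrite -[X in _ --> X](mulr0 C); apply: cvgM => //; exact: cvg_cst.
have cv1 : \forall n \near \oo, t * `|m n / a n - v| <= e / 8.
  have e8 : 0 < e / 8 / t by rewrite !divr_gt0.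
  move/cvgrPdist_le : mv => /(_ _ e8); apply: filterS => n; rewrite distrC => h.
  by have := ler_wpM2l (ltW t0) h; rewrite mulrCA mulfV ?gt_eqF// mulr1.
have cv2 : \forall n \near \oo, (0 < n)%N /\ (2 * B + `|v|) / n%:R <= e / 8.
  exists (Num.truncn ((2 * B + `|v|) / (e / 8))).+1 => // n /= nN.
  have n0 : (0 < n)%N by apply: leq_trans nN.
  split=> //; rewrite ler_pdivrMr ?ltr0n// [leRHS]mulrC -(@ler_pdivrMr _ (e / 8)) ?divr_gt0//.
  by rewrite ltW// (lt_le_trans (truncnS_gt _))// ler_nat.
move: cv1 cv2; apply: filterS2 => n h1 [n0 h2]; rewrite measure_ge0/=.
have nR : 0 < n%:R :> R by rewrite ltr0n.
have an := a0 n; have N0 : 0 < n%:R * a n by rewrite mulr_gt0.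
have AB : A n `<=` \big[setU/set0]_(j < L.+1) Bad n j.
  move=> w Aw; apply: contrapT => nB.
  have good j : (j <= L)%N -> `|S n (j * q n)%N w| < l n /\ `|S' n (j * q n)%N w| < l n.
    move=> jL; apply: contrapT => bad; apply: nB; rewrite -bigcup_mkord.
    exists j => //=; have [c1|c1] := ltP `|S n (j * q n)%N w| (l n); last by left.
    have [c2|c2] := ltP `|S' n (j * q n)%N w| (l n); last by right.
    by exfalso; apply: bad.
  move: Aw => /ereal_sup_gt [y [u + <-]]; rewrite /= in_itv/= => /andP[u0 ut].
  rewrite lte_fin; apply/negP; rewrite -leNgt.
  set k := Num.truncn _.
  have nu0 : 0 <= n%:R * u by rewrite mulr_ge0.
  have /andP[k1 k2] := truncn_itv nu0; rewrite -/k in k1 k2.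
  have kL : (k < L * q n)%N.
    have : (k <= Num.truncn (n%:R * t))%N by rewrite le_truncn// ler_wpM2l// ltW.
    by move=> /leq_ltn_trans; apply; rewrite mulnC ltn_ceil.
  have Sk := @grid_bound R (fun i => g n i w) (m n) (m' n) (l n) (q n) isT (mm' n) L k kL good.
  have SE : S n k w = \sum_(0 <= i < k) g n i w - k%:R * m n.
    by rewrite /S big_split/= sumrN big_const_nat iter_addr_0 subn0 mulr_natl.
  rewrite (_ : _ - v * u = (n%:R * a n)^-1 * S n k w +
     (k%:R / n%:R * (m n / a n - v) + v * (k%:R / n%:R - u))); last first.
    by rewrite SE; field; rewrite !gt_eqF.
  have p1 : (n%:R * a n)^-1 * `|S n k w| <= 3 * (e / 8) + (e / 8 + 2 * B / n%:R).
    rewrite ler_pdivrMl//; apply: (le_trans (ltW Sk)); rewrite mulrDr; apply: lerD.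
      by rewrite /l; lra.
    have qb : (q n)%:R * (2 * m' n) <= (n%:R * (t / L%:R) + 1) * (2 * (B * a n)).
      by apply: ler_pM => //; [rewrite mulr_ge0|exact: qn|rewrite ler_wpM2l].
    apply: (le_trans qb).
    have -> : (n%:R * (t / L%:R) + 1) * (2 * (B * a n)) = n%:R * a n * (2 * B * t / L%:R + 2 * B / n%:R).
      by field; rewrite !gt_eqF.
    by rewrite ler_pM2l// lerD2r.
  have p2 : `|k%:R / n%:R * (m n / a n - v)| <= e / 8.
    rewrite normrM ger0_norm ?divr_ge0//; apply: le_trans h1; rewrite ler_wpM2r//.
    by rewrite ler_pdivrMr// mulrC (le_trans k1)// ler_pM2l.
  have p3 : `|v * (k%:R / n%:R - u)| <= `|v| / n%:R.
    rewrite normrM ler_wpM2l// -[k%:R / _ - u](_ : (k%:R - n%:R * u) / n%:R = _); last first.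
      by field; rewrite gt_eqF.
    rewrite normrM [ `|_^-1| ]gtr0_norm ?invr_gt0// ler_piMl ?invr_ge0 ?(ltW nR)//.
    by rewrite ler_norml; move: k2; rewrite -natr1 => k2; apply/andP; split; lra.
  rewrite (le_trans (ler_normD _ _))//.
  apply: (le_trans (lerD (lexx _) (ler_normD _ _))).
  rewrite normrM gtr0_norm ?invr_gt0//.
  have h3 : 2 * B / n%:R + `|v| / n%:R <= e / 8 by rewrite -mulrDl.
  move: p1 p2 p3 h3.
  move: (_^-1 * _) `|_ * (_ - v)| `|v * _| (2 * B / _) (`|v| / _) => x1 x2 x3 x4 x5; lra.
have mB' j : (j < L.+1)%N -> measurable (Bad n j) by move=> jL; exact: (PBad n j n0 jL).1.
apply: (@le_trans _ _ (P (\big[setU/set0]_(j < L.+1) Bad n j))).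
  apply: le_measure; rewrite ?inE//.
    exact: mA.
  by apply: bigsetU_measurable => j _; exact: (mB' j (ltn_ord j)).
apply: (le_trans (Boole_inequality _ mB')).
apply: (@le_trans _ _ (\sum_(j < L.+1) (2 * (L.+1%:R * (t + 1)) * 64 / e ^+ 2 * (s n / (n%:R * a n ^+ 2)))%:E)%E).
  by apply: lee_sum => j _; exact: (PBad n j n0 (ltn_ord j)).2.
rewrite sumEFin lee_fin sumr_const card_ord -mulr_natl /C le_eqVlt; apply/orP; left; apply/eqP.
by ring.
Unshelve. all: by end_near. Qed.

End LawOfLargeNumbers.

(** * Moments of the increments of the process *)

Section IndependentPair.
Context d (T : measurableType d) (R : realType) (P : probability T R).
Local Notation RM := (measurableTypeR R).
Variables (Y1 Y2 : T -> RM).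
Hypotheses (mY1 : measurable_fun setT Y1) (mY2 : measurable_fun setT Y2).
Hypothesis indep : forall A B : set RM, measurable A -> measurable B ->
  P (Y1 @^-1` A `&` Y2 @^-1` B) = (P (Y1 @^-1` A) * P (Y2 @^-1` B))%E.

Lemma Rintegral_indep_prod (f h : RM -> R) (K : R) :
  measurable_fun setT f -> measurable_fun setT h ->
  (forall x, `|f x| <= K) -> (forall x, `|h x| <= K) ->
  \int[P]_w (f (Y1 w) * h (Y2 w)) = (\int[P]_w f (Y1 w)) * \int[P]_w h (Y2 w).
Proof.
move=> mf mh fK hK.
have mY : measurable_fun setT (fun w => (Y1 w, Y2 w)) by exact: measurable_fun_pair.
pose fh (z : RM * RM) := f z.1 * h z.2.
have mfh : measurable_fun setT fh by apply: measurable_funM; exact: measurableT_comp.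
have fhK z : `|fh z| <= K * K by rewrite normrM ler_pM.
pose L1 := law P mY1; pose L2 := law P mY2; pose L := law P mY.
have LE (A : set (RM * RM)) : measurable A -> (L1 \x L2)%E A = L A.
  by move=> mA; apply: (product_measure_unique (m' := L)) => // A1 A2 mA1 mA2; exact: indep.
have fhi : (L1 \x L2)%E.-integrable setT (EFin \o fh).
  apply: (bounded_integrable (K := K * K)) => //.
  have : (L setT < +oo)%E by exact: finite_measure_lty.
  by have <- := LE setT measurableT.
have fi (Q : probability RM R) : Q.-integrable setT (EFin \o f) by exact: (finite_bounded_integrable Q mf fK).
have hi (Q : probability RM R) : Q.-integrable setT (EFin \o h) by exact: (finite_bounded_integrable Q mh hK).
transitivity (\int[L]_z fh z); first by rewrite (Rintegral_law _ mY mfh fhK).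
transitivity (\int[(L1 \x L2)%E]_z fh z).
  by rewrite /Rintegral; congr fine; apply/esym/eq_measure_integral => A mA _; exact: LE.
rewrite -(Rintegral_law P mY1 mf fK) -(Rintegral_law P mY2 mh hK) -/L1 -/L2.
transitivity (\int[L1]_x (\int[L2]_y h y * f x)); last by rewrite (RintegralZl _ measurableT (fi L1)) mulrC.
rewrite {1}/Rintegral -(integral12_prod_meas1 fhi) {1}/Rintegral; congr fine.
apply: eq_integral => x _; rewrite /fubini_F /fh/=.
rewrite mulrC -(RintegralZl _ measurableT (hi L2)) /Rintegral fineK//.
exact: (integrable_fin_num measurableT (integrableZl_EFin (f x) (hi L2))).
Qed.

End IndependentPair.

Section Increments.
Context d (T : measurableType d) (R : realType) (P : probability T R).
Local Notation RM := (measurableTypeR R).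
Variables (X : R -> {RV P >-> R}) (D : R).
Hypothesis levyX : is_levy_process X.
Hypothesis D0 : 0 < D.

Lemma measurable_marginal (t : R) : measurable_fun setT (X t : T -> RM).
Proof. exact: (@measurable_funPT _ _ _ _ (X t)). Qed.

Lemma measurable_increment i : measurable_fun setT (increment X D i : T -> RM).
Proof. by apply: measurable_funB; exact: measurable_marginal. Qed.

Lemma increment_law i (B : set RM) : measurable B ->
  P (increment X D i.+1 @^-1` B) = P (X D @^-1` B).
Proof.
move=> mB; rewrite -(levy_stationary_increments levyX (s := i%:R * D) (t := D)) ?mulr_ge0 ?ler0n ?(ltW D0)//.
by congr (P _); rewrite /increment /= -natr1 mulrDl mul1r.
Qed.

Lemma Rintegral_increment i (f : RM -> R) (K : R) : measurable_fun setT f ->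
  (forall x, `|f x| <= K) ->
  \int[P]_w f (increment X D i.+1 w) = \int[law P (measurable_marginal D)]_x f x.
Proof.
move=> mf fK; rewrite -(Rintegral_law P (measurable_increment i.+1) mf fK).
rewrite /Rintegral; congr fine; apply: eq_measure_integral => A mA _.
exact: increment_law.
Qed.

Lemma increment_indep i j (A B : set RM) : (i < j)%N -> measurable A -> measurable B ->
  P (increment X D i.+1 @^-1` A `&` increment X D j.+1 @^-1` B) =
  (P (increment X D i.+1 @^-1` A) * P (increment X D j.+1 @^-1` B))%E.
Proof.
move=> ij mA mB; pose t (k : nat) : R := k%:R * D.
have t0 : 0 <= t 0%N by rewrite /t mul0r.
have tm : {homo t : i j / (i <= j)%N >-> i <= j}.
  by move=> p q pq; rewrite /t ler_wpM2r ?ler_nat// ltW.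
have := levy_independent_increments levyX (n := j.+1) t0 tm.
(* Pairwise independence is extracted from mutual independence by imposing the trivial set on all
   the other increments. *)
pose C (k : 'I_j.+1) : set RM := if k == i :> nat then A else if k == j :> nat then B else setT.
have mC k : measurable (C k) by rewrite /C; case: ifP => // _; case: ifP.
have ij' : (i < j.+1)%N by rewrite ltnS ltnW.
have incE k : (X (t k.+1) \- X (t k) : T -> R) = increment X D k.+1 by [].
move=> /(_ C mC); rewrite (_ : \bigcap_(k in _) _ = increment X D i.+1 @^-1` A `&` increment X D j.+1 @^-1` B); last first.
  apply/seteqP; split => [w hw|w [wA wB] k _].
    split; first by have := hw (Ordinal ij') Logic.I; rewrite /C /= eqxx.
    by have := hw ord_max Logic.I; rewrite /C /= eqxx gtn_eqF.
  rewrite /C; case: eqP => [ki|_]; first by rewrite /preimage /= ki.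
  by case: eqP => [kj|_//]; rewrite /preimage /= kj.
move=> ->; rewrite (bigD1 (Ordinal ij'))//= (bigD1 ord_max)/=; last by rewrite -val_eqE/= gtn_eqF.
rewrite big1 ?mule1 => [|k /andP[k1 k2]].
  by rewrite /C /= !eqxx gtn_eqF.
rewrite /C -!val_eqE /= in k1 k2 *; rewrite (negbTE k1) (negbTE k2).
by rewrite preimage_setT probability_setT.
Qed.

Lemma Rintegral_increment_prod i j (f : RM -> R) (K : R) : i != j ->
  measurable_fun setT f -> (forall x, `|f x| <= K) ->
  \int[P]_w (f (increment X D i.+1 w) * f (increment X D j.+1 w)) =
  (\int[law P (measurable_marginal D)]_x f x) ^+ 2.
Proof.
move=> + mf fK; wlog ij : i j / (i < j)%N => [hw|_].
  rewrite neq_ltn => /orP[ij|ij]; first by apply: hw => //; rewrite ltn_eqF.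
  by under eq_Rintegral do rewrite mulrC; apply: hw => //; rewrite ltn_eqF.
rewrite (Rintegral_indep_prod (measurable_increment i.+1) (measurable_increment j.+1) _ mf mf fK fK).
  by rewrite !(Rintegral_increment _ mf fK).
by move=> A B mA mB; exact: increment_indep.
Qed.

End Increments.

(** * Marginal laws and part (i) *)

Section LevyMarginals.
Context d (T : measurableType d) (R : realType) (P : probability T R).
Local Notation RM := (measurableTypeR R).
Variables (X : R -> {RV P >-> R}) (b c : R) (F : {measure set RM -> \bar R}).

Definition marginal (t : R) : probability RM R := law P (measurable_marginal X t).

Hypothesis charX : has_characteristics X b c F.

Lemma levy_exponentE u : levy_exponent b c F u =
  (- exponent_re c F u +i* exponent_im b F u)%C.
Proof.
have Fint := characteristics_Fint charX.
rewrite /levy_exponent /cintegral /exponent_re /exponent_im.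
have -> : \int[F]_x complex.Re (cexp ('i%C * (u * x)%:C%C) - 1 -
    'i%C * (u * x * \1_[set y : R | `|y| <= 1] x)%:C%C) = - \int[F]_x (1 - cos (u * x)).
  rewrite -[RHS]mulN1r -(RintegralZl _ measurableT (integrable_one_sub_cos Fint u)).
  apply: eq_Rintegral => x _ /=.
  rewrite !(mul0r, mul1r, mulr0, subr0, addr0, add0r, sub0r, oppr0, expR0); ring.
have -> : \int[F]_x complex.Im (cexp ('i%C * (u * x)%:C%C) - 1 -
    'i%C * (u * x * \1_[set y : R | `|y| <= 1] x)%:C%C) =
    \int[F]_x (sin (u * x) - u * x * \1_[set y : R | `|y| <= 1] x).
  apply: eq_Rintegral => x _ /=.
  by rewrite !(mul0r, mul1r, mulr0, subr0, addr0, add0r, sub0r, oppr0, expR0).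
by apply/eqP; rewrite eq_complex /=; apply/andP; split; apply/eqP; ring.
Qed.

Lemma marginal_cos t u a : 0 <= t -> \int[marginal t]_x cos (u * x - a) =
  expR (- (t * exponent_re c F u)) * cos (t * exponent_im b F u - a).
Proof.
move=> t0; have mX := measurable_marginal X t.
rewrite (Rintegral_law P (measurable_marginal X t) (measurable_cos_affine u a) (norm_cos_affine u a)).
have := characteristics_charfun charX u t0; rewrite levy_exponentE /cintegral.
have -> : \int[P]_w complex.Re (cexp ('i%C * (u * X t w)%:C%C)) = \int[P]_w cos (u * X t w).
  apply: eq_Rintegral => w _ /=.
  by rewrite !mul0r !mul1r subr0 add0r expR0 mul1r.
have -> : \int[P]_w complex.Im (cexp ('i%C * (u * X t w)%:C%C)) = \int[P]_w sin (u * X t w).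
  apply: eq_Rintegral => w _ /=.
  by rewrite !mul0r !mul1r subr0 add0r expR0 mul1r.
move=> /eqP; rewrite eq_complex /= => /andP[/eqP hre /eqP him].
have mc : measurable_fun setT (fun w => cos (u * X t w)) by exact: (measurableT_comp (measurable_cosM u) mX).
have ms : measurable_fun setT (fun w => sin (u * X t w)) by exact: (measurableT_comp (measurable_sinM u) mX).
have ci : P.-integrable setT (EFin \o (fun w => cos (u * X t w))).
  by apply: (finite_bounded_integrable P mc (K := 1)) => w; rewrite ler_norml cos_geN1 cos_le1.
have si : P.-integrable setT (EFin \o (fun w => sin (u * X t w))).
  by apply: (finite_bounded_integrable P ms (K := 1)) => w; exact: sin_max.
transitivity (cos a * \int[P]_w cos (u * X t w) + sin a * \int[P]_w sin (u * X t w)).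
  rewrite -(RintegralZl _ measurableT ci) -(RintegralZl _ measurableT si).
  rewrite -(RintegralD measurableT (integrableZl_EFin _ ci) (integrableZl_EFin _ si)).
  by apply: eq_Rintegral => w _; rewrite cosB; ring.
rewrite hre him !mul0r subr0 addr0 mulrN cosB; ring.
Qed.

End LevyMarginals.

Section LevyLaw.
Context d (T : measurableType d) (R : realType) (P : probability T R).
Local Notation RM := (measurableTypeR R).
Variables (X : R -> {RV P >-> R}) (D : nat -> R).
Hypothesis levyX : is_levy_process X.
Hypothesis D0 : forall n, 0 < D n.

Lemma levy_ucp (f : nat -> R -> R) (a : nat -> R) (K v B : R) :
  (forall n, measurable_fun setT (f n)) -> (forall n x, `|f n x| <= K) ->
  (forall n, 0 < a n) ->
  (\int[marginal X (D n)]_x f n x) / a n @[n --> \oo] --> v ->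
  (forall n, \int[marginal X (D n)]_x `|f n x| <= B * a n) ->
  (\int[marginal X (D n)]_x (f n x ^+ 2)) / (n%:R * a n ^+ 2) @[n --> \oo] --> 0 ->
  cvg_ucp P (fun n t w => (n%:R * a n)^-1 *
    \sum_(1 <= i < (Num.truncn (n%:R * t)).+1) f n (increment X (D n) i w))
   (fun t _ => v * t).
Proof.
move=> mf fK a0 fv fB fs.
have mf' n : measurable_fun setT (fun x => `|f n x|) by exact: measurableT_comp.
have fK' n x : `| `|f n x| | <= K by rewrite normr_id.
have mf2 n : measurable_fun setT (fun x => f n x ^+ 2) by exact: measurable_funX.
have fK2 n x : `|f n x ^+ 2| <= K ^+ 2.
  by rewrite normrX lerXn2r ?nnegrE// (le_trans _ (fK n x)).
rewrite (_ : (fun n t w => _) = (fun n t w => (n%:R * a n)^-1 *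
    \sum_(0 <= i < Num.truncn (n%:R * t)) f n (increment X (D n) i.+1 w))); last first.
  by apply/funext => n; apply/funext => t; apply/funext => w; rewrite big_add1.
apply: (@cvg_ucp_uncorrelated _ _ _ P (fun n i w => f n (increment X (D n) i.+1 w)) a (fun=> K)
  (fun n => \int[marginal X (D n)]_x f n x) (fun n => \int[marginal X (D n)]_x `|f n x|)
  (fun n => \int[marginal X (D n)]_x (f n x ^+ 2)) v B _ _ _ _ _ _ _ a0 fv fB fs) => n i.
- exact: (measurableT_comp (mf n) (measurable_increment X (D n) i.+1)).
- by move=> w; exact: fK.
- exact: (Rintegral_increment levyX (D0 n) i (mf n) (fK n)).
- exact: (Rintegral_increment levyX (D0 n) i (mf' n) (fK' n)).
- by move=> j ij; exact: (Rintegral_increment_prod levyX (D0 n) ij (mf n) (fK n)).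
- by move=> j ij; exact: (Rintegral_increment_prod levyX (D0 n) ij (mf' n) (fK' n)).
- rewrite le_eqVlt; apply/orP; left; apply/eqP.
  exact: (Rintegral_increment levyX (D0 n) i (mf2 n) (fK2 n)).
Qed.

End LevyLaw.

Section LevyBounded.
Context d (T : measurableType d) (R : realType) (P : probability T R).
Local Notation RM := (measurableTypeR R).
Variables (X : R -> {RV P >-> R}) (D : nat -> R).
Hypothesis levyX : is_levy_process X.
Hypothesis D0 : forall n, 0 < D n.

(** For bounded f one has f^2 <= K |f|, so second moments are of order a_n and the variance term is
    of order 1 / (n a_n). *)
Lemma levy_ucp_bounded (f : R -> R) (a : nat -> R) (K v v' : R) :
  measurable_fun setT f -> (forall x, `|f x| <= K) ->
  (forall n, 0 < a n) -> n%:R * a n @[n --> \oo] --> +oo ->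
  (a n)^-1 * \int[marginal X (D n)]_x f x @[n --> \oo] --> v ->
  (a n)^-1 * \int[marginal X (D n)]_x `|f x| @[n --> \oo] --> v' ->
  cvg_ucp P (fun n t w => (n%:R * a n)^-1 * Vbar X D f n t w) (fun t _ => v * t).
Proof.
move=> mf fK a0 na fv fv'.
have mf' : measurable_fun setT (fun x => `|f x|) by exact: measurableT_comp.
have K0 : 0 <= K by apply: le_trans (fK 0).
have i1 n : (marginal X (D n)).-integrable setT (EFin \o (fun x => `|f x|)).
  by apply: (finite_bounded_integrable (marginal X (D n)) (K := K)) => // x; rewrite normr_id.
have [B hB] := cvg_seq_ubound fv'.
have hB' n : \int[marginal X (D n)]_x `|f x| <= B * a n.
  by have := le_trans (ler_norm _) (hB n); rewrite ler_pdivrMl// mulrC.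
apply: (levy_ucp levyX D0 (f := fun=> f) (K := K) (B := B)) => //.
  by under eq_fun do rewrite mulrC.
have ia : (n%:R * a n)^-1 @[n --> \oo] --> 0.
  apply/gtr0_cvgV0; last exact: na.
  by exists 1%N => // n /= n0; rewrite mulr_gt0// ltr0n.
apply: (@squeeze_cvgr _ _ _ _ (fun=> 0) (fun n => (K * B) * (n%:R * a n)^-1)); last 2 first.
- exact: cvg_cst.
- by rewrite -[X in _ --> X](mulr0 (K * B)); apply: cvgM => //; exact: cvg_cst.
exists 1%N => // n /= n0; have nR : 0 < n%:R :> R by rewrite ltr0n.
have an := a0 n; have na0 : 0 < n%:R * a n ^+ 2 by rewrite mulr_gt0// exprn_gt0.
rewrite divr_ge0 ?(ltW na0)//=; last by apply: Rintegral_ge0 => x _; exact: sqr_ge0.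
have h : \int[marginal X (D n)]_x (f x ^+ 2) <= K * \int[marginal X (D n)]_x `|f x|.
  rewrite -(RintegralZl _ measurableT (i1 n)); apply: (le_trans (ler_norm _)).
  apply: Rintegral_norm_le; first exact: measurable_funX.
    exact: (integrableZl_EFin K (i1 n)).
  by move=> x; rewrite normrX expr2 ler_wpM2r.
rewrite ler_pdivrMr//; apply: (le_trans h); apply: (le_trans (ler_wpM2l K0 (hB' n))).
rewrite le_eqVlt; apply/orP; left; apply/eqP; field.
by rewrite !gt_eqF.
Qed.

Variables (b c : R) (F : {measure set RM -> \bar R}).
Hypothesis charX : has_characteristics X b c F.
Hypothesis Dc : D n @[n --> \oo] --> 0.
Hypothesis Dy : n%:R * D n @[n --> \oo] --> +oo.

Let muE n u a := marginal_cos charX u a (ltW (D0 n)).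
Let c_ge0 := characteristics_c_ge0 charX.
Let Fint := characteristics_Fint charX.

Lemma ae_continuous_norm (f : R -> R) : {ae F, forall x : R, {for x, continuous f}} ->
  {ae F, forall x : R, {for x, continuous (fun y => `|f y|)}}.
Proof. by apply: ae_imply => x cx; apply: cvg_norm; exact: cx. Qed.

Lemma levy_ucp_abs (f : R -> R) (K v v' : R) :
  measurable_fun setT f -> (forall x, `|f x| <= K) ->
  (D n)^-1 * \int[marginal X (D n)]_x f x @[n --> \oo] --> v ->
  (D n)^-1 * \int[marginal X (D n)]_x `|f x| @[n --> \oo] --> v' ->
  cvg_ucp P (fun n t w => (n%:R * D n)^-1 * Vbar X D f n t w) (fun t _ => v * t).
Proof. by move=> mf fK; apply: (levy_ucp_bounded mf fK D0 Dy). Qed.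

Lemma levy_ucp_quadratic (f : R -> R) (K l : R) :
  measurable_fun setT f -> (forall x, `|f x| <= K) -> 0 <= l ->
  {ae F, forall x : R, {for x, continuous f}} ->
  (forall e : R, 0 < e -> exists2 d : R, 0 < d &
     forall x : R, `|x| < d -> `|f x - l * x ^+ 2| <= e * x ^+ 2) ->
  cvg_ucp P (fun n t w => (n%:R * D n)^-1 * Vbar X D f n t w)
    (fun t _ => (\int[F]_x f x + c * l) * t).
Proof.
move=> mf fK l0 cf fl; rewrite addrC.
have mf' : measurable_fun setT (fun x => `|f x|) by exact: measurableT_comp.
have fK' x : `| `|f x| | <= K by rewrite normr_id.
apply: (levy_ucp_abs mf fK (v' := c * l + \int[F]_x `|f x|)).
  exact: (small_time_quadratic c_ge0 Fint D0 Dc muE mf fK fl cf).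
apply: (small_time_quadratic c_ge0 Fint D0 Dc muE mf' fK' _ (ae_continuous_norm cf)).
move=> e e0; have [d' d0 hd] := fl e e0; exists d' => // x xd.
have -> : l * x ^+ 2 = `|l * x ^+ 2| by rewrite ger0_norm// mulr_ge0// sqr_ge0.
exact: le_trans (ler_dist_dist _ _) (hd x xd).
Qed.

Let muE0 : c = 0 -> forall n u a, \int[marginal X (D n)]_x cos (u * x - a) =
  expR (- (D n * exponent_re 0 F u)) * cos (D n * exponent_im b F u - a).
Proof. by move=> c0 n u a; rewrite muE c0. Qed.

Lemma levy_ucp_bigO (f : R -> R) (K r A d' : R) :
  measurable_fun setT f -> (forall x, `|f x| <= K) ->
  {ae F, forall x : R, {for x, continuous f}} ->
  c = 0 -> 0 < r < 2 -> I_set F r -> 1 < r \/ bbar F b = 0 ->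
  0 < d' -> (forall x, `|x| < d' -> `|f x| <= A * `|x| `^ r) ->
  cvg_ucp P (fun n t w => (n%:R * D n)^-1 * Vbar X D f n t w)
    (fun t _ => (\int[F]_x f x) * t).
Proof.
move=> mf fK cf c0 r02 Ir rb d0 fA.
have mf' : measurable_fun setT (fun x => `|f x|) by exact: measurableT_comp.
have fK' x : `| `|f x| | <= K by rewrite normr_id.
have fA' x : `|x| < d' -> `| `|f x| | <= A * `|x| `^ r by rewrite normr_id; exact: fA.
apply: (levy_ucp_abs mf fK (v' := \int[F]_x `|f x|)).
  exact: (small_time_bigO Fint D0 Dc (muE0 c0) r02 Ir rb mf fK cf d0 fA).
exact: (small_time_bigO Fint D0 Dc (muE0 c0) r02 Ir rb mf' fK' (ae_continuous_norm cf) d0 fA').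
Qed.

Lemma levy_ucp_littleo1 (f : R -> R) (K : R) :
  measurable_fun setT f -> (forall x, `|f x| <= K) ->
  {ae F, forall x : R, {for x, continuous f}} -> c = 0 -> I_set F 1 ->
  (forall e : R, 0 < e -> exists2 d : R, 0 < d &
     forall x : R, `|x| < d -> `|f x| <= e * `|x|) ->
  cvg_ucp P (fun n t w => (n%:R * D n)^-1 * Vbar X D f n t w)
    (fun t _ => (\int[F]_x f x) * t).
Proof.
move=> mf fK cf c0 I1 fo.
have mf' : measurable_fun setT (fun x => `|f x|) by exact: measurableT_comp.
have fK' x : `| `|f x| | <= K by rewrite normr_id.
apply: (levy_ucp_abs mf fK (v' := \int[F]_x `|f x|)).
  exact: (small_time_littleo1 Fint D0 Dc (muE0 c0) I1 mf fK cf fo).2.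
apply: (small_time_littleo1 Fint D0 Dc (muE0 c0) I1 mf' fK' (ae_continuous_norm cf) _).2.
by move=> e e0; have [d' d0 hd] := fo e e0; exists d' => // x xd; rewrite normr_id hd.
Qed.

Lemma levy_ucp_equiv1 (f : R -> R) (K : R) :
  measurable_fun setT f -> (forall x, `|f x| <= K) ->
  {ae F, forall x : R, {for x, continuous f}} -> c = 0 -> I_set F 1 ->
  (forall e : R, 0 < e -> exists2 d : R, 0 < d &
     forall x : R, `|x| < d -> `|f x - `|x| | <= e * `|x|) ->
  cvg_ucp P (fun n t w => (n%:R * D n)^-1 * Vbar X D f n t w)
    (fun t _ => (\int[F]_x f x + `|bbar F b|) * t).
Proof.
move=> mf fK cf c0 I1 fe.
have mf' : measurable_fun setT (fun x => `|f x|) by exact: measurableT_comp.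
have fK' x : `| `|f x| | <= K by rewrite normr_id.
apply: (levy_ucp_abs mf fK (v' := \int[F]_x `|f x| + `|bbar F b|)).
  exact: (small_time_equiv1 Fint D0 Dc (muE0 c0) I1 mf fK cf fe).
apply: (small_time_equiv1 Fint D0 Dc (muE0 c0) I1 mf' fK' (ae_continuous_norm cf)).
move=> e e0; have [d' d0 hd] := fe e e0; exists d' => // x xd.
rewrite -[X in `|_ - X|]normr_id; exact: le_trans (ler_dist_dist _ _) (hd x xd).
Qed.

Lemma levy_limit_i :
  (forall f : R -> R, bounded_fun f ->
     [\/ (classE'' 2 `&` C0F F) f,
         (exists r : R, [/\ I_set F r, 1 < r < 2 & (classE' r `&` C0F F) f])
           /\ c = 0,
         [/\ (classE'' 1 `&` C0F F) f, I_set F 1 & c = 0] |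
         (exists r : R, [/\ I_set F r, 0 < r <= 1 & (classE' r `&` C0F F) f])
           /\ (c = 0 /\ bbar F b = 0)] ->
     cvg_ucp P (fun n t w => (n%:R * D n)^-1 * Vbar X D f n t w)
               (fun t _ => (\int[F]_x f x) * t))
  /\
  (forall f : R -> R, bounded_fun f -> (classE 2 `&` C0F F) f ->
     cvg_ucp P (fun n t w => (n%:R * D n)^-1 * Vbar X D f n t w)
               (fun t _ => (\int[F]_x f x + c) * t))
  /\
  (forall f : R -> R, bounded_fun f -> (classE 1 `&` C0F F) f ->
     c = 0 -> I_set F 1 ->
     cvg_ucp P (fun n t w => (n%:R * D n)^-1 * Vbar X D f n t w)
               (fun t _ => (\int[F]_x f x + `|bbar F b|) * t)).
Proof.
split; [|split].
- move=> f /bounded_fun_le [K fK]; case.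
  + move=> [fE cf]; have mf : measurable_fun setT f by case: fE.
    rewrite -[\int[F]_x f x]addr0 -(mulr0 c).
    apply: (levy_ucp_quadratic mf fK (lexx 0) cf) => e e0.
    have [d' d0 hd] := classE''_le fE e0; exists d' => // x xd.
    by rewrite mul0r subr0 -norm_powR2; exact: hd.
  + move=> [[r [Ir /andP[r1 r2] [fE cf]]] c0]; have mf : measurable_fun setT f by case: fE.
    have [A [d' [d0 hd]]] := classE'_le fE.
    apply: (levy_ucp_bigO mf fK cf c0 _ Ir _ d0 hd); last by left.
    by rewrite r2 andbT (lt_trans _ r1).
  + move=> [[fE cf] I1 c0]; have mf : measurable_fun setT f by case: fE.
    apply: (levy_ucp_littleo1 mf fK cf c0 I1) => e e0.
    have [d' d0 hd] := classE''_le fE e0; exists d' => // x xd.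
    by have := hd x xd; rewrite powRr1.
  + move=> [[r [Ir /andP[r0 r1] [fE cf]]] [c0 b0]]; have mf : measurable_fun setT f by case: fE.
    have [A [d' [d0 hd]]] := classE'_le fE.
    apply: (levy_ucp_bigO mf fK cf c0 _ Ir _ d0 hd); last by right.
    by rewrite r0/= (le_lt_trans r1)// ltr1n.
- move=> f /bounded_fun_le [K fK] [fE cf]; have mf : measurable_fun setT f by case: fE.
  rewrite -[c in _ + c](mulr1 c); apply: (levy_ucp_quadratic mf fK ler01 cf) => e e0.
  have [d' d0 hd] := classE_le fE e0; exists d' => // x xd.
  by rewrite mul1r -norm_powR2; exact: hd.
- move=> f /bounded_fun_le [K fK] [fE cf] c0 I1; have mf : measurable_fun setT f by case: fE.
  apply: (levy_ucp_equiv1 mf fK cf c0 I1) => e e0.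
  have [d' d0 hd] := classE_le fE e0; exists d' => // x xd.
  by have := hd x xd; rewrite powRr1.
Qed.

End LevyBounded.

(** * Gaussian scaling *)

Section NormalSymmetry.
Context {R : realType}.
Local Notation RM := (measurableTypeR R).
Local Notation N := (normal_prob (0 : R) 1).
Local Notation leb := (@lebesgue_measure R).

Lemma Rintegral_normal_opp (g : R -> R) (K : R) : measurable_fun setT g ->
  (forall x, `|g x| <= K) -> \int[N]_z g (- z) = \int[N]_z g z.
Proof.
move=> mg gK; have mopp : measurable_fun setT (-%R : RM -> RM) by exact: oppr_measurable.
have mg' : measurable_fun setT (fun z : R => g (- z)) by exact: (measurableT_comp mg mopp).
rewrite !Rintegral_normal_prob//.
pose h (z : R) := g z * normal_pdf 0 1 z.
have mh : measurable_fun setT h by apply: measurable_funM => //; exact: measurable_normal_pdf.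
have hi : leb.-integrable setT (EFin \o (fun z => h (- z))).
  have pi : leb.-integrable setT (EFin \o (fun z : R => K * normal_pdf 0 1 z)).
    by apply: integrableZl_EFin; exact: integrable_normal_pdf.
  apply: (dominated_integrable _ pi); first exact: (measurableT_comp mh mopp).
  move=> z; have p0 := normal_pdf_ge0 (0 : R) 1 z.
  rewrite /h (_ : normal_pdf 0 1 (- z) = normal_pdf 0 1 z); last by rewrite !normal_pdf01 sqrrN.
  by rewrite normrM (ger0_norm p0) ler_wpM2r.
transitivity (\int[leb]_z h (- z)).
  by apply: eq_Rintegral => z _; rewrite /h !normal_pdf01 sqrrN.
apply: (congr1 fine).
transitivity (\int[pushforward leb (-%R : RM -> RM)]_z (h z)%:E)%E.
  by rewrite integral_pushforward//; exact/measurable_EFinP.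
by apply: eq_measure_integral => A mA _; exact: lebesgue_measureN.
Qed.

Lemma normal_cos_affine (s v u a : R) :
  \int[N]_z cos (u * (v + s * z) - a) = expR (- (s ^+ 2 / 2 * u ^+ 2)) * cos (u * v - a).
Proof.
have mc (w : R) : measurable_fun setT (fun z : R => cos (w * z)) by exact: measurable_cosM.
have ms (w : R) : measurable_fun setT (fun z : R => sin (w * z)) by exact: measurable_sinM.
have cK (w z : R) : `|cos (w * z)| <= 1 by rewrite ler_norml cos_geN1 cos_le1.
have sK (w z : R) : `|sin (w * z)| <= 1 by exact: sin_max.
have ci (w : R) := finite_bounded_integrable N (mc w) (cK w).
have si (w : R) := finite_bounded_integrable N (ms w) (sK w).
have s0 w : \int[N]_z sin (w * z) = 0.
  have := Rintegral_normal_opp (ms w) (sK w).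
  under eq_Rintegral do rewrite mulrN sinN -mulN1r.
  by rewrite (RintegralZl _ measurableT (si w)) => h; lra.
pose q := u * v - a.
transitivity (\int[N]_z (cos q * cos ((u * s) * z) - sin q * sin ((u * s) * z))).
  apply: eq_Rintegral => z _; rewrite (_ : _ - a = q + (u * s) * z) ?cosD//.
  by rewrite /q; ring.
rewrite (RintegralB measurableT (integrableZl_EFin _ (ci _)) (integrableZl_EFin _ (si _))).
rewrite (RintegralZl _ measurableT (ci _)) (RintegralZl _ measurableT (si _)) s0 mulr0 subr0.
rewrite normal_characteristic_function mulrC; congr (expR _ * _).
by rewrite exprMn; field.
Qed.

End NormalSymmetry.

(** * Laws dominated by Lebesgue measure *)

Section GaussDominated.
Context {R : realType}.
Local Notation RM := (measurableTypeR R).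
Local Notation N := (normal_prob (0 : R) 1).
Local Notation leb := (@lebesgue_measure R).
Variables (c : R).
Hypothesis c0 : 0 < c.

Definition gauss_dominated (nu : probability RM R) :=
  forall u a, `|\int[nu]_x cos (u * x - a)| <= expR (- (c / 2 * u ^+ 2)).

(** The maximum of the N(0, c) density, as Fourier inversion suggests for a law whose characteristic
    function is at most exp(-cu^2/2) in modulus. *)
Let M := normal_peak (1 : R) / Num.sqrt c.

Let sc0 : 0 < Num.sqrt c. Proof. by rewrite sqrtr_gt0. Qed.

Let peak0 : 0 <= normal_peak (1 : R).
Proof.
have := normal_pdf_ge0 (0 : R) 1 0; rewrite normal_pdf01 expr0n/= oppr0 mul0r expR0 mulr1.
by [].
Qed.

Let M0 : 0 <= M. Proof. by rewrite divr_ge0// ltW. Qed.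

Variable nu : probability RM R.
Hypothesis nuc : gauss_dominated nu.

(** In the smoothing formula, the coefficient of h(y) is at most the peak times (1/s)(1 +
    c/s^2)^(-1/2) = (s^2 + c)^(-1/2), which is below [M] for every s. Then s tends to 0, the
    Lipschitz bound controlling the smoothing error. *)
Lemma lipschitz_le_lebesgue (h : R -> R) (L K : R) :
  (forall x, 0 <= h x) -> (forall x, `|h x| <= K) ->
  (forall x y, `|h x - h y| <= L * `|x - y|) ->
  leb.-integrable setT (EFin \o h) ->
  \int[nu]_x h x <= M * \int[leb]_x h x.
Proof.
move=> h0 hK hL hi; have ch := lipschitz_continuous hL.
have key (s : R) : 0 < s -> \int[nu]_x \int[N]_z h (x + s * z) <= M * \int[leb]_x h x.
  move=> s0; rewrite (Rintegral_gauss_smoothing nu s0 ch h0 hi).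
  rewrite -(RintegralZl _ measurableT hi).
  apply: (le_trans (ler_norm _)).
  have bnd y : `|normal_peak 1 / s * \int[N]_u0 \int[nu]_x cos (u0 / s * x - u0 / s * y)| <= M.
    have A1 : -1 < c / s ^+ 2 by rewrite (lt_le_trans _ (divr_ge0 (ltW c0) (sqr_ge0 s)))// ltrN10.
    have [gi gE] := normal_expR_sqr A1.
    have B1 : `|\int[N]_u0 \int[nu]_x cos (u0 / s * x - u0 / s * y)| <= (Num.sqrt (1 + c / s ^+ 2))^-1.
      rewrite -gE; apply: (Rintegral_norm_le _ gi) => [|z].
        apply: (@measurable_Rintegral_param _ _ RM RM R nu (fun z => cos (z.1 / s * z.2 - z.1 / s * y)) 1).
          apply: measurableT_comp; first by apply: continuous_measurable_fun; exact: continuous_cos.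
          apply: measurable_funB; apply: measurable_funM => //; exact: measurable_funM.
        by move=> z; rewrite ler_norml cos_geN1 cos_le1.
      apply: (le_trans (nuc _ _)); rewrite ler_expR le_eqVlt; apply/orP; left; apply/eqP.
      by field; rewrite gt_eqF.
    rewrite normrM ger0_norm ?divr_ge0 ?(ltW s0)//.
    apply: (le_trans (ler_wpM2l _ B1)); first by rewrite divr_ge0// ltW.
    rewrite /M -mulrA ler_wpM2l// -invfM lef_pV2 ?posrE//; last first.
      by rewrite mulr_gt0// sqrtr_gt0 addr_gt0// divr_gt0// exprn_gt0.
    have -> : s * Num.sqrt (1 + c / s ^+ 2) = Num.sqrt (s ^+ 2 + c).
      rewrite -{1}(gtr0_norm s0) -sqrtr_sqr -sqrtrM ?sqr_ge0//; congr (Num.sqrt _).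
      by field; rewrite gt_eqF.
    by rewrite ler_wsqrtr// lerDr sqr_ge0.
  have Mi := integrableZl_EFin M hi.
  apply: (Rintegral_norm_le _ Mi) => [|y].
    apply: measurable_funM; first exact: integrable_measurable hi.
    apply: measurable_funM => //.
    apply: (@measurable_Rintegral_param _ _ RM RM R N (fun z => \int[nu]_x cos (z.2 / s * x - z.2 / s * z.1)) 1).
      apply: (@measurable_Rintegral_param _ _ (RM * RM)%type RM R nu
        (fun z => cos (z.1.2 / s * z.2 - z.1.2 / s * z.1.1)) 1).
        apply: measurableT_comp; first by apply: continuous_measurable_fun; exact: continuous_cos.
        have m12 : measurable_fun setT (fun z : RM * RM * RM => z.1.2 / s : R).
          by apply: measurable_funM => //; exact: (measurableT_comp measurable_snd measurable_fst).
        apply: measurable_funB; apply: measurable_funM => //.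
        exact: (measurableT_comp measurable_fst measurable_fst).
      by move=> z; rewrite ler_norml cos_geN1 cos_le1.
    move=> z; apply: Rintegral_probability_le; first exact: measurable_cos_affine.
    by move=> x; exact: norm_cos_affine.
  by rewrite normrM (ger0_norm (h0 y)) mulrC ler_wpM2r.
have err s : 0 < s -> \int[nu]_x h x <= M * \int[leb]_x h x + L * s * \int[N]_z `|z|.
  move=> s0; have := smoothing_error nu (ltW s0) hK hL.
  have nuT : nu [set: RM] = 1%E by exact: probability_setT.
  rewrite [X in _ <= _ * X -> _](_ : _ = 1); last exact: (congr1 fine nuT).
  rewrite mulr1 => /(le_trans (ler_norm _)).
  by have := key s s0; lra.
apply/ler_addgt0Pr => e e0.
have q0 : 0 < `|L * \int[N]_z `|z| | + 1 by rewrite ltr_wpDl.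
have := err (e / (`|L * \int[N]_z `|z| | + 1)) (divr_gt0 e0 q0).
move=> /le_trans; apply; rewrite lerD2l mulrAC mulrA ler_pdivrMr//.
rewrite mulrC ler_pM2l//; apply: (le_trans (ler_norm _)); by rewrite lerDl.
Qed.

(** A Lipschitz function that is 1 on [a, b] and 0 at distance more than 1/(k+1) from it. *)
Definition trapezoid (a b : R) (k : nat) (x : R) : R :=
  Num.max 0 (Num.min 1 (1 + k.+1%:R * Num.min (x - a) (b - x))).

Lemma trapezoid_lipschitz (a b : R) k (x y : R) :
  `|trapezoid a b k x - trapezoid a b k y| <= k.+1%:R * `|x - y|.
Proof.
rewrite /trapezoid; have k0 : 0 < k.+1%:R :> R by [].
have : `|k.+1%:R * Num.min (x - a) (b - x) - k.+1%:R * Num.min (y - a) (b - y)| <= k.+1%:R * `|x - y|.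
  rewrite -mulrBr normrM gtr0_norm// ler_pM2l//.
  have := ler_norm (x - y); have := ler_norm (y - x); rewrite (distrC y x).
  move: `|x - y| => d h1 h2; rewrite ler_norml.
  by case: (leP (x - a) (b - x)); case: (leP (y - a) (b - y)) => *; apply/andP; split; lra.
move: (_ * Num.min _ _) (_ * Num.min _ _) (_ * `|_|) => p q d; rewrite !ler_norml => /andP[h1 h2].
have : - d <= Num.min 1 (1 + p) - Num.min 1 (1 + q) <= d.
  by case: (leP 1 (1 + p)); case: (leP 1 (1 + q)) => *; apply/andP; split; lra.
move: (Num.min _ _) (Num.min _ _) => u v /andP[h3 h4].
by case: (leP 0 u); case: (leP 0 v) => *; apply/andP; split; lra.
Qed.

Lemma trapezoid_ge0 (a b : R) k (x : R) : 0 <= trapezoid a b k x.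
Proof. by rewrite le_max lexx. Qed.

Lemma trapezoid_le1 (a b : R) k (x : R) : trapezoid a b k x <= 1.
Proof. by rewrite ge_max ler01 ge_min lexx. Qed.

Lemma trapezoid_in (a b : R) k (x : R) : a <= x <= b -> trapezoid a b k x = 1.
Proof.
move=> /andP[ax xb]; rewrite /trapezoid min_l ?max_r//.
by rewrite lerDl mulr_ge0// le_min !subr_ge0 ax.
Qed.

Lemma trapezoid_out (a b : R) k (x : R) : ~~ (a - k.+1%:R^-1 <= x <= b + k.+1%:R^-1) -> trapezoid a b k x = 0.
Proof.
move=> h; rewrite /trapezoid max_l// ge_min; apply/orP; right.
have k0 : 0 < k.+1%:R :> R by [].
have h' : Num.min (x - a) (b - x) <= - k.+1%:R^-1.
  move: h; move: (k.+1%:R^-1) => w; rewrite ge_min negb_and -!ltNge => /orP[h|h]; apply/orP; [left|right].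
    by rewrite lerBlDr addrC ltW.
  by rewrite lerBlDr addrC lerBrDr ltW.
have := ler_wpM2l (ltW k0) h'; rewrite mulrN mulfV ?gt_eqF//; lra.
Qed.

Lemma itv_le_lebesgue (a b : R) : a <= b -> (nu `]a, b]%classic <= (M * (b - a))%:E)%E.
Proof.
move=> ab; have mI : measurable (`]a, b]%classic : set RM) by exact: measurable_itv.
have E : nu `]a, b]%classic = (\int[nu]_x (\1_(`]a, b]%classic) x))%:E.
  rewrite /Rintegral; under eq_integral do rewrite -/((EFin \o \1_(`]a, b]%classic)) _).
  by rewrite integral_indic// setIT fineK// fin_num_measure.
rewrite E lee_fin; apply/ler_addgt0Pr => e e0.
pose k := Num.truncn (M * 2 / e).
have k0 : 0 < k.+1%:R :> R by [].
have hk : M * 2 / k.+1%:R <= e.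
  by rewrite ler_pdivrMr// [leRHS]mulrC -ler_pdivrMr// ltW// truncnS_gt.
pose J := (`[a - k.+1%:R^-1, b + k.+1%:R^-1]%classic : set R).
have mJ : measurable J by exact: measurable_itv.
have ki : 0 < k.+1%:R^-1 :> R by rewrite invr_gt0.
have Ji : leb.-integrable setT (EFin \o (\1_J : R -> R)) by exact: integrable_indic_itv.
have tJ x : trapezoid a b k x <= \1_J x.
  rewrite indicE; have [xJ|xJ] := boolP (x \in J); first exact: trapezoid_le1.
  rewrite trapezoid_out//; apply: contra xJ => xJ.
  by rewrite inE /J /= in_itv.
have mt : measurable_fun setT (trapezoid a b k).
  exact: continuous_measurable_fun (lipschitz_continuous (@trapezoid_lipschitz a b k)).
have ti : leb.-integrable setT (EFin \o trapezoid a b k).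
  by apply: (dominated_integrable _ Ji) => [|x]; [exact: mt|rewrite ger0_norm ?trapezoid_ge0].
have tK x : `|trapezoid a b k x| <= 1 by rewrite ger0_norm ?trapezoid_ge0 ?trapezoid_le1.
have h1 := lipschitz_le_lebesgue (@trapezoid_ge0 a b k) tK (@trapezoid_lipschitz a b k) ti.
have h2 : \int[leb]_x trapezoid a b k x <= b - a + 2 * k.+1%:R^-1.
  apply: (@le_trans _ _ (\int[leb]_x (\1_J x))); first exact: le_Rintegral.
  rewrite /Rintegral; under eq_integral do rewrite -/((EFin \o \1_J) _).
  have -> : (\int[leb]_x (EFin \o \1_J) x = leb J)%E by rewrite integral_indic// setIT.
  have -> : leb J = (b + k.+1%:R^-1 - (a - k.+1%:R^-1))%:E.
    rewrite /J lebesgue_measure_itv/= lte_fin ifT// ltrBlDr.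
    by rewrite (le_lt_trans ab)// -addrA ltrDl addr_gt0.
  rewrite /= le_eqVlt; apply/orP; left; apply/eqP; ring.
have h3 : \int[nu]_x (\1_(`]a, b]%classic) x) <= \int[nu]_x trapezoid a b k x.
  apply: le_Rintegral => //.
  - apply: (finite_bounded_integrable nu (K := 1)) => // x.
    by rewrite indicE; case: (_ \in _); rewrite ?normr1 ?normr0.
  - exact: (finite_bounded_integrable nu mt tK).
  - move=> x _; rewrite indicE; case: (boolP (x \in _)) => [|_]; last exact: trapezoid_ge0.
    rewrite inE /= in_itv/= => /andP[ax xb]; rewrite trapezoid_in// xb andbT ltW//.
apply: (le_trans h3); apply: (le_trans h1); apply: (le_trans (ler_wpM2l M0 h2)).
by rewrite mulrDr lerD2l mulrA.
Qed.

End GaussDominated.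

Section LebesgueDominated.
Context {R : realType}.
Local Notation RM := (measurableTypeR R).
Local Notation leb := (@lebesgue_measure R).
Variables (nu : probability RM R) (M : {nonneg R}).
Hypothesis nuI : forall a b : R, a <= b -> (nu `]a, b]%classic <= (M%:num * (b - a))%:E)%E.

(** Lebesgue measure is an infimum over countable covers by half-open intervals, and countable
    subadditivity carries the interval bound to each cover. *)
Lemma le_lebesgue_of_itv (A : set RM) : measurable A -> (nu A <= mscale M leb A)%E.
Proof.
move=> mA; have nuI' (I : set (ocitv_type R)) : measurable I ->
    (nu I <= M%:num%:E * wlength idfun I)%E.
  move=> [[a b] _ <-] /=; have [ab|ab] := leP a b.
    by rewrite (wlength_itv_bnd idfun false false ab) -EFinM; exact: nuI.
  by rewrite set_itv_ge ?measure0 ?wlength0 ?mule0// -leNgt bnd_simp ltW.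
rewrite /mscale /=.
(* The general argument divides by the constant. If it is 0, every interval is null, and so is the
   line. *)
have [M0|M0] := eqVneq M%:num 0.
  have key (I : set (ocitv_type R)) : measurable I -> (nu I = 0)%E.
    by move=> mI; apply/eqP; rewrite eq_le measure_ge0 andbT (le_trans (nuI' _ mI))// M0 mul0e.
  have -> : nu A = 0%E; last by rewrite M0 mul0e.
  apply/eqP; rewrite eq_le measure_ge0 andbT.
  have sub : A `<=` \bigcup_n (`]- n%:R, n%:R]%classic : set RM).
    move=> x _; exists (Num.truncn `|x|).+1 => //=; rewrite in_itv/=.
    have := truncnS_gt `|x|; rewrite ltr_norml => /andP[-> /ltW ->]//.
  apply: (le_trans (measure_sigma_subadditive _ _ _ sub)) => //.
  by rewrite eseries0// => n _ _; apply: key; exists (- n%:R, n%:R).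
have Mp : 0 < M%:num by rewrite lt_neqAle eq_sym M0/=.
rewrite -lee_pdivrMl//; apply: le_ereal_inf_tmp => _ [I [mI AI] <-].
rewrite lee_pdivrMl//.
have mI' k : measurable (I k : set RM) by apply: sub_sigma_algebra; exact: mI.
apply: (le_trans (measure_sigma_subadditive nu mI' mA AI)).
rewrite -nneseriesZl//.
by apply: lee_nneseries => n _ //; exact: nuI'.
Qed.

Lemma Rintegral_le_lebesgue (h : R -> R) (K : R) (E : set RM) : measurable E ->
  measurable_fun setT h -> (forall x, 0 <= h x <= K) ->
  leb.-integrable E (EFin \o h) ->
  \int[nu]_(x in E) h x <= M%:num * \int[leb]_(x in E) h x.
Proof.
move=> mE mh h0 hi.
have h0' x : (0%:E <= (h x)%:E)%E by rewrite lee_fin; case/andP: (h0 x).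
have mh' : measurable_fun setT (EFin \o h) by exact/measurable_EFinP.
have := ge0_le_measure_integral le_lebesgue_of_itv mE h0' mh'.
rewrite ge0_integral_mscale//; last exact: measurable_funTS.
have nui : nu.-integrable setT (EFin \o h).
  apply: (finite_bounded_integrable nu (K := K)) => [|x]; first exact: mh.
  by case/andP: (h0 x) => p q; rewrite ger0_norm.
have nuiE : nu.-integrable E (EFin \o h) by exact: integrableS nui.
rewrite /Rintegral -lee_fin EFinM !fineK//; exact: integrable_fin_num.
Qed.

End LebesgueDominated.

(** * From weak convergence to bounded Borel functions *)

Section BorelConvergence.
Context {R : realType}.
Local Notation RM := (measurableTypeR R).
Local Notation leb := (@lebesgue_measure R).

Lemma cutoff_tail_cvg0 (G : {finite_measure set RM -> \bar R}) :
  \int[G]_x (1 - cutoff L x) @[L --> \oo] --> 0.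
Proof.
have -> : (0 : R) = \int[G]_x (fun _ : R => 0) x by rewrite /Rintegral integral0.
apply: (@Rintegral_dominated_cvg _ _ _ G (fun L x => 1 - cutoff L x) (fun=> 0) (fun=> 1)).
- move=> L; apply: measurable_funB => //.
  exact: continuous_measurable_fun (lipschitz_continuous (@cutoff_lipschitz R L)).
- move=> x; apply: cvg_near_cst; exists (Num.truncn `|x|).+1 => // L /= xL.
  rewrite cutoff_near ?subrr// ltW// (lt_le_trans (truncnS_gt _))// ler_nat//.
- exact: finite_measure_integrable_cst.
- move=> L x; have := cutoff_ge0 L x; have := cutoff_le1 L x.
  by move=> h1 h2; rewrite ger0_norm ?subr_ge0// gerBl.
Qed.

Lemma continuous_approx (f : R -> R) (K : R) (L : nat) (e : R) :
  measurable_fun setT f -> (forall x, `|f x| <= K) -> 0 < e ->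
  exists g : R -> R, [/\ continuous g, (forall x, `|g x| <= K) &
    \int[leb]_(x in `[- L.+1%:R, L.+1%:R]) `|f x - g x| <= e].
Proof.
move=> mf fK e0; pose E := (`[- L.+1%:R, L.+1%:R]%classic : set RM).
have mE : measurable E by exact: measurable_itv.
have Efin : (leb E < +oo)%E by rewrite /E lebesgue_measure_itv/=; case: ifP; rewrite ltry.
have fi : leb.-integrable E (EFin \o f).
  apply: measurable_bounded_integrable => //; first exact: measurable_funTS.
  by exists K; split; [exact: num_real|move=> y /ltW Ky x _ /=; rewrite (le_trans (fK x))].
have [g_ [cg gi gc]] := approximation_continuous_integrable mE Efin fi.
have [n [nfin nle]] : exists n, (\int[leb]_(z in E) `|(f z - g_ n z)%:E|)%E \is a fin_num /\
    fine (\int[leb]_(z in E) `|(f z - g_ n z)%:E|)%E <= e.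
  move: gc => /fine_cvgP [[m _ hm] /cvgrPdist_le /(_ _ e0) [k _ hk]].
  exists (maxn m k); split; first by apply: hm; exact: leq_maxl.
  by have := hk _ (leq_maxr m k); rewrite sub0r normrN; apply: le_trans; exact: ler_norm.
have K0 : 0 <= K by apply: le_trans (fK 0).
(* Clipping to [-K, K] keeps continuity and, because |f| <= K, does not increase the distance to
   f. *)
pose g x := Num.max (- K) (Num.min K (g_ n x)).
have gK x : `|g x| <= K.
  rewrite /g ler_norml le_max lexx/= ge_max ge_min lexx andbT; lra.
have cg' : continuous g.
  move=> x; apply: (@continuous_max R R (fun=> - K) (fun y => Num.min K (g_ n y))).
    exact: cvg_cst.
  apply: (@continuous_min R R (fun=> K) (g_ n)); first exact: cvg_cst.
  exact: cg.
have fg x : `|f x - g x| <= `|f x - g_ n x|.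
  have := fK x; rewrite /g; move: (f x) (g_ n x) => p q; rewrite ler_norml => /andP[h1 h2].
  have := ler_norm (p - q); have := ler_norm (q - p); rewrite (distrC q p).
  move: `|p - q| => d h3 h4; rewrite ler_norml; clear -K0 h1 h2 h3 h4.
  by case: (leP K q) => h5; case: (leP (- K) _) => h6; apply/andP; split; lra.
have mg : measurable_fun setT g by exact: continuous_measurable_fun.
have mgn : measurable_fun setT (g_ n) by exact: continuous_measurable_fun.
exists g; split=> //; apply: le_trans nle.
apply: fine_le => //.
  rewrite ge0_fin_numE; last by apply: integral_ge0 => x _; rewrite lee_fin.
  apply: le_lt_trans (_ : _ <= \int[leb]_(z in E) `|(f z - g_ n z)%:E|)%E _; last by rewrite -ge0_fin_numE// integral_ge0.
  apply: ge0_le_integral => //.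
  - by apply/measurable_EFinP/measurable_funTS; apply: measurableT_comp => //; exact: measurable_funB.
  - by apply/measurable_EFinP/measurable_funTS; apply: measurableT_comp => //; exact: measurable_funB.
  - by move=> x _; rewrite lee_fin.
apply: ge0_le_integral => //.
- by apply/measurable_EFinP/measurable_funTS; apply: measurableT_comp => //; exact: measurable_funB.
- by apply/measurable_EFinP/measurable_funTS; apply: measurableT_comp => //; exact: measurable_funB.
- by move=> x _; rewrite lee_fin.
Qed.

Variables (c : R) (nu_ : nat -> probability RM R) (G : probability RM R).
Hypothesis c0 : 0 < c.
Hypothesis nud : forall n, gauss_dominated c (nu_ n).
Hypothesis Gd : gauss_dominated c G.
Hypothesis cfc : forall u a, \int[nu_ n]_x cos (u * x - a) @[n --> \oo] --> \int[G]_x cos (u * x - a).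

Theorem borel_convergence (f : R -> R) (K : R) : measurable_fun setT f ->
  (forall x, `|f x| <= K) -> \int[nu_ n]_x f x @[n --> \oo] --> \int[G]_x f x.
Proof.
move=> mf fK; apply/cvgrPdist_le => e e0.
have K0 : 0 <= K by apply: le_trans (fK 0).
have M0 : 0 <= normal_peak (1 : R) / Num.sqrt c.
  have := normal_pdf_ge0 (0 : R) 1 0; rewrite normal_pdf01 expr0n/= oppr0 mul0r expR0 mulr1.
  by move=> h; rewrite divr_ge0// sqrtr_ge0.
pose M := NngNum M0.
have e1 : 0 < e / (8 * (K + 1)) by rewrite divr_gt0// mulr_gt0// ltr_wpDl.
have e1K : K * (e / (8 * (K + 1))) <= e / 8.
  rewrite mulrA ler_pdivrMr ?mulr_gt0 ?ltr_wpDl//.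
  by rewrite (_ : e / 8 * _ = e * (K + 1)); [rewrite mulrC ler_wpM2l ?(ltW e0)// lerDl|field].
have e2 : 0 < e / (8 * (M%:num + 1)) by rewrite divr_gt0// mulr_gt0// ltr_wpDl.
have e2M : M%:num * (e / (8 * (M%:num + 1))) <= e / 8.
  rewrite mulrA ler_pdivrMr ?mulr_gt0 ?ltr_wpDl//.
  by rewrite (_ : e / 8 * _ = e * (M%:num + 1)); [rewrite mulrC ler_wpM2l ?(ltW e0)// lerDl|field].
have /cvgrPdist_le /(_ _ e1) [L _ hL] := cutoff_tail_cvg0 G.
have {}hL : \int[G]_x (1 - cutoff L x) <= e / (8 * (K + 1)).
  by have := hL L (leqnn L); rewrite sub0r normrN; apply: le_trans; exact: ler_norm.
have cchi := lipschitz_continuous (@cutoff_lipschitz R L).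
have mchi := continuous_measurable_fun cchi.
have chi01 (x : R) : 0 <= 1 - cutoff L x <= 1.
  by have := cutoff_ge0 L x; have := cutoff_le1 L x; rewrite subr_ge0 gerBl => -> ->.
have mtl : measurable_fun setT (fun x : R => 1 - cutoff L x) by apply: measurable_funB.
have tlK (x : R) : `|1 - cutoff L x| <= 1 by case/andP: (chi01 x) => h1 h2; rewrite ger0_norm.
have [g [cg gK gint]] := continuous_approx L mf fK e2.
have mg : measurable_fun setT g by exact: continuous_measurable_fun.
pose f1 (x : R) := f x * cutoff L x; pose g1 (x : R) := g x * cutoff L x.
have mf1 : measurable_fun setT f1 by exact: measurable_funM.
have mg1 : measurable_fun setT g1 by exact: measurable_funM.
have chiK (h : R -> R) x : `|h x| <= K -> `|h x * cutoff L x| <= K.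
  move=> hK; rewrite normrM -[leRHS]mulr1 ler_pM//.
  by rewrite ger0_norm ?cutoff_ge0 ?cutoff_le1.
have f1K (x : R) : `|f1 x| <= K by exact: chiK.
have g1K (x : R) : `|g1 x| <= K by exact: chiK.
have cg1 (x : R) : {for x, continuous g1} by apply: cvgM; [exact: cg|exact: cchi].
(* Valid for all the laws at once: cutting off costs K times the tail mass of Q, and replacing f by
   the continuous g costs M times an L^1 distance for Lebesgue measure. *)
have main (Q : probability RM R) : gauss_dominated c Q ->
    `|\int[Q]_x f x - \int[Q]_x g1 x| <= K * \int[Q]_x (1 - cutoff L x) + e / 8.
  move=> Qd.
  have fi := finite_bounded_integrable Q mf fK; have g1i := finite_bounded_integrable Q mg1 g1K.
  have f1i := finite_bounded_integrable Q mf1 f1K; have ti := finite_bounded_integrable Q mtl tlK.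
  have -> : \int[Q]_x f x - \int[Q]_x g1 x = (\int[Q]_x f x - \int[Q]_x f1 x) + (\int[Q]_x f1 x - \int[Q]_x g1 x) by ring.
  rewrite (le_trans (ler_normD _ _))//; apply: lerD.
    rewrite -(RintegralB measurableT fi f1i) -(RintegralZl _ measurableT ti).
    apply: (Rintegral_norm_le _ (integrableZl_EFin K ti)) => [|x]; first exact: measurable_funB.
    rewrite /f1 -{1}(mulr1 (f x)) -mulrBr normrM [ `|1 - _| ]ger0_norm; last by case/andP: (chi01 x).
    by rewrite ler_wpM2r//; case/andP: (chi01 x).
  rewrite -(RintegralB measurableT f1i g1i); apply: le_trans e2M.
  pose E := (`[- L.+1%:R, L.+1%:R]%classic : set RM).
  have mE : measurable E by exact: measurable_itv.
  pose h (x : R) := `|f1 x - g1 x|.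
  have mh : measurable_fun setT h by apply: measurableT_comp => //; exact: measurable_funB.
  have h0 x : 0 <= h x <= K + K by rewrite normr_ge0 (le_trans (ler_normB _ _))// lerD.
  have hN x : x \notin E -> h x = 0.
    rewrite notin_setE /E /= in_itv/= => /negP xE; rewrite /h /f1 /g1 cutoff_far ?mulr0 ?subrr ?normr0//.
    by rewrite leNgt; apply: contra xE => xL; move: (ltW xL); rewrite ler_norml.
  have hfg x : h x <= `|f x - g x|.
    rewrite /h /f1 /g1 -mulrBl normrM ler_piMr// ger0_norm ?cutoff_ge0 ?cutoff_le1//.
  have Efin : (leb E < +oo)%E by rewrite /E lebesgue_measure_itv/=; case: ifP; rewrite ltry.
  have bi (k : R -> R) (B : R) : measurable_fun setT k -> (forall x, `|k x| <= B) -> leb.-integrable E (EFin \o k).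
    move=> mk kB; apply: measurable_bounded_integrable => //; first exact: measurable_funTS.
    by exists B; split; [exact: num_real|move=> y /ltW By x _ /=; rewrite (le_trans (kB x))].
  have hK x : `|h x| <= K + K by case/andP: (h0 x) => p q; rewrite ger0_norm.
  have mfg : measurable_fun setT (fun x => `|f x - g x|).
    by apply: measurableT_comp => //; exact: measurable_funB.
  have hEi := bi h _ mh hK.
  have step := Rintegral_le_lebesgue (M := M) (itv_le_lebesgue c0 Qd) mE mh h0 hEi.
  apply: (@le_trans _ _ (\int[Q]_x h x)).
    apply: (Rintegral_norm_le _ (finite_bounded_integrable Q mh hK)) => //.
    exact: measurable_funB.
  have -> : \int[Q]_x h x = \int[Q]_(x in E) h x.
    rewrite [RHS]Rintegral_mkcond; apply: eq_Rintegral => x _; rewrite patchE.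
    by case: (boolP (x \in E)) => // /hN.
  apply: (le_trans step); rewrite ler_wpM2l//; apply: le_trans gint.
  apply: le_Rintegral => //.
  apply: (bi _ (K + K)) => // x; rewrite normr_id (le_trans (ler_normB _ _))// lerD//.
have mainG := main G Gd.
have tl_cvg : \int[nu_ n]_x (1 - cutoff L x) @[n --> \oo] --> \int[G]_x (1 - cutoff L x).
  apply: (@levy_continuity _ nu_ G cfc _ 1 mtl tlK).
  by apply/aeW => x; apply: cvgB; [exact: cvg_cst|exact: cchi].
have g1_cvg : \int[nu_ n]_x g1 x @[n --> \oo] --> \int[G]_x g1 x.
  by apply: (@levy_continuity _ nu_ G cfc _ K mg1 g1K); apply/aeW => x; exact: cg1.
have e8 : 0 < e / 8 by rewrite divr_gt0.
move/cvgrPdist_le : tl_cvg => /(_ _ e1); move/cvgrPdist_le : g1_cvg => /(_ _ e8).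
apply: filterS2 => n hg ht; have mainn := main (nu_ n) (nud n).
have ht' : \int[nu_ n]_x (1 - cutoff L x) <= 2 * (e / (8 * (K + 1))).
  by move: ht hL; rewrite ler_norml => /andP[]; lra.
have b1 := ler_wpM2l K0 hL; have b2 := ler_wpM2l K0 ht'.
move: mainG mainn hg b1 b2 e1K.
set p := \int[G]_x f x; set q := \int[G]_x g1 x; set p' := \int[nu_ n]_x f x; set q' := \int[nu_ n]_x g1 x.
move: (e / (8 * (K + 1))) => w m1 m2 hg b1 b2 e1K'.
rewrite (_ : p - p' = (p - q) + (q - q') - (p' - q')); last by ring.
rewrite (le_trans (ler_normB _ _))// (le_trans (lerD (ler_normD _ _) (lexx _)))//.
by move: m1 m2 hg b1 b2 e1K'; lra.
Qed.

End BorelConvergence.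

(** * The exponents under Gaussian scaling *)

Section GaussianZoom.
Context {R : realType}.
Local Notation RM := (measurableTypeR R).
Local Notation N := (normal_prob (0 : R) 1).
Variables (b c : R) (F : {measure set RM -> \bar R}).
Hypothesis Fint : (\int[F]_x (Num.min (x ^+ 2) 1)%:E < +oo)%E.
Variable s : nat -> R.
Hypothesis s0 : forall n, 0 < s n.
Hypothesis sc : s n @[n --> \oo] --> 0.

(** The Gaussian part is invariant under this scaling. The jump part s^2 (1 - cos(ux/s)) is at most
    2 s^2 and at most u^2 x^2 / 2, so it vanishes by dominated convergence with respect to F. *)
Lemma exponent_re_gauss_zoom (u : R) :
  s n ^+ 2 * exponent_re c F (u / s n) @[n --> \oo] --> c * u ^+ 2 / 2.
Proof.
have [B hB] := cvg_seq_ubound sc.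
have B0 : 0 <= B by apply: le_trans (hB 0%N).
have ic n := integrable_one_sub_cos Fint (u / s n).
have -> : (fun n => s n ^+ 2 * exponent_re c F (u / s n)) =
    (fun n => c * u ^+ 2 / 2 + \int[F]_x (s n ^+ 2 * (1 - cos (u / s n * x)))).
  apply/funext => n; rewrite (RintegralZl _ measurableT (ic n)) /exponent_re mulrDr.
  by congr (_ + _); field; rewrite gt_eqF.
rewrite -[X in _ --> X]addr0; apply: cvgD; first exact: cvg_cst.
have -> : (0 : R) = \int[F]_x (fun _ : R => 0) x by rewrite /Rintegral integral0.
have sB n : s n ^+ 2 <= B ^+ 2.
  have := hB n; rewrite (gtr0_norm (s0 n)) => h.
  by apply: lerXn2r => //; rewrite nnegrE ltW.
have bnd n (x : R) : `|s n ^+ 2 * (1 - cos (u / s n * x))| <= (2 * B ^+ 2 + u ^+ 2) * Num.min (x ^+ 2) 1.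
  rewrite ger0_norm; last exact: (mulr_ge0 (sqr_ge0 _) (one_sub_cos_ge0 _)).
  have s2 : 0 < s n ^+ 2 by rewrite exprn_gt0.
  have h1 := ler_wpM2l (ltW s2) (one_sub_cos_le2 (u / s n * x)).
  have h2 := ler_wpM2l (ltW s2) (one_sub_cos_le (u / s n * x)).
  have e2 : s n ^+ 2 * ((u / s n * x) ^+ 2 / 2) = u ^+ 2 * x ^+ 2 / 2 by field; rewrite gt_eqF.
  rewrite e2 in h2; have sBn := sB n.
  have x2 := sqr_ge0 x; have u2 := sqr_ge0 u; have B2 := sqr_ge0 B; have ux := mulr_ge0 u2 x2.
  have Bx := mulr_ge0 B2 x2.
  by case: (leP (x ^+ 2) 1) => x1; lra.
apply: (@Rintegral_dominated_cvg _ _ _ F _ (fun=> 0) (fun x => (2 * B ^+ 2 + u ^+ 2) * Num.min (x ^+ 2) 1)) => //.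
- by move=> n; apply: measurable_funM => //; exact: measurable_one_sub_cos.
- move=> x; apply: (@squeeze_cvgr _ _ _ _ (fun=> 0) (fun n => s n ^+ 2 * 2)).
  + apply: nearW => n; rewrite (mulr_ge0 (sqr_ge0 _) (one_sub_cos_ge0 _))/=.
    by rewrite ler_wpM2l ?sqr_ge0// one_sub_cos_le2.
  + exact: cvg_cst.
  + rewrite -[X in _ --> X](mul0r 2); apply: cvgM; last exact: cvg_cst.
    by rewrite -[X in _ --> X](mulr0 0); exact: (cvgM sc sc).
- exact: integrableZl_EFin (integrable_min_sqr Fint).
Qed.

(** The drift is multiplied by s. For the small jumps, |sin v - v| <= 2 |v| with v = ux/s gives the
    pointwise limit and |sin v - v| <= 2 v^2 the domination. *)
Lemma exponent_im_gauss_zoom (u : R) :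
  s n ^+ 2 * exponent_im b F (u / s n) @[n --> \oo] --> 0.
Proof.
have [B hB] := cvg_seq_ubound sc.
have B0 : 0 <= B by apply: le_trans (hB 0%N).
pose g (w x : R) := sin (w * x) - w * x * \1_[set y : R | `|y| <= 1] x.
have ig n : F.-integrable setT (EFin \o g (u / s n)) by exact: integrable_sin_compensated.
have -> : (fun n => s n ^+ 2 * exponent_im b F (u / s n)) =
    (fun n => s n * (u * b) + \int[F]_x (s n ^+ 2 * g (u / s n) x)).
  apply/funext => n; rewrite (RintegralZl _ measurableT (ig n)) /exponent_im mulrDr.
  by congr (_ + _); field; rewrite gt_eqF.
rewrite -[X in _ --> X]addr0; apply: cvgD.
  by rewrite -[X in _ --> X](mul0r (u * b)); apply: cvgM => //; exact: cvg_cst.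
have -> : (0 : R) = \int[F]_x (fun _ : R => 0) x by rewrite /Rintegral integral0.
have sB n : s n ^+ 2 <= B ^+ 2.
  have := hB n; rewrite (gtr0_norm (s0 n)) => h.
  by apply: lerXn2r => //; rewrite nnegrE ltW.
have gE n x : `|x| <= 1 -> g (u / s n) x = sin (u / s n * x) - u / s n * x.
  by move=> x1; rewrite /g indicE mem_set// mulr1.
have gE' n x : ~ (`|x| <= 1) -> g (u / s n) x = sin (u / s n * x).
  by move=> x1; rewrite /g indicE memNset// mulr0 subr0.
have bnd n (x : R) : `|s n ^+ 2 * g (u / s n) x| <= (B ^+ 2 + 2 * u ^+ 2) * Num.min (x ^+ 2) 1.
  have s2 : 0 < s n ^+ 2 by rewrite exprn_gt0.
  rewrite normrM (gtr0_norm s2).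
  have x2 := sqr_ge0 x; have u2 := sqr_ge0 u; have B2 := sqr_ge0 B; have ux := mulr_ge0 u2 x2.
  have Bx := mulr_ge0 B2 x2; have sBn := sB n.
  have [x1|x1] := pselect (`|x| <= 1).
    rewrite gE// min_l; last by rewrite -real_normK ?num_real// expr_le1.
    apply: (le_trans (ler_wpM2l (ltW s2) (norm_sin_sub_le_sqr _))).
    have -> : s n ^+ 2 * (2 * (u / s n * x) ^+ 2) = 2 * (u ^+ 2 * x ^+ 2) by field; rewrite gt_eqF.
    by lra.
  rewrite gE'// min_r; last first.
    by move/negP: x1; rewrite -ltNge => x1; rewrite -real_normK ?num_real// exprn_ege1// ltW.
  apply: (le_trans (ler_wpM2l (ltW s2) (sin_max _))); lra.
apply: (@Rintegral_dominated_cvg _ _ _ F _ (fun=> 0) (fun x => (B ^+ 2 + 2 * u ^+ 2) * Num.min (x ^+ 2) 1)) => //.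
- by move=> n; apply: measurable_funM => //; exact: measurable_sin_compensated.
- move=> x; apply: norm_cvg0.
  apply: (@squeeze_cvgr _ _ _ _ (fun=> 0) (fun n => s n * (2 * `|u * x| + B))).
  + apply: nearW => n; rewrite normr_ge0/= normrM ger0_norm ?sqr_ge0// expr2 -mulrA.
    rewrite ler_wpM2l ?(ltW (s0 n))//.
    have sn := s0 n; have := hB n; rewrite (gtr0_norm sn) => hBn.
    have ux := normr_ge0 (u * x).
    have [x1|x1] := pselect (`|x| <= 1).
      rewrite gE//; apply: (le_trans (ler_wpM2l (ltW sn) (norm_sin_sub_le_norm _))).
      rewrite (_ : u / s n * x = u * x / s n); last by rewrite mulrAC.
      rewrite normrM [ `|_^-1| ]gtr0_norm ?invr_gt0//.
      have -> : s n * (2 * (`|u * x| / s n)) = 2 * `|u * x| by field; rewrite gt_eqF.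
      by rewrite lerDl.
    rewrite gE'//; apply: (le_trans (ler_wpM2l (ltW sn) (sin_max _))); lra.
  + exact: cvg_cst.
  + by rewrite -[X in _ --> X](mul0r (2 * `|u * x| + B)); apply: cvgM => //; exact: cvg_cst.
- exact: integrableZl_EFin (integrable_min_sqr Fint).
Qed.

End GaussianZoom.

Section LevyGaussian.
Context d (T : measurableType d) (R : realType) (P : probability T R).
Local Notation RM := (measurableTypeR R).
Local Notation N := (normal_prob (0 : R) 1).
Variables (X : R -> {RV P >-> R}) (D : nat -> R).
Hypothesis levyX : is_levy_process X.
Hypothesis D0 : forall n, 0 < D n.
Hypothesis Dc : D n @[n --> \oo] --> 0.
Variables (b c : R) (F : {measure set RM -> \bar R}).
Hypothesis charX : has_characteristics X b c F.
Hypothesis c0 : 0 < c.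

Let Fint := characteristics_Fint charX.
Let s n := Num.sqrt (D n).
Let s0 n : 0 < s n. Proof. by rewrite sqrtr_gt0. Qed.
Let s2 n : s n ^+ 2 = D n. Proof. by rewrite sqr_sqrtr// ltW. Qed.

Lemma sqrt_cvg0 : Num.sqrt (D n) @[n --> \oo] --> 0.
Proof.
rewrite -[X in _ --> X](sqrtr0 R).
by apply: (continuous_cvg _ (@sqrt_continuous R 0)).
Qed.

Lemma measurable_zoom (k : R) : measurable_fun setT (fun x : RM => x / k : RM).
Proof. exact: measurable_funM. Qed.

Definition gauss_zoom n : probability RM R := law (marginal X (D n)) (measurable_zoom (Num.sqrt (D n))).

Lemma gauss_zoom_cos n u a : \int[gauss_zoom n]_x cos (u * x - a) =
  expR (- (s n ^+ 2 * exponent_re c F (u / s n))) * cos (s n ^+ 2 * exponent_im b F (u / s n) - a).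
Proof.
rewrite s2 -(marginal_cos charX _ _ (ltW (D0 n))) /gauss_zoom.
rewrite (Rintegral_law (marginal X (D n)) (measurable_zoom (Num.sqrt (D n))) (measurable_cos_affine u a) (norm_cos_affine u a)).
by apply: eq_Rintegral => x _; congr cos; rewrite /s; ring.
Qed.

Lemma gauss_zoom_dominated n : gauss_dominated c (gauss_zoom n).
Proof.
move=> u a; rewrite gauss_zoom_cos normrM (ger0_norm (expR_ge0 _)) -[leRHS]mulr1.
apply: ler_pM => //; last by rewrite ler_norml cos_geN1 cos_le1.
rewrite ler_expR lerN2 /exponent_re mulrDr.
have -> : s n ^+ 2 * (c * (u / s n) ^+ 2 / 2) = c / 2 * u ^+ 2 by field; rewrite gt_eqF.
rewrite lerDl; apply: mulr_ge0; first exact: sqr_ge0.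
by apply: Rintegral_ge0 => x _; exact: one_sub_cos_ge0.
Qed.

Definition measurable_affine_law (v k : R) : measurable_fun setT (fun z : RM => v + k * z : RM) :=
  measurable_affine v k.

Definition affine_normal (v k : R) : probability RM R := law N (measurable_affine_law v k).

Lemma affine_normal_cos v k u a : \int[affine_normal v k]_x cos (u * x - a) =
  expR (- (k ^+ 2 / 2 * u ^+ 2)) * cos (u * v - a).
Proof.
rewrite /affine_normal (Rintegral_law N (measurable_affine_law v k) (measurable_cos_affine u a) (norm_cos_affine u a)).
exact: normal_cos_affine.
Qed.

Lemma affine_normal_dominated v : gauss_dominated c (affine_normal v (Num.sqrt c)).
Proof.
move=> u a; rewrite affine_normal_cos normrM (ger0_norm (expR_ge0 _)) -[leRHS]mulr1.
rewrite sqr_sqrtr ?(ltW c0)//; apply: ler_pM => //.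
by rewrite ler_norml cos_geN1 cos_le1.
Qed.

Lemma gauss_zoom_cvg (f : R -> R) (K : R) : measurable_fun setT f -> (forall x, `|f x| <= K) ->
  \int[gauss_zoom n]_x f x @[n --> \oo] --> gauss_mean (fun u => f (Num.sqrt c * u)).
Proof.
move=> mf fK.
have -> : gauss_mean (fun u => f (Num.sqrt c * u)) = \int[affine_normal 0 (Num.sqrt c)]_x f x.
  rewrite /affine_normal (Rintegral_law N (measurable_affine_law 0 (Num.sqrt c)) mf fK).
  by apply: eq_Rintegral => z _; rewrite add0r.
apply: (@borel_convergence R c gauss_zoom (affine_normal 0 (Num.sqrt c)) c0 gauss_zoom_dominated
  (@affine_normal_dominated 0) _ f K mf fK) => u a.
rewrite affine_normal_cos sqr_sqrtr ?(ltW c0)// mulr0.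
under eq_fun do rewrite gauss_zoom_cos.
apply: cvgM.
  apply: cvgn_expR; apply: cvgN.
  rewrite (_ : c / 2 * u ^+ 2 = c * u ^+ 2 / 2); last by ring.
  by have := @exponent_re_gauss_zoom R c F Fint s s0; apply; exact: sqrt_cvg0.
apply: cvgn_cos; apply: cvgB; last exact: cvg_cst.
exact: (exponent_im_gauss_zoom b Fint s0 sqrt_cvg0).
Qed.

Lemma levy_limit_iii (f : R -> R) : bounded_fun f -> borel f ->
  cvg_ucp P (fun n t w => n%:R^-1 * Vbar' X D f n t w)
    (fun t _ => t * gauss_mean (fun u => f (Num.sqrt c * u))).
Proof.
move=> /bounded_fun_le [K fK] mf.
set v := gauss_mean _.
have -> : (fun (t : R) (_ : T) => t * v) = (fun t _ => v * t).
  by apply/funext => t; apply/funext => w; rewrite mulrC.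
have -> : (fun n t w => n%:R^-1 * Vbar' X D f n t w) = (fun n t w => (n%:R * 1)^-1 *
    \sum_(1 <= i < (Num.truncn (n%:R * t)).+1) f (increment X (D n) i w / Num.sqrt (D n))).
  by apply/funext => n; apply/funext => t; apply/funext => w; rewrite mulr1.
have mfz n : measurable_fun setT (fun x : R => f (x / Num.sqrt (D n))).
  exact: (measurableT_comp mf (measurable_zoom _)).
have K0 : 0 <= K by apply: le_trans (fK 0).
apply: (levy_ucp levyX D0 (f := fun n x => f (x / Num.sqrt (D n))) (a := fun=> 1) (K := K) (B := K)) => //.
- under eq_fun do rewrite divr1; have := gauss_zoom_cvg mf fK.
  rewrite (_ : (fun n => \int[gauss_zoom n]_x f x) =
    (fun n => \int[marginal X (D n)]_x f (x / Num.sqrt (D n))))//.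
  by apply/funext => n; rewrite /gauss_zoom (Rintegral_law (marginal X (D n)) (measurable_zoom _) mf fK).
- move=> n; rewrite mulr1; apply: (le_trans (ler_norm _)); apply: Rintegral_probability_le.
    by apply: measurableT_comp => //; exact: mfz.
  by move=> x; rewrite normr_id.
- apply: (@squeeze_cvgr _ _ _ _ (fun=> 0) (fun n => K ^+ 2 * n%:R^-1)).
  + apply: nearW => n; rewrite expr1n mulr1 divr_ge0//=; last first.
      by apply: Rintegral_ge0 => x _; exact: sqr_ge0.
    rewrite ler_wpM2r ?invr_ge0//; apply: (le_trans (ler_norm _)); apply: Rintegral_probability_le.
      by apply: measurable_funX; exact: mfz.
    by move=> x; rewrite normrX lerXn2r ?nnegrE.
  + exact: cvg_cst.
  + rewrite -[X in _ --> X](mulr0 (K ^+ 2)); apply: cvgM; first exact: cvg_cst.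
    apply/gtr0_cvgV0; last exact: cvgr_idn.
    by exists 1%N => // n /= n0; rewrite ltr0n.
Qed.

End LevyGaussian.

(** * Power moments of the marginals *)

Section PowerMoments.
Context {R : realType}.
Local Notation RM := (measurableTypeR R).
Local Notation N := (normal_prob (0 : R) 1).

Lemma powR_le_expR (r y : R) : 0 < r -> 0 <= y -> y `^ r <= r `^ r * expR y.
Proof.
move=> r0 y0; have -> : y = r * (y / r) by rewrite mulrCA mulfV ?gt_eqF// mulr1.
have yr : 0 <= y / r by rewrite divr_ge0// ltW.
rewrite powRM ?(ltW r0)// ler_wpM2l ?powR_ge0//.
have h : y / r <= expR (y / r) by have := expR_ge1Dx (y / r); lra.
apply: (@le_trans _ _ (expR (y / r) `^ r)).
  by rewrite ge0_ler_powR ?nnegrE ?expR_ge0 ?(ltW r0).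
by rewrite /powR gt_eqF ?expR_gt0// expRK.
Qed.

Lemma integrable_normal_powR (r k l : R) : 0 < r -> 0 <= k -> 0 <= l ->
  N.-integrable setT (EFin \o (fun z : R => (k + l * `|z|) `^ r)).
Proof.
move=> r0 k0 l0.
have [gi _] := @normal_expR_sqr R (- 2^-1) ltac:(lra).
(* From (|z| - 2)^2 >= 0, exp(1 + |z|) <= e^2 exp(z^2/4), and the last factor is integrable for the
   normal law. *)
pose C := r `^ r * ((k + l + 1) `^ r * expR 2).
have := integrableZl_EFin C gi; move=> ci.
apply: (dominated_integrable _ ci).
  apply: (measurableT_comp (measurable_powR _)).
  by apply: measurable_funD => //; apply: measurable_funM => //; exact: normr_measurable.
move=> z; rewrite ger0_norm ?powR_ge0//; have z0 := normr_ge0 z.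
have h1 : k + l * `|z| <= (k + l + 1) * (1 + `|z|).
  by have := mulr_ge0 k0 z0; lra.
have kl : 0 <= k + l + 1 by lra.
apply: (@le_trans _ _ (((k + l + 1) * (1 + `|z|)) `^ r)).
  by rewrite ge0_ler_powR ?nnegrE ?(ltW r0) ?mulr_ge0 ?addr_ge0 ?mulr_ge0.
rewrite powRM// ?addr_ge0// /C.
have h2 := @powR_le_expR r (1 + `|z|) r0 (addr_ge0 ler01 z0).
apply: (le_trans (ler_wpM2l (powR_ge0 _ _) h2)).
have h3 : expR (1 + `|z|) <= expR 2 * expR (- (- 2^-1 / 2) * z ^+ 2).
  rewrite -expRD ler_expR -[z ^+ 2]real_normK ?num_real//.
  by have := sqr_ge0 (`|z| - 2); lra.
have A0 : 0 <= (k + l + 1) `^ r * r `^ r by rewrite mulr_ge0 ?powR_ge0.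
have := ler_wpM2l A0 h3; rewrite !mulrA => h4.
by apply: (le_trans h4); rewrite le_eqVlt; apply/orP; left; apply/eqP; ring.
Qed.

Lemma gauss_moment_scale (r sg : R) : 0 < r -> 0 <= sg ->
  \int[N]_z `|sg * z| `^ r = sg `^ r * gauss_moment r.
Proof.
move=> r0 sg0; have i1 := @integrable_normal_powR r 0 1 r0 (lexx 0) ler01.
have i2 : N.-integrable setT (EFin \o (fun z : R => `|z| `^ r)).
  by have := i1; rewrite (_ : (fun z : R => (0 + 1 * `|z|) `^ r) = (fun z => `|z| `^ r))//; apply/funext => z; rewrite add0r mul1r.
rewrite /gauss_moment /gauss_mean -(RintegralZl _ measurableT i2).
by apply: eq_Rintegral => z _; rewrite normrM (ger0_norm sg0) powRM.
Qed.

(** For |y| <= k the two functions agree. Beyond k, with t = min(1, s|y|)/s >= k, the difference is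
    at most t^r <= k^(r-2) t^2 because r < 2, which trades the power for a truncated second
    moment. *)
Lemma truncated_powR_sub (r s k y : R) : 0 < r < 2 -> 0 < s -> 0 < k -> s * k <= 1 ->
  `|(s `^ r)^-1 * phi r (s * y) - Num.min (k `^ r) (`|y| `^ r)| <=
  k `^ (r - 2) * ((s ^+ 2)^-1 * Num.min ((s * y) ^+ 2) 1).
Proof.
move=> /andP[r0 r2] s0 k0 sk; have y0 := normr_ge0 y.
have sr : 0 < s `^ r by exact: powR_gt0.
have rhs0 : 0 <= k `^ (r - 2) * ((s ^+ 2)^-1 * Num.min ((s * y) ^+ 2) 1).
  by rewrite mulr_ge0 ?powR_ge0// mulr_ge0 ?invr_ge0 ?sqr_ge0// le_min sqr_ge0 ler01.
have ns : `|s * y| = s * `|y| by rewrite normrM (gtr0_norm s0).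
have [yk|ky] := leP `|y| k.
  have sy1 : s * `|y| <= 1 by apply: le_trans sk; rewrite ler_pM2l.
  rewrite phi_small ?ns// powRM ?(ltW s0)// mulKf ?gt_eqF// min_r ?subrr ?normr0//.
  by rewrite ge0_ler_powR ?nnegrE ?(ltW r0) ?(ltW k0).
rewrite min_l; last by rewrite ge0_ler_powR ?nnegrE ?(ltW r0) ?(ltW k0) ?(ltW ky).
pose m := Num.min 1 (s * `|y|).
have m0 : 0 < m by rewrite lt_min ltr01 mulr_gt0// (lt_trans k0).
have mk : s * k <= m by rewrite le_min sk ler_pM2l// ltW.
have pm : phi r (s * y) = m `^ r.
  rewrite /m; case: (leP 1 (s * `|y|)) => h.
    by rewrite phi_large ?ns// powR1.
  by rewrite phi_small ?ns// ltW.
have mm : Num.min ((s * y) ^+ 2) 1 = m ^+ 2.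
  rewrite -[(s * y) ^+ 2]real_normK ?num_real// ns /m.
  case: (leP 1 (s * `|y|)) => h; first by rewrite min_r ?expr1n// exprn_ege1.
  by rewrite min_l// expr_le1 ?(ltW h)// mulr_ge0// ltW.
rewrite pm mm.
have E : (s `^ r)^-1 * m `^ r = (m / s) `^ r.
  have mE : m `^ r = (m / s) `^ r * s `^ r.
    by rewrite -powRM ?divr_ge0 ?(ltW m0) ?(ltW s0)// divfK ?gt_eqF.
  by rewrite mE mulrC mulfK ?gt_eqF.
have E2 : (s ^+ 2)^-1 * m ^+ 2 = (m / s) ^+ 2 by rewrite exprMn exprVn mulrC.
rewrite E E2; set t := m / s.
have kt : k <= t by rewrite /t ler_pdivlMr// mulrC.
have t0 : 0 < t by rewrite (lt_le_trans k0).
have kr : k `^ r <= t `^ r by rewrite ge0_ler_powR ?nnegrE ?(ltW r0) ?(ltW k0) ?(ltW t0).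
rewrite ger0_norm ?subr_ge0//; apply: (@le_trans _ _ (t `^ r)).
  by rewrite gerBl powR_ge0.
have -> : t `^ r = t `^ (r - 2) * t ^+ 2.
  rewrite -powR_mulrn ?(ltW t0)// -powRD ?subrK//.
  by rewrite gt_eqF ?implybT// .
rewrite ler_wpM2r ?sqr_ge0//.
have -> : r - 2 = - (2 - r) by ring.
rewrite !powRN lef_pV2 ?posrE ?powR_gt0//.
by rewrite ge0_ler_powR ?nnegrE ?subr_ge0 ?(ltW r2) ?(ltW k0) ?(ltW t0).
Qed.

End PowerMoments.

Section LevyPower.
Context d (T : measurableType d) (R : realType) (P : probability T R).
Local Notation RM := (measurableTypeR R).
Local Notation N := (normal_prob (0 : R) 1).
Variables (X : R -> {RV P >-> R}) (D : nat -> R).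
Hypothesis levyX : is_levy_process X.
Hypothesis D0 : forall n, 0 < D n.
Hypothesis Dc : D n @[n --> \oo] --> 0.
Variables (b c : R) (F : {measure set RM -> \bar R}).
Hypothesis charX : has_characteristics X b c F.
Hypothesis c0 : 0 < c.

Let Fint := characteristics_Fint charX.
Let s n := Num.sqrt (D n).
Let s0 n : 0 < s n. Proof. by rewrite sqrtr_gt0. Qed.
Let s2 n : s n ^+ 2 = D n. Proof. by rewrite sqr_sqrtr// ltW. Qed.
Let sg := Num.sqrt c.
Let sg0 : 0 <= sg. Proof. exact: sqrtr_ge0. Qed.

Lemma powR_half (r x : R) : 0 <= x -> x `^ (r / 2) = Num.sqrt x `^ r.
Proof. by move=> x0; rewrite -(powR12_sqrt x0) -powRrM mulrC. Qed.

Lemma gauss_zoom_integral n (f : R -> R) (K : R) : measurable_fun setT f -> (forall x, `|f x| <= K) ->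
  \int[marginal X (D n)]_x f x = \int[gauss_zoom X D n]_y f (s n * y).
Proof.
move=> mf fK; have mg : measurable_fun setT (fun y : R => f (s n * y)).
  by apply: (measurableT_comp mf); exact: measurable_funM.
rewrite /gauss_zoom (Rintegral_law (marginal X (D n)) (measurable_zoom (Num.sqrt (D n))) mg (fun y => fK (s n * y))).
by apply: eq_Rintegral => x _; rewrite mulrCA mulfV ?mulr1// gt_eqF// s0.
Qed.

Lemma min_sqr_moment_bounded : exists C, 0 <= C /\
  forall n, (D n)^-1 * \int[marginal X (D n)]_x Num.min (x ^+ 2) 1 <= C.
Proof.
have muE n u a := marginal_cos charX u a (ltW (D0 n)).
have mm : measurable_fun setT (fun x : R => Num.min (x ^+ 2) 1).
  by apply: measurable_minr => //; exact: exprn_measurable.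
have mK (x : R) : `|Num.min (x ^+ 2) 1| <= 1.
  by rewrite ger0_norm ?le_min ?sqr_ge0 ?ler01// ge_min lexx orbT.
have near1 (e : R) : 0 < e -> exists2 d : R, 0 < d &
    forall x : R, `|x| < d -> `|Num.min (x ^+ 2) 1 - 1 * x ^+ 2| <= e * x ^+ 2.
  move=> e0; exists 1 => // x x1; rewrite mul1r min_l ?subrr ?normr0.
    by rewrite mulr_ge0 ?(ltW e0) ?sqr_ge0.
  by rewrite -real_normK ?num_real// expr_le1 ?(ltW x1).
have cm : {ae F, forall x : R, {for x, continuous (fun y : R => Num.min (y ^+ 2) 1)}}.
  apply/aeW => x; apply: (@continuous_min R R (fun y => y ^+ 2) (fun=> 1)); last exact: cvg_cst.
  exact: exprn_continuous.
have := small_time_quadratic (characteristics_c_ge0 charX) Fint D0 Dc muE mm mK near1 cm.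
move=> /cvg_seq_ubound [C hC]; exists C; split; first exact: le_trans (hC 0%N).
by move=> n; exact: le_trans (ler_norm _) (hC n).
Qed.

(** The scaled laws converge on bounded functions only, so |y|^r is truncated at k^r. The error is
    k^(r-2) times a truncated second moment that is bounded in n, hence small for large k; this is
    where r < 2 is used. *)
Lemma power_moment_phi (r : R) : 0 < r < 2 ->
  (s n `^ r)^-1 * \int[marginal X (D n)]_x phi r x @[n --> \oo] --> sg `^ r * gauss_moment r.
Proof.
move=> r02; have /andP[r0 r2] := r02; have [C [C0 hC]] := min_sqr_moment_bounded.
have mphi := measurable_phi r0.
have phiK (x : R) : `|phi r x| <= 1 by rewrite ger0_norm ?phi_ge0 ?phi_le1.
pose q (k : nat) (y : R) := Num.min (k.+1%:R `^ r) (`|y| `^ r).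
have mpow : measurable_fun setT (fun y : R => `|y| `^ r).
  exact: continuous_measurable_fun (continuous_norm_powR r0).
have mq k : measurable_fun setT (q k) by apply: measurable_minr.
have qK k y : `|q k y| <= k.+1%:R `^ r.
  by rewrite ger0_norm ?le_min ?powR_ge0// ge_min lexx.
have lim_k : \int[N]_z q k (sg * z) @[k --> \oo] --> sg `^ r * gauss_moment r.
  rewrite -(gauss_moment_scale r0 sg0).
  apply: (@Rintegral_dominated_cvg _ _ _ N (fun k z => q k (sg * z)) _ (fun z => (0 + sg * `|z|) `^ r)).
  - by move=> k; apply: (measurableT_comp (mq k)); exact: measurable_funM.
  - move=> z; apply: cvg_near_cst; exists (Num.truncn `|sg * z|) => // k /= kz.
    rewrite /q min_r// ge0_ler_powR ?nnegrE ?(ltW r0)// ltW// (lt_le_trans (truncnS_gt _))//.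
    by rewrite ler_nat.
  - exact: integrable_normal_powR.
  - move=> k z; rewrite ger0_norm ?le_min ?powR_ge0// ge_min add0r.
    by rewrite normrM (ger0_norm sg0) lexx orbT.
apply/cvgrPdist_le => e e0; have e3 : 0 < e / 3 by rewrite divr_gt0.
move/cvgrPdist_le : lim_k => /(_ _ e3) [k0 _ hk0].
(* The second index makes C (k+1)^(r-2) at most e/3. *)
pose k := maxn k0 (Num.truncn ((3 * C / e) `^ (2 - r)^-1)).
have kk : 0 < k.+1%:R :> R by [].
have hk := hk0 k (leq_maxl _ _); rewrite /= in hk.
have r20 : 0 < 2 - r by rewrite subr_gt0.
have hkC : k.+1%:R `^ (r - 2) * C <= e / 3.
  have -> : r - 2 = - (2 - r) by ring.
  rewrite powRN mulrC ler_pdivrMr ?powR_gt0//.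
  have h : 3 * C / e <= k.+1%:R `^ (2 - r).
    have q0 : 0 <= 3 * C / e by rewrite divr_ge0 ?mulr_ge0// ltW.
    apply: (@le_trans _ _ (((3 * C / e) `^ (2 - r)^-1) `^ (2 - r))).
      by rewrite -powRrM mulVf ?gt_eqF// powRr1.
    rewrite ge0_ler_powR ?nnegrE ?powR_ge0 ?(ltW r20)//.
    rewrite ltW// (lt_le_trans (truncnS_gt _))// ler_nat ltnS; exact: leq_maxr.
  by move: h; rewrite ler_pdivrMr//; lra.
have ki : 0 < k.+1%:R^-1 :> R by rewrite invr_gt0.
have qc := gauss_zoom_cvg D0 Dc charX c0 (mq k) (qK k).
move/cvgrPdist_le : qc => /(_ _ e3).
have := sqrt_cvg0 Dc; move=> /cvgrPdist_le /(_ _ ki); apply: filterS2 => n hs hq.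
have sk : s n * k.+1%:R <= 1.
  by move: hs; rewrite sub0r normrN (gtr0_norm (s0 n)) -ler_pdivlMr// div1r.
rewrite (gauss_zoom_integral n mphi phiK).
have mphis : measurable_fun setT (fun y : R => phi r (s n * y)).
  by apply: (measurableT_comp mphi); exact: measurable_funM.
pose Q := gauss_zoom X D n.
have i1 : Q.-integrable setT (EFin \o (fun y : R => phi r (s n * y))).
  exact: (finite_bounded_integrable Q mphis (fun y => phiK (s n * y))).
have i2 : Q.-integrable setT (EFin \o q k) by exact: (finite_bounded_integrable Q (mq k) (qK k)).
have mmin : measurable_fun setT (fun x : R => Num.min (x ^+ 2) 1).
  by apply: measurable_minr => //; exact: exprn_measurable.
have minK (x : R) : `|Num.min (x ^+ 2) 1| <= 1.
  by rewrite ger0_norm ?le_min ?sqr_ge0 ?ler01// ge_min lexx orbT.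
have mmins : measurable_fun setT (fun y : R => Num.min ((s n * y) ^+ 2) 1).
  by apply: (measurableT_comp mmin); exact: measurable_funM.
have i3 : Q.-integrable setT (EFin \o (fun y : R => Num.min ((s n * y) ^+ 2) 1)).
  exact: (finite_bounded_integrable Q mmins (fun y => minK (s n * y))).
have B : `|(s n `^ r)^-1 * \int[Q]_y phi r (s n * y) - \int[Q]_y q k y| <= e / 3.
  rewrite -(RintegralZl _ measurableT i1) -(RintegralB measurableT (integrableZl_EFin _ i1) i2).
  have i4 := integrableZl_EFin (k.+1%:R `^ (r - 2)) (integrableZl_EFin (s n ^+ 2)^-1 i3).
  apply: le_trans (_ : _ <= \int[Q]_y (k.+1%:R `^ (r - 2) * ((s n ^+ 2)^-1 * Num.min ((s n * y) ^+ 2) 1))) _.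
    apply: (Rintegral_norm_le _ i4).
      by apply: measurable_funB; [apply: measurable_funM => //; exact: mphis|exact: mq].
    by move=> y; exact: truncated_powR_sub.
  rewrite (RintegralZl _ measurableT (integrableZl_EFin _ i3)) (RintegralZl _ measurableT i3).
  rewrite -(gauss_zoom_integral n mmin minK) s2; apply: le_trans hkC.
  by rewrite ler_wpM2l ?powR_ge0.
have tri (x1 x2 x3 x4 E : R) : `|x1 - x2| <= E -> `|x3 - x2| <= E -> `|x4 - x3| <= E ->
    `|x4 - x1| <= 3 * E.
  move=> h1 h2 h3; rewrite (_ : x4 - x1 = (x4 - x3) + (x3 - x2) - (x1 - x2)); last by ring.
  rewrite (le_trans (ler_normB _ _))// (le_trans (lerD (ler_normD _ _) (lexx _)))//; lra.
apply: (le_trans (tri _ _ _ _ _ B hq hk)); by rewrite mulrCA mulfV// mulr1.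
Qed.

(** f - [phi r] is bounded by a small multiple of [phi r] plus a multiple of min(x^2, 1). The mean
    of the latter is of order D, which is negligible against D^(r/2) for r < 2. *)
Lemma power_moment (r K : R) (f : R -> R) : 0 < r < 2 ->
  measurable_fun setT f -> (forall x, `|f x| <= K) ->
  (forall e : R, 0 < e -> exists2 d : R, 0 < d &
    forall x : R, `|x| < d -> `|f x - `|x| `^ r| <= e * `|x| `^ r) ->
  (s n `^ r)^-1 * \int[marginal X (D n)]_x f x @[n --> \oo] --> sg `^ r * gauss_moment r.
Proof.
move=> r02 mf fK fr; have /andP[r0 r2] := r02; have [C [C0 hC]] := min_sqr_moment_bounded.
have K0 : 0 <= K by apply: le_trans (fK 0).
have mphi := measurable_phi r0; have pc := power_moment_phi r02.
have phiK (x : R) : `|phi r x| <= 1 by rewrite ger0_norm ?phi_ge0 ?phi_le1.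
have [B1 hB1] := cvg_seq_ubound pc.
have B10 : 0 <= B1 by apply: le_trans (hB1 0%N).
have mmin : measurable_fun setT (fun x : R => Num.min (x ^+ 2) 1).
  by apply: measurable_minr => //; exact: exprn_measurable.
have minK (x : R) : `|Num.min (x ^+ 2) 1| <= 1.
  by rewrite ger0_norm ?le_min ?sqr_ge0 ?ler01// ge_min lexx orbT.
suff diff : (s n `^ r)^-1 * \int[marginal X (D n)]_x (f x - phi r x) @[n --> \oo] --> 0.
  rewrite -[X in _ --> X]add0r.
  rewrite (_ : (fun n => _) = (fun n => (s n `^ r)^-1 * \int[marginal X (D n)]_x (f x - phi r x) +
      (s n `^ r)^-1 * \int[marginal X (D n)]_x phi r x)); first exact: (cvgD diff pc).
  apply/funext => n; rewrite -mulrDr; congr (_ * _).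
  have i1 := finite_bounded_integrable (marginal X (D n)) mf fK.
  have i2 := finite_bounded_integrable (marginal X (D n)) mphi phiK.
  by rewrite (RintegralB measurableT i1 i2) subrK.
have t0 : s n `^ (2 - r) @[n --> \oo] --> 0.
  have r20 : 0 < 2 - r by rewrite subr_gt0.
  have h := @continuous_norm_powR R (2 - r) r20 0.
  rewrite /continuous_at normr0 powR0 ?gt_eqF// in h.
  have := cvg_comp _ _ (sqrt_cvg0 Dc) h; rewrite (_ : _ \o _ = fun n => s n `^ (2 - r))//.
  by apply/funext => n /=; rewrite ger0_norm ?sqrtr_ge0.
apply/cvgrPdist_le => e e0.
have e1 : 0 < e / (2 * (B1 + 1)) by rewrite divr_gt0// mulr_gt0// ltr_wpDl.
have e1B : e / (2 * (B1 + 1)) * B1 <= e / 2.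
  rewrite mulrAC ler_pdivrMr ?mulr_gt0 ?ltr_wpDl//.
  by rewrite (_ : e / 2 * _ = e * (B1 + 1)); [rewrite ler_wpM2l ?(ltW e0)// lerDl|field].
have [d0' d0'0 hd0'] := fr _ e1; pose d1 := Num.min d0' 1.
have d10 : 0 < d1 by rewrite lt_min d0'0 ltr01.
(* Away from 0 the difference is at most K + 1, and 1 <= (1 + 1/d1^2) min(x^2, 1) for |x| >= d1. *)
pose K1 := (K + 1) * (1 + (d1 ^+ 2)^-1).
have d2 : 0 < d1 ^+ 2 by rewrite exprn_gt0.
have i20 : 0 <= (d1 ^+ 2)^-1 by rewrite invr_ge0 ltW.
have K10 : 0 <= K1 by rewrite mulr_ge0 ?addr_ge0.
have bnd (x : R) : `|f x - phi r x| <= e / (2 * (B1 + 1)) * phi r x + K1 * Num.min (x ^+ 2) 1.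
  have m0 : 0 <= Num.min (x ^+ 2) 1 by rewrite le_min sqr_ge0 ler01.
  have [xd|xd] := ltP `|x| d1.
    move: xd; rewrite lt_min => /andP[xd x1]; rewrite phi_small ?(ltW x1)//.
    by apply: (le_trans (hd0' x xd)); rewrite lerDl mulr_ge0.
  apply: (@le_trans _ _ (K1 * Num.min (x ^+ 2) 1)); last first.
    by rewrite lerDr mulr_ge0 ?phi_ge0// ltW.
  apply: (@le_trans _ _ (K + 1)); first by rewrite (le_trans (ler_normB _ _))// lerD.
  have x2d : d1 ^+ 2 <= x ^+ 2 by rewrite -[x ^+ 2]real_normK ?num_real// lerXn2r ?nnegrE// ltW.
  rewrite /K1 -[leLHS]mulr1 -mulrA ler_wpM2l ?addr_ge0//.
  case: (leP (x ^+ 2) 1) => x1; last by rewrite mulr1 lerDl.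
  rewrite -[leLHS](mulVf (lt0r_neq0 d2)) mulrDl mul1r.
  by rewrite -[leLHS]add0r lerD ?sqr_ge0// ler_wpM2l.
have e2 : 0 < e / (2 * (K1 * C + 1)) by rewrite divr_gt0// mulr_gt0// ltr_wpDl// mulr_ge0.
move/cvgrPdist_le : t0 => /(_ _ e2); apply: filterS => n; rewrite !sub0r !normrN.
rewrite ger0_norm ?powR_ge0// => hn.
have i1 := integrableZl_EFin (e / (2 * (B1 + 1))) (finite_bounded_integrable (marginal X (D n)) mphi phiK).
have i2 := finite_bounded_integrable (marginal X (D n)) mmin minK.
have i2K := integrableZl_EFin K1 i2.
have sr : 0 < (s n `^ r)^-1 by rewrite invr_gt0 powR_gt0.
rewrite normrM (gtr0_norm sr).
have h1 : `|\int[marginal X (D n)]_x (f x - phi r x)| <=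
    e / (2 * (B1 + 1)) * \int[marginal X (D n)]_x phi r x + K1 * \int[marginal X (D n)]_x Num.min (x ^+ 2) 1.
  rewrite -(RintegralZl _ measurableT (finite_bounded_integrable (marginal X (D n)) mphi phiK)).
  rewrite -(RintegralZl _ measurableT i2) -(RintegralD measurableT i1 i2K).
  apply: (Rintegral_norm_le _ (integrableD_EFin i1 i2K) bnd).
  exact: measurable_funB.
apply: (le_trans (ler_wpM2l (ltW sr) h1)); rewrite mulrDr.
have p1 : (s n `^ r)^-1 * (e / (2 * (B1 + 1)) * \int[marginal X (D n)]_x phi r x) <= e / 2.
  rewrite mulrCA; apply: le_trans e1B; rewrite ler_wpM2l ?(ltW e1)//.
  exact: le_trans (ler_norm _) (hB1 n).
have p2 : (s n `^ r)^-1 * (K1 * \int[marginal X (D n)]_x Num.min (x ^+ 2) 1) <= e / 2.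
  have DE : (s n `^ r)^-1 = s n `^ (2 - r) * (D n)^-1.
    have := powR_mulrn 2 (ltW (s0 n)) => s2E.
    rewrite powRB ?gt_eqF ?implybT// s2E s2; field.
    by rewrite !gt_eqF ?powR_gt0.
  rewrite DE mulrCA -(mulrA (s n `^ (2 - r))).
  apply: (@le_trans _ _ (K1 * (s n `^ (2 - r) * C))).
    by rewrite ler_wpM2l// ler_wpM2l ?powR_ge0.
  rewrite mulrCA; apply: (@le_trans _ _ (e / (2 * (K1 * C + 1)) * (K1 * C))).
    by rewrite ler_wpM2r// mulr_ge0.
  have KC := mulr_ge0 K10 C0.
  rewrite mulrAC ler_pdivrMr ?mulr_gt0 ?ltr_wpDl//.
  by rewrite (_ : e / 2 * _ = e * (K1 * C + 1)); [rewrite ler_wpM2l ?(ltW e0)// lerDl|field].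
by rewrite [leRHS]splitr lerD.
Qed.

Lemma levy_limit_ii_small (r : R) (f : R -> R) : n%:R * D n @[n --> \oo] --> +oo ->
  0 < r < 2 -> bounded_fun f -> classE r f ->
  cvg_ucp P (fun n t w => (n%:R * D n `^ (r / 2))^-1 * Vbar X D f n t w)
    (fun t _ => c `^ (r / 2) * gauss_moment r * t).
Proof.
move=> Dy r02 /bounded_fun_le [K fK] fE; have /andP[r0 r2] := r02.
have mf : measurable_fun setT f by case: fE.
have mf' : measurable_fun setT (fun x => `|f x|) by exact: measurableT_comp.
have fK' x : `| `|f x| | <= K by rewrite normr_id.
have fr := classE_le fE.
have aE n : D n `^ (r / 2) = s n `^ r by rewrite powR_half// ltW.
apply: (levy_ucp_bounded levyX D0 mf fK (v' := sg `^ r * gauss_moment r)).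
- by move=> n; exact: powR_gt0.
(* Eventually D_n <= 1, and r/2 <= 1, so n D_n^(r/2) >= n D_n. *)
- apply: ger_cvgy Dy; move/cvgrPdist_le : Dc => /(_ 1 ltr01); apply: filterS => n.
  rewrite sub0r normrN (gtr0_norm (D0 n)) => Dn; rewrite ler_wpM2l//.
  rewrite -[leLHS]powRr1 ?(ltW (D0 n))// ger_powR ?D0//.
  by rewrite ler_pdivrMr// mul1r ltW.
- rewrite powR_half ?(ltW c0)//; under eq_fun do rewrite aE.
  exact: (power_moment r02 mf fK fr).
- under eq_fun do rewrite aE.
  apply: (power_moment r02 mf' fK') => e e0; have [d' d0 hd] := fr e e0; exists d' => // x xd.
  rewrite -[X in `|_ - X|](ger0_norm (powR_ge0 _ _)); exact: le_trans (ler_dist_dist _ _) (hd x xd).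
Qed.

End LevyPower.

(** * Absence of jumps and arbitrary powers *)

Section LevyNoJump.
Context d (T : measurableType d) (R : realType) (P : probability T R).
Local Notation RM := (measurableTypeR R).
Local Notation N := (normal_prob (0 : R) 1).
Variables (X : R -> {RV P >-> R}) (D : nat -> R).
Hypothesis levyX : is_levy_process X.
Hypothesis D0 : forall n, 0 < D n.
Hypothesis Dc : D n @[n --> \oo] --> 0.
Variables (b c : R) (F : {measure set RM -> \bar R}).
Hypothesis charX : has_characteristics X b c F.
Hypothesis c0 : 0 < c.
Hypothesis F0 : forall A, measurable A -> F A = 0%E.

Let s n := Num.sqrt (D n).
Let s0 n : 0 < s n. Proof. by rewrite sqrtr_gt0. Qed.
Let s2 n : s n ^+ 2 = D n. Proof. by rewrite sqr_sqrtr// ltW. Qed.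
Let sg := Num.sqrt c.
Let sg0 : 0 <= sg. Proof. exact: sqrtr_ge0. Qed.

Lemma Rintegral_null_measure (f : R -> R) : \int[F]_x f x = 0.
Proof.
rewrite /Rintegral (eq_measure_integral (@mzero _ RM R)) => [|A mA _]; last exact: F0.
by rewrite integral_measure_zero.
Qed.

(** The scaled law is exactly normal, since its cosine integrals are those of a normal law.
    Uniqueness is obtained by applying [borel_convergence] to a constant sequence. *)
Lemma gauss_zoom_no_jump n (f : R -> R) (K : R) : measurable_fun setT f ->
  (forall x, `|f x| <= K) ->
  \int[gauss_zoom X D n]_y f y = \int[N]_z f (b * s n + sg * z).
Proof.
move=> mf fK.
have cfE u a : \int[gauss_zoom X D n]_x cos (u * x - a) = \int[affine_normal (b * s n) sg]_x cos (u * x - a).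
  have sg2 : sg ^+ 2 = c by rewrite sqr_sqrtr// ltW.
  rewrite (gauss_zoom_cos D0 charX) affine_normal_cos sg2 -/(s n).
  rewrite /exponent_re /exponent_im !Rintegral_null_measure !addr0.
  by congr (expR (- _) * cos (_ - a)); field; rewrite gt_eqF.
have := @borel_convergence R c (fun=> gauss_zoom X D n) (affine_normal (b * s n) sg) c0
  (fun=> gauss_zoom_dominated D0 charX n) (@affine_normal_dominated R c c0 (b * s n)) _ f K mf fK.
rewrite /affine_normal (Rintegral_law N (measurable_affine_law (b * s n) sg) mf fK) => h.
have hc u a : \int[gauss_zoom X D n]_x cos (u * x - a) @[_ --> \oo] -->
    \int[affine_normal (b * s n) sg]_x cos (u * x - a) by rewrite cfE; exact: cvg_cst.
by rewrite -(cvg_lim _ (h hc))// lim_cst.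
Qed.

(** The equivalence at 0 and boundedness give |f| <= C |x|^r on the whole line, so the rescaled
    integrands are dominated by a power of an affine function of |z|, which is integrable for the
    normal law whatever r > 0. *)
Lemma power_moment_no_jump (r K : R) (f : R -> R) : 0 < r ->
  measurable_fun setT f -> (forall x, `|f x| <= K) ->
  (forall e : R, 0 < e -> exists2 d : R, 0 < d &
    forall x : R, `|x| < d -> `|f x - `|x| `^ r| <= e * `|x| `^ r) ->
  (s n `^ r)^-1 * \int[marginal X (D n)]_x f x @[n --> \oo] --> sg `^ r * gauss_moment r.
Proof.
move=> r0 mf fK fr; rewrite -(gauss_moment_scale r0 sg0).
have K0 : 0 <= K by apply: le_trans (fK 0).
have [d1 d10 hd1] := fr 1 ltr01.
have dr : 0 < d1 `^ r by exact: powR_gt0.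
pose C := 2 + K / d1 `^ r.
have C0 : 0 <= C by rewrite addr_ge0// divr_ge0// ltW.
have fC (x : R) : `|f x| <= C * `|x| `^ r.
  have xr := powR_ge0 `|x| r; have [xd|xd] := ltP `|x| d1.
    have := hd1 x xd; rewrite mul1r => h.
    apply: (@le_trans _ _ (2 * `|x| `^ r)).
      rewrite -[f x](subrK (`|x| `^ r)) (le_trans (ler_normD _ _))//.
      by rewrite [ `|_ `^ _| ]ger0_norm// mulr_natl mulr2n lerD2r.
    by rewrite ler_wpM2r// lerDl divr_ge0// ltW.
  have h : d1 `^ r <= `|x| `^ r by rewrite ge0_ler_powR ?nnegrE ?(ltW r0) ?(ltW d10).
  apply: (le_trans (fK x)); apply: (@le_trans _ _ (K / d1 `^ r * `|x| `^ r)).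
    by rewrite mulrAC ler_pdivlMr// ler_wpM2l.
  by rewrite ler_wpM2r// lerDr.
have [B hB] := cvg_seq_ubound (sqrt_cvg0 Dc).
have B0 : 0 <= B by apply: le_trans (hB 0%N).
pose x n (z : R) := s n * (b * s n + sg * z).
have mx n : measurable_fun setT (x n).
  apply: measurable_funM => //; exact: measurable_affine.
have -> : (fun n => (s n `^ r)^-1 * \int[marginal X (D n)]_x f x) =
    (fun n => \int[N]_z ((s n `^ r)^-1 * f (x n z))).
  apply/funext => n; rewrite (gauss_zoom_integral X D0 n mf fK).
  have mfs : measurable_fun setT (fun y : R => f (s n * y)).
    by apply: (measurableT_comp mf); exact: measurable_funM.
  rewrite (gauss_zoom_no_jump n mfs (fun y => fK (s n * y))).
  have mfx : measurable_fun setT (fun z => f (x n z)) by exact: (measurableT_comp mf (mx n)).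
  by rewrite (RintegralZl _ measurableT (finite_bounded_integrable N mfx (fun z => fK (x n z)))).
have normx n z : `|x n z| `^ r = s n `^ r * `|b * s n + sg * z| `^ r.
  by rewrite /x normrM (gtr0_norm (s0 n)) powRM ?(ltW (s0 n)).
have yc (z : R) : b * s n + sg * z @[n --> \oo] --> sg * z.
  rewrite -[X in _ --> X]add0r -[X in X + _](mulr0 b); apply: cvgD; last exact: cvg_cst.
  by apply: cvgM; [exact: cvg_cst|exact: sqrt_cvg0].
apply: (@Rintegral_dominated_cvg _ _ _ N (fun n z => (s n `^ r)^-1 * f (x n z)) _
  (fun z => C * (`|b| * B + sg * `|z|) `^ r)).
- by move=> n; apply: measurable_funM => //; exact: (measurableT_comp mf (mx n)).
- move=> z.
  have pc : `|b * s n + sg * z| `^ r @[n --> \oo] --> `|sg * z| `^ r.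
    exact: (cvg_comp _ _ (yc z) (@continuous_norm_powR R r r0 (sg * z))).
  have xc : x n z @[n --> \oo] --> 0.
    by rewrite -[X in _ --> X](mul0r (sg * z)); apply: cvgM; [exact: sqrt_cvg0|exact: yc].
  suff h : (s n `^ r)^-1 * f (x n z) - `|b * s n + sg * z| `^ r @[n --> \oo] --> 0.
    rewrite -[X in _ --> X]add0r.
    rewrite (_ : (fun n => _) = (fun n => ((s n `^ r)^-1 * f (x n z) - `|b * s n + sg * z| `^ r) +
      `|b * s n + sg * z| `^ r)); first exact: (cvgD h pc).
    by apply/funext => n; rewrite subrK.
  have [L hL] := cvg_seq_ubound pc.
  have L0 : 0 <= L by apply: le_trans (hL 0%N).
  apply/cvgrPdist_le => e e0.
  have e1 : 0 < e / (L + 1) by rewrite divr_gt0// ltr_wpDl.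
  have [d2 d20 hd2] := fr _ e1.
  move/cvgrPdist_lt : xc => /(_ _ d20); apply: filterS => n; rewrite !sub0r !normrN => xn.
  have sr : 0 < s n `^ r by exact: powR_gt0.
  have := hd2 _ xn; rewrite normx => h.
  rewrite (_ : _ - _ = (s n `^ r)^-1 * (f (x n z) - s n `^ r * `|b * s n + sg * z| `^ r)); last first.
    by rewrite mulrBr mulKf ?gt_eqF.
  rewrite normrM gtr0_norm ?invr_gt0// ler_pdivrMl//; apply: (le_trans h).
  rewrite mulrCA ler_pM2l//; apply: (@le_trans _ _ (e / (L + 1) * L)).
    by rewrite ler_wpM2l ?(ltW e1)// (le_trans (ler_norm _)).
  by rewrite mulrAC ler_pdivrMr ?ltr_wpDl// ler_wpM2l ?(ltW e0)// lerDl.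
- by apply: integrableZl_EFin; apply: integrable_normal_powR => //; rewrite mulr_ge0.
- move=> n z; have sr : 0 < s n `^ r by exact: powR_gt0.
  rewrite normrM gtr0_norm ?invr_gt0// ler_pdivrMl//; apply: (le_trans (fC _)).
  rewrite normx mulrCA ler_pM2l// ler_wpM2l//.
  rewrite ge0_ler_powR ?nnegrE ?(ltW r0) ?addr_ge0 ?mulr_ge0//.
  rewrite (le_trans (ler_normD _ _))// !normrM (ger0_norm sg0) lerD2r ler_wpM2l//.
  exact: hB.
Qed.

(** When r > 2 the normalisation n D^(r/2) may stay bounded, and f^2 <= K |f| no longer controls the
    variance. Instead f^2 is equivalent to |x|^(2r), its mean is of order D^r, and the variance term
    is of order 1/n. *)
Lemma levy_limit_ii_no_jump (r : R) (f : R -> R) :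
  0 < r -> bounded_fun f -> classE r f ->
  cvg_ucp P (fun n t w => (n%:R * D n `^ (r / 2))^-1 * Vbar X D f n t w)
    (fun t _ => c `^ (r / 2) * gauss_moment r * t).
Proof.
move=> r0 /bounded_fun_le [K fK] fE.
have mf : measurable_fun setT f by case: fE.
have K0 : 0 <= K by apply: le_trans (fK 0).
have mf' : measurable_fun setT (fun x => `|f x|) by exact: measurableT_comp.
have fK' x : `| `|f x| | <= K by rewrite normr_id.
have mf2 : measurable_fun setT (fun x => f x ^+ 2) by exact: measurable_funX.
have fK2 x : `|f x ^+ 2| <= K ^+ 2 by rewrite normrX lerXn2r ?nnegrE.
have fr := classE_le fE.
have fr' (e : R) : 0 < e -> exists2 d : R, 0 < d &
    forall x : R, `|x| < d -> `| `|f x| - `|x| `^ r| <= e * `|x| `^ r.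
  move=> e0; have [d' d0 hd] := fr e e0; exists d' => // x xd.
  rewrite -[X in `|_ - X|](ger0_norm (powR_ge0 _ _)); exact: le_trans (ler_dist_dist _ _) (hd x xd).
have fr2 (e : R) : 0 < e -> exists2 d : R, 0 < d &
    forall x : R, `|x| < d -> `|f x ^+ 2 - `|x| `^ (r + r)| <= e * `|x| `^ (r + r).
  (* With q = |x|^r, f^2 - q^2 = (f - q)(f + q), and |f + q| <= 3q when the relative error is at
     most 1. *)
  move=> e0; pose e' := Num.min 1 (e / 3).
  have e'0 : 0 < e' by rewrite lt_min ltr01 divr_gt0.
  have [d' d0 hd] := fr e' e'0; exists d' => // x xd; have := hd x xd.
  have x0 := powR_ge0 `|x| r.
  rewrite powRD; last by rewrite gt_eqF// addr_gt0.
  have : e' <= 1 /\ e' <= e / 3 by rewrite !ge_min !lexx orbT.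
  move: (f x) (`|x| `^ r) x0 => p q q0 [e1 e3] h.
  rewrite -expr2 subr_sqr normrM.
  have hp : `|p + q| <= 3 * q.
    rewrite (_ : p + q = (p - q) + 2 * q); last by ring.
    rewrite (le_trans (ler_normD _ _))// [ `|2 * q| ]ger0_norm ?mulr_ge0//.
    by have := ler_wpM2r q0 e1; lra.
  apply: (@le_trans _ _ (e' * q * (3 * q))); first by rewrite ler_pM.
  have := ler_wpM2r (mulr_ge0 q0 q0) e3; rewrite expr2; lra.
have aE n : D n `^ (r / 2) = s n `^ r by rewrite powR_half// ltW.
have a0 n : 0 < D n `^ (r / 2) by exact: powR_gt0.
have m1 := power_moment_no_jump r0 mf fK fr.
have m1' := power_moment_no_jump r0 mf' fK' fr'.
have m2 := power_moment_no_jump (addr_gt0 r0 r0) mf2 fK2 fr2.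
have [B hB] := cvg_seq_ubound m1'.
apply: (levy_ucp levyX D0 (f := fun=> f) (K := K) (B := B) (fun=> mf) (fun=> fK) a0).
- have cE : c `^ (r / 2) = sg `^ r by apply: powR_half; exact: ltW.
  have fE' : (fun n => (\int[marginal X (D n)]_x f x) / D n `^ (r / 2)) =
      (fun n => (s n `^ r)^-1 * \int[marginal X (D n)]_x f x).
    by apply/funext => n; rewrite aE mulrC.
  by rewrite cE fE'; exact: m1.
- move=> n; rewrite aE; have := le_trans (ler_norm _) (hB n).
  by rewrite ler_pdivrMl ?powR_gt0// mulrC.
- rewrite (_ : (fun n => _) = (fun n => ((s n `^ (r + r))^-1 * \int[marginal X (D n)]_x (f x ^+ 2)) * n%:R^-1)).
    rewrite -[X in _ --> X](mulr0 (sg `^ (r + r) * gauss_moment (r + r))); apply: cvgM => //.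
    apply/gtr0_cvgV0; last exact: cvgr_idn.
    by exists 1%N => // n /= n0; rewrite ltr0n.
  apply/funext => n; rewrite aE powRD; last by rewrite gt_eqF// addr_gt0.
  by rewrite -expr2 invfM mulrCA [RHS]mulrC; congr (_ * _); exact: mulrC.
Qed.

End LevyNoJump.

Unset Implicit Arguments.
Unset Strict Implicit.

Theorem theorem3p1 (R : realType) (d : measure_display) (T : measurableType d)
    (P : probability T R) (X : R -> {RV P >-> R})
    (b c : R) (F : {measure set (measurableTypeR R) -> \bar R})
    (Delta : nat -> R)
    (levyX : is_levy_process X)
    (charX : has_characteristics X b c F)
    (Delta_gt0 : forall n, 0 < Delta n)
    (Delta_cvg0 : Delta n @[n --> \oo] --> 0)
    (Tn_cvgy : n%:R * Delta n @[n --> \oo] --> +oo) :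
  (forall f : R -> R, bounded_fun f ->
     [\/ (classE'' 2 `&` C0F F) f,
         (exists r : R, [/\ I_set F r, 1 < r < 2 & (classE' r `&` C0F F) f])
           /\ c = 0,
         [/\ (classE'' 1 `&` C0F F) f, I_set F 1 & c = 0] |
         (exists r : R, [/\ I_set F r, 0 < r <= 1 & (classE' r `&` C0F F) f])
           /\ (c = 0 /\ bbar F b = 0)] ->
     cvg_ucp P (fun n t w => (n%:R * Delta n)^-1 * Vbar X Delta f n t w)
               (fun t _ => (\int[F]_x f x) * t))
  /\
  (forall f : R -> R, bounded_fun f -> (classE 2 `&` C0F F) f ->
     cvg_ucp P (fun n t w => (n%:R * Delta n)^-1 * Vbar X Delta f n t w)
               (fun t _ => (\int[F]_x f x + c) * t))
  /\
  (forall f : R -> R, bounded_fun f -> (classE 1 `&` C0F F) f ->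
     c = 0 -> I_set F 1 ->
     cvg_ucp P (fun n t w => (n%:R * Delta n)^-1 * Vbar X Delta f n t w)
               (fun t _ => (\int[F]_x f x + `|bbar F b|) * t))
  /\
  (forall (r : R) (f : R -> R), 0 < c -> bounded_fun f -> classE r f ->
     0 < r < 2 \/ (2 <= r /\ forall A, measurable A -> F A = 0%E) ->
     cvg_ucp P (fun n t w => (n%:R * Delta n `^ (r / 2))^-1 * Vbar X Delta f n t w)
               (fun t _ => c `^ (r / 2) * gauss_moment r * t))
  /\
  (forall f : R -> R, 0 < c -> bounded_fun f -> borel f ->
     cvg_ucp P (fun n t w => n%:R^-1 * Vbar' X Delta f n t w)
               (fun t _ => t * gauss_mean (fun u => f (Num.sqrt c * u)))).
Proof.
have [h1 [h2 h3]] := levy_limit_i levyX Delta_gt0 charX Delta_cvg0 Tn_cvgy.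
split; first exact: h1.
split; first exact: h2.
split; first exact: h3.
split=> [r f c0 bf fE [r02|[r2 F0]]|f c0 bf mf].
- exact: (levy_limit_ii_small levyX Delta_gt0 Delta_cvg0 charX c0 Tn_cvgy r02 bf fE).
- apply: (levy_limit_ii_no_jump levyX Delta_gt0 Delta_cvg0 charX c0 F0 _ bf fE).
  exact: lt_le_trans r2.
- exact: (levy_limit_iii levyX Delta_gt0 Delta_cvg0 charX c0 bf mf).
Qed.
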